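(* Let $T:\mathcal{H}_1\to\mathcal{H}_1'$ and $T':\mathcal{H}_2\to\mathcal{H}_2'$ be bounded linear operators with dense image between complex Hilbert spaces. Let $\mathcal{M}$ be an eigenvalue sequence with infinity intermissions of $T$, and let $\mathcal{M}'$ be an eigenvalue sequence with infinity intermissions of $T'$. Then $T$ and $T'$ are topologically equivalent if and only if $\mathcal{M}'$ can be obtained from $\mathcal{M}$ by a uniformly log-bounded shift.
   Context: Two bounded operators $T_1:X_1\to Y_1$ and $T_2:X_2\to Y_2$ between Banach spaces are topologically equivalent if there exist isomorphisms onto (bounded linear bijections with bounded inverse) $U:X_1\to X_2$ and $V:Y_1\to Y_2$ such that $T_2=VT_1U^{-1}$. For a bounded linear operator $T:\mathcal{H}\to\mathcal{H}'$ between complex Hilbert spaces, let $A=\sqrt{T^\star T}$ and let $\mathcal{E}$ be its spectral measure, a projection-valued measure on the Borel subsets of $[0,\infty[$ with $A=\int_{[0,\infty[}\lambda\,d\mathcal{E}(\lambda)$. The dimension spectral measure of $T$ is the cardinal-number-valued ($\sigma$-additive, with cardinal sums) measure $\mathcal{D}_T(S)=\dim\mathcal{E}(S)\mathcal{H}$ on Borel sets $S\subset[0,\infty[$, where $\dim$ is the Hilbert dimension (the cardinality of an orthonormal basis). Uniformly log-bounded shift (transfer of masses to uniformly log-bounded-ly distant places): for cardinal-number-valued $\sigma$-additive measures $\mathcal{M},\mathcal{M}'$ on the Borel subsets of $[0,\infty[$, we say that $\mathcal{M}'$ is obtained from $\mathcal{M}$ by a uniformly log-bounded shift if there are a constant $K>1$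 and a cardinal-number-valued $\sigma$-additive measure $\mathcal{N}$ on the Borel subsets of $[0,\infty[\times[0,\infty[$ such that $\mathcal{N}(S\times[0,\infty[)=\mathcal{M}(S)$ and $\mathcal{N}([0,\infty[\times S)=\mathcal{M}'(S)$ for all Borel $S\subset[0,\infty[$, and $\mathcal{N}$ gives weight $0$ to the complement of $\{(0,0)\}\cup\{(x,y): x,y>0,\ K^{-1}\le y/x\le K\}$. (Here $\mathcal{N}$ records which mass is transferred from where to where; mass at $0$ stays at $0$. Special cases: transferring $1$-masses from points $\lambda_k$ to $\gamma_k\lambda_k$ with $K^{-1}\le\gamma_k\le K$; and transferring, for each member $S_k$ of a countable Borel partition of $]0,\infty[$, all the mass of $S_k$ to a point $a_k>0$, where all quotients of two elements of $S_k\cup\{a_k\}$ lie in $[K^{-1},K]$ with $K$ independent of $k$.) The relation is symmetric in $\mathcal{M},\mathcal{M}'$. Eigenvalue sequence with infinity intermissions of $T$: a cardinal-number-valued $\sigma$-additive measure $\mathcal{M}$ obtained from $\mathcal{D}_T$ by a uniformly log-bounded shift and concentrated on a set $\{0\}\cup\{\lambda_k: k\ge 1\}$, where $(\lambda_k)$ is a strictly decreasing sequence of positive numbers tending to $0$ with $\lambda_k/\lambda_{k+1}\ge K_0$ for all $k$, for some fixed $K_0>1$. Equivalently, it is the data of the points among $0,\lambda_k$ having infinite weight together with their (infinite cardinal) weights (the ''infinity intermissions''), and the points of finite weight arranged as a non-increasing sequence of eigenvalues in which a point of weight $n$ is repeated $n$ times. Every such $T$ admits such an $\mathcal{M}$;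 it is not unique. *)

(* Defs.v *)
From HB Require Import structures.
From mathcomp Require Import all_boot all_order all_algebra.
From mathcomp Require Import all_classical all_reals all_analysis.
From mathcomp Require Import complex.
Import Order.TTheory GRing.Theory Num.Theory.
Import numFieldNormedType.Exports.

Set Implicit Arguments.
Unset Strict Implicit.
Unset Printing Implicit Defensive.

Local Open Scope classical_set_scope.
Local Open Scope card_scope.
Local Open Scope ring_scope.
Local Open Scope complex_scope.

(* A complex Hilbert space is a complete normed space over R[i] whose norm
   comes from an inner product, linear in its first argument. *)
HB.mixin Record isHilbert (R : realType) (H : Type)
    & CompleteNormedModule R[i] H := {
  hdot : {dot H for (@Num.conj R[i])} ;
  hdot_norm : forall x : H, `|x| ^+ 2 = hdot x x
}.

#[short(type="hilbertType")]
HB.structure Definition Hilbert (R : realType) :=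
  { H of CompleteNormedModule R[i] H & isHilbert R H }.

Section operators.
Variable R : realType.

Definition bounded_operator (X Y : normedModType R[i]) (T : {linear X -> Y}) :=
  exists c : R[i], forall x, `|T x| <= c * `|x|.

Definition isomorphism_onto (X Y : completeNormedModType R[i])
    (U : {linear X -> Y}) (Uinv : {linear Y -> X}) :=
  [/\ bounded_operator U, bounded_operator Uinv,
      cancel U Uinv & cancel Uinv U].

Definition topologically_equivalent (X1 Y1 X2 Y2 : completeNormedModType R[i])
    (T1 : {linear X1 -> Y1}) (T2 : {linear X2 -> Y2}) :=
  exists (U : {linear X1 -> X2}) (Uinv : {linear X2 -> X1})
         (V : {linear Y1 -> Y2}) (Vinv : {linear Y2 -> Y1}),
    [/\ isomorphism_onto U Uinv, isomorphism_onto V Vinv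
      & forall x, T2 x = V (T1 (Uinv x))].

Definition adjoint (H H' : hilbertType R)
    (T : {linear H -> H'}) (Tstar : {linear H' -> H}) :=
  forall x y, hdot (T x) y = hdot x (Tstar y).

Definition positive_operator (H : hilbertType R) (A : {linear H -> H}) :=
  [/\ bounded_operator A, adjoint A A & forall x, 0 <= hdot (A x) x].

(* A is the positive square root of T^* T. *)
Definition is_modulus (H H' : hilbertType R)
    (T : {linear H -> H'}) (A : {linear H -> H}) :=
  positive_operator A /\
  exists Tstar : {linear H' -> H},
    [/\ bounded_operator Tstar, adjoint T Tstar
      & forall x, A (A x) = Tstar (T x)].

Definition orthogonal_projection (H : hilbertType R) (P : {linear H -> H}) :=
  [/\ bounded_operator P, adjoint P P & forall x, P (P x) = P x].

(* The carrier measurableTypeR R has the Borel sigma-algebra of the line. *)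
Definition halfline : set (measurableTypeR R) := [set t : R | 0 <= t].

Definition borel_halfline (S : set (measurableTypeR R)) :=
  measurable S /\ S `<=` halfline.

(* The values of E outside the Borel subsets of [0,oo[ are irrelevant. *)
Record projection_valued_measure (H : hilbertType R)
    (E : set (measurableTypeR R) -> {linear H -> H}) : Prop := {
  pvm_proj : forall S, borel_halfline S -> orthogonal_projection (E S) ;
  pvm_set0 : forall x, E set0 x = 0 ;
  pvm_setT : forall x, E halfline x = x ;
  pvm_setI : forall S S', borel_halfline S -> borel_halfline S' ->
    forall x, E (S `&` S') x = E S (E S' x) ;
  pvm_sigma_additive : forall F : nat -> set (measurableTypeR R),
    (forall k, borel_halfline (F k)) -> trivIset setT F ->
    forall x, (fun n => \sum_(k < n) E (F k) x) @ \oo --> E (\bigcup_k F k) x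
}.

(* E is the spectral measure of the positive operator A, that is,
   A = \int_[0,oo[ t dE(t).  The operator integral is taken in the usual weak
   sense: <A x, x> is the integral of t against the positive measure
   S |-> <E S x, x>. *)
Definition is_spectral_measure (H : hilbertType R) (A : {linear H -> H})
    (E : set (measurableTypeR R) -> {linear H -> H}) :=
  projection_valued_measure E /\
  forall x : H, exists2 mu : {measure set (measurableTypeR R) -> \bar R},
    (forall S, measurable S ->
       mu S = (complex.Re (hdot (E (S `&` halfline) x) x))%:E) &
    ((complex.Re (hdot (A x) x))%:E = \int[mu]_(t in halfline) (t : R)%:E)%E.

Definition lin_span (H : hilbertType R) (B : set H) : set H :=
  [set x | exists (s : seq H) (c : H -> R[i]),
     (forall b, b \in s -> B b) /\ x = \sum_(b <- s) c b *: b].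

Definition orthonormal_set (H : hilbertType R) (B : set H) :=
  forall b b', B b -> B b' -> hdot b b' = (b == b')%:R.

Definition orthonormal_basis (H : hilbertType R) (F B : set H) :=
  orthonormal_set B /\ closure (lin_span B) = F.

(* Cardinal numbers are represented by types, and equality of cardinals by the
   equipotence of the corresponding full sets. *)
Definition same_cardinal (k k' : Type) : Prop := [set: k] #= [set: k'].

Definition hilbert_dim (H : hilbertType R) (F : set H) (k : Type) :=
  exists2 B : set H, orthonormal_basis F B & [set: k] #= B.

Definition is_dim_spectral_measure (H H' : hilbertType R)
    (T : {linear H -> H'}) (D : set (measurableTypeR R) -> Type) :=
  exists (A : {linear H -> H}) (E : set (measurableTypeR R) -> {linear H -> H}),
    [/\ is_modulus T A, is_spectral_measure A E
      & forall S, borel_halfline S -> hilbert_dim (range (E S)) (D S)].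

End operators.

(* Sigma-additive cardinal-valued measures on the measurable subsets of D.
   M set0 = 0 has to be imposed: sigma-additivity alone would also allow
   M set0 to be infinite. *)
Record cardinal_measure d (X : measurableType d) (D : set X)
    (M : set X -> Type) : Prop := {
  cardinal_measure0 : M set0 -> False ;
  cardinal_measure_sigma_additive : forall F : nat -> set X,
    (forall k, measurable (F k) /\ F k `<=` D) -> trivIset setT F ->
    same_cardinal (M (\bigcup_k F k)) {k : nat & M (F k)}
}.

Section shifts.
Variable R : realType.
Local Notation bR := (measurableTypeR R).
Local Notation halfline := (@halfline R).

Definition log_bounded_region (K : R) : set (bR * bR) :=
  [set p | p = (0, 0) \/
     [/\ (0 : R) < p.1, (0 : R) < p.2
       & K^-1 <= (p.2 : R) / p.1 <= K]].

(* The sigma-algebra on bR * bR is the product one, which is the Borel one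
   since the line is second countable. *)
Definition log_bounded_shift (M M' : set bR -> Type) :=
  exists (K : R) (N : set (bR * bR) -> Type),
    [/\ 1 < K,
        cardinal_measure (halfline `*` halfline) N,
        forall S, borel_halfline S ->
          same_cardinal (N (S `*` halfline)) (M S),
        forall S, borel_halfline S ->
          same_cardinal (N (halfline `*` S)) (M' S)
      & N ((halfline `*` halfline) `\` log_bounded_region K) -> False].

Definition eigenvalue_sequence (H H' : hilbertType R)
    (T : {linear H -> H'}) (M : set bR -> Type) :=
  cardinal_measure halfline M /\
  (exists2 D : set bR -> Type,
     is_dim_spectral_measure T D & log_bounded_shift D M) /\
  exists (lam : nat -> R) (K0 : R),
    [/\ forall k, 0 < lam k,
        forall k, lam k.+1 < lam k,
        lam @ \oo --> (0 : R),
        1 < K0 /\ (forall k, K0 <= lam k / lam k.+1)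
      & M (halfline `\` ([set (0 : R)] `|` range lam)) -> False].

End shifts.

(* Main.v *)
(* Two operators with dense image are equivalent iff an isomorphism U of the
   initial spaces makes |T' U x| comparable to |T x|: V is then the extension of
   T x |-> T' U x. Everything is therefore read off the spectral projections of
   the moduli, and the pivot is the condition that, up to a factor K in the
   endpoints, each spectral interval of one measure has at most the mass of the
   enlarged interval of the other, in both directions, the masses at 0 being
   equal. A shift obviously implies it.

   If T' U is comparable to T, let F1 be the spectral subspace of T on [0,a] and
   F2 the one on [0,b]. The compression of U to the spectral subspace of T' on
   [0,Cb] is bounded below on F2, and no nonzero vector of the one on
   [0,a/C] is orthogonal to U F1; hence F2/F1 embeds in the spectral subspace on
   ]a/C,Cb]. This handles finite and infinite dimensions alike.

   Conversely, cut the half-line into geometric bands. The interval condition is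
   Hall's condition for matching points of neighbouring bands. Near a band of
   infinite mass there is room for everything (k * aleph_0 = k), and between
   such bands an explicit greedy formula solves the finite problem; this gives
   injections both ways, and Cantor-Bernstein preserves the bound on the
   displacement. Matching the atoms of M and M' gives a shift; matching
   orthonormal bases adapted to the bands gives U. *)

Require Import Defs.
From HB Require Import structures.
From mathcomp Require Import all_boot all_order all_algebra.
From mathcomp Require Import all_classical all_reals all_analysis.
From mathcomp Require Import measurable_realfun complex zify ring lra.
Import Order.TTheory GRing.Theory Num.Theory.
Import numFieldNormedType.Exports.

Set Implicit Arguments.
Unset Strict Implicit.
Unset Printing Implicit Defensive.

Local Open Scope classical_set_scope.
Local Open Scope card_scope.
Local Open Scope nat_scope.

(** * Matching two families level by level *)

(** The obstacle is the coexistence of finite and infinite masses: infinite ones swallow countably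
    many neighbours but cannot be counted, finite ones must be counted exactly and leave no room. A
    level is therefore handled by counting only when every level it may be sent to is finite.

    Dimension spectral measures may be diffuse and are never coupled with each other; that would
    require building a joint measure on the quadrant. Only the atomic [M] and [M'] are coupled: a
    bijection of their atoms, together with the pairs of positions, already is such a joint measure.
    On the operator side the same bijection concerns basis vectors, so one combinatorial statement
    about two families with levels in [nat] serves both purposes.

    One-sided levels suffice because all measures involved vanish above some [c]. Level numbers grow
    towards 0, which no band contains, and the mass at 0 is matched separately. *)

Lemma card_le_funP T U (A : set T) (B : set U) :
  A #<= B <-> exists f : A -> B, injective f.
Proof.
split=> [/card_leP[f]|[f fI]]; first by exists f => x y; apply: inj; rewrite inE.
by apply/card_leP; have [|g _] := @Pinj _ _ [set: A] f; [by move=> x y _ _ /fI|squash (totalfun_ [set: A] g)].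
Qed.

Lemma card_leTP T U (A : set T) :
  A #<= [set: U] <-> exists f : A -> U, injective f.
Proof.
split=> [/card_le_funP[f fI]|[f fI]].
  by exists (fun x => val (f x)) => x y /val_inj/fI.
apply/card_le_funP; exists (fun x => exist _ (f x) (in_setT (f x))) => x y.
by move=> /(congr1 val)/fI.
Qed.

Lemma card_leTTP T U :
  [set: T] #<= [set: U] <-> exists f : T -> U, injective f.
Proof.
split=> [/card_leTP[f fI]|[f fI]].
  exists (fun x => f (exist _ x (in_setT x))) => x y /fI.
  by move=> /(congr1 val).
by apply/card_leTP; exists (fun x => f (val x)) => x y /fI/val_inj.
Qed.

Lemma card_le_intro T U (A : set T) (B : set U) (f : forall x, A x -> U) :
  (forall x (h : A x), B (f x h)) ->
  (forall x (h : A x) y (h' : A y), f x h = f y h' -> x = y) -> A #<= B.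
Proof.
move=> fB fI; apply/card_le_funP.
exists (fun x : A => SigSub (mem_set (fB _ (set_mem (valP x))))) => x y.
by move=> /(congr1 val) /= /fI/val_inj.
Qed.

(** By Zorn, take a maximal family of injective sequences with disjoint ranges. It misses only
    finitely many points, so [Y] is essentially a disjoint union of copies of [nat], and each copy
    absorbs a further factor [nat]. *)
Lemma infinite_card_prod_nat (Y : Type) : infinite_set [set: Y] ->
  exists e : Y * nat -> Y, injective e.
Proof.
move=> Yinf.
have [E [EI Etriv Emax]] :=
  ex_maximal_disjoint_subcollection (fun s : nat -> Y => range s)
    [set s : nat -> Y | injective s].
pose W := \bigcup_(s in E) range s.
have Rfin : finite_set (~` W).
  apply: contrapT => /infiniteP/card_le_funP[f fI].
  pose s n := val (f (exist _ n (in_setT n))).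
  have sI : injective s by move=> m n /val_inj/fI /(congr1 val).
  have sW n : ~ W (s n) by have := valP (f (exist _ n (in_setT n))); rewrite inE.
  have sE : ~ E s by move=> Es; apply: (sW 0%N); exists s.
  apply: (Emax (E `|` [set s])).
  - split; first by move=> x; left.
    by move=> /(_ s) /= H; apply: sE; apply: H; right.
  - by move=> x [/EI//|->].
  - move=> u v [Eu|->] [Ev|->] //.
    + exact: Etriv.
    + by move=> [y [uy [n _ yn]]]; elim: (sW n); exists u => //; rewrite yn.
    + by move=> [y [[n _ yn] vy]]; elim: (sW n); exists v => //; rewrite yn.
have [s0 Es0] : exists s, E s.
  apply: contrapT => nE; apply: Yinf; apply: sub_finite_set Rfin => y _ [s Es].
  by case: nE; exists s.
have /card_leTP[r rI] : ~` W #<= [set: nat] by apply: finite_set_countable.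
(* Every point is coded by a sequence and a position: points on a sequence get even positions, and
   the finite remainder goes to odd positions of the single sequence [s0]. *)
have c1 y : exists sn : (nat -> Y) * nat, E sn.1 /\
    ((exists n, sn.2 = n.*2 /\ y = sn.1 n) \/
     exists h : y \in ~` W, sn.2 = (r (exist _ y h)).*2.+1).
  have [[s Es [n _ sn]]|nW] := pselect (W y).
    by exists (s, n.*2); split=> //; left; exists n.
  have h : y \in ~` W by rewrite inE.
  by exists (s0, (r (exist _ y h)).*2.+1); split => //; right; exists h.
have [g gP] := choice c1.
have gI : injective g.
  move=> x y gxy; have [_ gx] := gP x; have [_ gy] := gP y.
  move: gx gy; rewrite gxy => -[[n [e1 ->]]|[h e1]] [[m [e2 e3]]|[h' e2]].
  - by rewrite [RHS]e3; congr (_ _); move: e1 e2; lia.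
  - by move: e1 e2; lia.
  - by move: e1 e2; lia.
  - have /rI/(congr1 val) : r (exist _ x h) = r (exist _ y h') by move: e1 e2; lia.
    by [].
have [p pI] : exists p : nat * nat -> nat, injective p.
  by exists pickle; apply: (pcan_inj pickleK).
exists (fun yn => (g yn.1).1 (p ((g yn.1).2, yn.2))) => -[y n] [z m] /= e.
have Eq : (g y).1 = (g z).1.
  apply: Etriv => /=; [exact: (gP y).1|exact: (gP z).1|].
  by exists ((g y).1 (p ((g y).2, n))); split; [|rewrite e]; eexists.
move: e; rewrite Eq => /(EI _ (gP z).1)/pI[e ->]; congr (_, _).
by apply: gI; case: (g y) (g z) Eq e => ? ? [? ?] /= -> ->.
Qed.

Section stacking.
Variables (Z : Type) (lev e : Z -> nat) (cnt : nat -> nat).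

Definition stack j := \sum_(k < j) cnt k.

Lemma stackS j : stack j.+1 = stack j + cnt j.
Proof. by rewrite /stack big_ord_recr. Qed.

Lemma leq_stack i j : i <= j -> stack i <= stack j.
Proof.
by elim: j => [|j IH]; [case: i|rewrite leq_eqVlt stackS => /predU1P[->|]];
  rewrite ?stackS // ltnS => /IH; lia.
Qed.

(** Putting finite levels end to end turns a window of levels into an interval of integers, so that
    matching windows becomes arithmetic on the partial sums [stack]. *)
Lemma stack_bij u v :
  (forall k, u <= k < v -> set_bij [set z | lev z = k] `I_(cnt k) e) ->
  set_bij [set z | u <= lev z < v] [set s | stack u <= s < stack v]
    (fun z => stack (lev z) + e z).
Proof.
move=> enum.
have lt z : u <= lev z < v -> e z < cnt (lev z).
  by move=> /enum[+ _ _] => /(_ z); apply.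
have mono z z' : u <= lev z < v -> lev z < lev z' ->
    stack (lev z) + e z < stack (lev z').
  by move=> /lt ez /leq_stack; rewrite stackS; lia.
split.
- move=> z /= uv; have := lt z uv; case/andP: uv => /leq_stack + /leq_stack.
  by rewrite stackS; lia.
- move=> z z' /set_mem /= zuv /set_mem /= z'uv ee.
  have [zz'|z'z|zz'] := ltngtP (lev z) (lev z').
  + by have := mono _ _ zuv zz'; lia.
  + by have := mono _ _ z'uv z'z; lia.
  have [_ inj _] := enum _ zuv; apply: inj; rewrite ?inE //=.
  by move: ee; rewrite zz'; lia.
- move=> s /= /andP[us sv].
  have [k [uk kv ks sk]] : exists k, [/\ u <= k, k < v, stack k <= s & s < stack k.+1].
    elim: v sv {enum lt mono} => [|v IH] sv.
      by move: us; have := @leq_stack 0 u; lia.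
    have [sv'|vs] := ltnP s (stack v).
      by have [k [? ? ? ?]] := IH sv'; exists k; split => //; lia.
    exists v; split => //; rewrite leqNgt; apply/negP => vu.
    by have := leq_stack vu; lia.
  have [_ _ sur] := enum k (introT andP (conj uk kv)).
  have /sur[z /= lz ez] : `I_(cnt k) (s - stack k) by rewrite /= stackS in sk *; lia.
  by exists z; [rewrite /= lz uk|rewrite lz ez; lia].
Qed.

Lemma stack_card u v :
  (forall k, u <= k < v -> set_bij [set z | lev z = k] `I_(cnt k) e) ->
  [set z | u <= lev z < v] #= `I_(stack v - stack u).
Proof.
move=> /stack_bij[fS fI fO]; apply/card_set_bijP.
exists (fun z => stack (lev z) + e z - stack u); split.
- by move=> z /fS /=; lia.
- move=> z z' zS z'S ee; apply: fI => //.
  by move: zS z'S => /set_mem/fS /= + /set_mem/fS /=; lia.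
- move=> s /= sv; have /fO[z zuv ez] :
    [set s | stack u <= s < stack v] (s + stack u) by rewrite /=; lia.
  by exists z => //; rewrite ez; lia.
Qed.

End stacking.

Lemma level_enum (Z : Type) (lev : Z -> nat) : exists (e : Z -> nat) (cnt : nat -> nat),
  forall k, finite_set [set z | lev z = k] ->
    set_bij [set z | lev z = k] `I_(cnt k) e.
Proof.
have c k : exists p : (Z -> nat) * nat, finite_set [set z | lev z = k] ->
    set_bij [set z | lev z = k] `I_p.2 p.1.
  have [[n /card_set_bijP[f fb]]|] := pselect (finite_set [set z | lev z = k]).
    by exists (f, n).
  (* The count of an infinite level is a default value; across such a level only the monotonicity of
     [stack] is ever used. *)
  by exists (cst 0, 0).
have [p pP] := choice c.
exists (fun z => (p (lev z)).1 z), (fun k => (p k).2) => k /pP[S I O]; split.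
- by move=> z zk; move: (S z zk); rewrite /= zk.
- move=> z z' zk z'k ee; apply: I => //.
  by move: zk z'k ee; rewrite !inE /= => -> ->.
- by move=> s /O[z zk <-]; exists z; rewrite //= zk.
Qed.

Section injection.
Variables (X Y : Type) (lX : X -> nat) (lY : Y -> nat).

Hypothesis hall : forall i j, i <= j ->
  [set x | i <= lX x < j.+1] #<= [set y | i.-1 <= lY y < j.+2].

Local Notation fin k := (finite_set [set y | lY y = k]).

(* The elements of a poor level will go to finite levels of [Y], the others to
   infinite levels, so that the two injections cannot collide. *)
Definition poor l := forall k, l.-1 <= k < l.+2 -> fin k.

Lemma fin_window a b : (forall k, a <= k < b -> fin k) ->
  finite_set [set y | a <= lY y < b].
Proof.
move=> fk; have -> : [set y | a <= lY y < b] =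
    \bigcup_(k in [set k | a <= k < b]) [set y | lY y = k].
  by apply/seteqP; split => [y /= ylt|y [k /= klt ->]] //; exists (lY y).
apply: bigcup_finite; last exact: fk.
by apply: (@sub_finite_set _ _ `I_b) => [k /=|]; [lia|exact: finite_II].
Qed.

Lemma poor_fin l : poor l -> finite_set [set x | lX x = l].
Proof.
move=> /fin_window; apply: card_le_finite; apply: card_le_trans (hall (leqnn l)).
by apply: subset_card_le => x /= ->; lia.
Qed.

Lemma poor_injection : exists f : X -> option Y,
  (forall x, poor (lX x) -> exists y, [/\ f x = Some y,
     (lX x).-1 <= lY y < (lX x).+2 & fin (lY y)]) /\
  (forall x x', poor (lX x) -> poor (lX x') -> f x = f x' -> x = x').
Proof.
have [eX [n Xenum]] := level_enum lX.
have [eY [m Yenum]] := level_enum lY.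
pose NX := stack n; pose NY := stack m.
(* A constraint from the levels [i..l] only makes sense when no infinite level
   of [Y] intervenes. The element of rank [a] in level [l] takes slot [h l + a],
   the earliest one compatible with all elements before it. *)
pose ok i l := `[< forall k, i.-1 <= k <= l -> fin k >].
pose h l := \max_(i < l.+1 | ok i l) (NY i.-1 + (NX l - NX i)).
(* Behind a poor level, the levels of an admissible range are poor too, so both sides of Hall's
   condition can be counted there. *)
have okpoor i l k : poor l -> ok i l -> i <= k <= l -> poor k.
  move=> pl /asboolP okl ikl j jk; have [jl|lj] := leqP j l.
    by apply: okl; lia.
  by apply: pl; lia.
have hallN i l : poor l -> ok i l -> i <= l -> NX l.+1 - NX i <= NY l.+2 - NY i.-1.
  move=> pl oki il; rewrite -card_le_II.
  rewrite -(card_le_eql (@stack_card _ lX eX n i l.+1 _)); last first.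
    by move=> k kil; apply/Xenum/poor_fin/(okpoor _ _ _ pl oki); lia.
  rewrite -(card_le_eqr (@stack_card _ lY eY m i.-1 l.+2 _)); first exact: hall.
  move=> k kil; apply: Yenum; have [kl|lk] := leqP k l.
    by move/asboolP: oki; apply; lia.
  by apply: pl; lia.
(* The slots of a poor level start inside its window: take [i = l] in the maximum. *)
have hA l : poor l -> NY l.-1 <= h l.
  move=> pl; have okl : ok (@ord_max l) l by apply/asboolP => k /= kl; apply: pl; lia.
  by apply: (@bigop.bigmax_sup _ (@ord_max l)) => //=; lia.
(* They also end inside the window: this is Hall's condition, applied to each [i] of the maximum. *)
have hB l : poor l -> h l + n l <= NY l.+2.
  move=> pl; suff : h l <= NY l.+2 - n l.
    have : ok l l by apply/asboolP => k /= kl; apply: pl; lia.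
    move=> /(hallN _ _ pl)/(_ (leqnn _)).
    have := @leq_stack m l.-1 l.+2; have := @stackS n l; rewrite -/NX -/NY; lia.
  apply/bigmax_leqP => i oki; have il : i <= l by rewrite -ltnS.
  have := hallN _ _ pl oki il.
  have := @leq_stack n i l il; have := @stackS n l.
  have := @leq_stack m i.-1 l.+2; rewrite -/NX -/NY; lia.
have hC l l' : l < l' -> poor l -> poor l' -> h l + n l <= h l'.
  move=> ll' pl pl'.
  (* If an infinite level [q] lies between [l] and [l'], poverty of both keeps their windows on
     different sides of [q]. Otherwise each [i] admissible for [l] remains admissible for [l'], and
     the term it contributes to [h l'] leaves room for all of level [l]. *)
  have [F|] := pselect (forall k, l <= k <= l' -> fin k); last first.
    move=> nF; have [q qll' qinf] : exists2 q, l <= q <= l' & ~ fin q.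
      by apply: contrapT => nq; apply: nF => k kll'; apply: contrapT => kinf; apply: nq; exists k.
    have lq : l.+2 <= q by rewrite leqNgt; apply/negP => ?; apply: qinf; apply: pl; lia.
    have ql' : q <= l'.-1.
      by rewrite leqNgt; apply/negP => ?; apply: qinf; apply: pl'; lia.
    have := hB l pl; have := hA l' pl'; have := @leq_stack m _ _ lq.
    have := @leq_stack m _ _ ql'; rewrite -/NX -/NY; lia.
  have step i : ok i l -> i <= l -> NY i.-1 + (NX l - NX i) + n l <= h l'.
    move=> oki il; have il' : i < l'.+1 by lia.
    have oki' : ok (Ordinal il') l'.
      apply/asboolP => k kil'; have [kl|lk] := leqP k l.
        by move/asboolP : oki; apply; move: kil' => /=; lia.
      by apply: F; move: kil' => /=; lia.
    apply: (@bigop.bigmax_sup _ (Ordinal il')) => //=.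
    have := @leq_stack n i l il; have := @stackS n l.
    have := @leq_stack n _ _ ll'; rewrite -/NX -/NY; lia.
  suff : h l <= h l' - n l.
    have : ok l l by apply/asboolP => k /= kl; apply: pl; lia.
    by move=> /step/(_ (leqnn _)); lia.
  by apply/bigmax_leqP => i oki; have := step i oki; have := ltn_ord i; lia.
pose s x := h (lX x) + eX x.
have ltX x : poor (lX x) -> eX x < n (lX x).
  by move=> /poor_fin/Xenum[+ _ _] => /(_ x); apply.
have sI x x' : poor (lX x) -> poor (lX x') -> s x = s x' -> x = x'.
  move=> px px'; rewrite /s => ss; have := ltX x px; have := ltX x' px'.
  have [ll'|l'l|ll'] := ltngtP (lX x) (lX x').
  - by have := hC _ _ ll' px px'; lia.
  - by have := hC _ _ l'l px' px; lia.
  move=> _ _; have [_ inj _] := Xenum _ (poor_fin px); apply: inj; rewrite ?inE //=.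
  by move: ss; rewrite ll'; lia.
have ex x : exists oy, poor (lX x) ->
    exists2 y, oy = Some y & (lX x).-1 <= lY y < (lX x).+2 /\ NY (lY y) + eY y = s x.
  have [px|] := pselect (poor (lX x)); last by exists None.
  have [|_ _ sur] := @stack_bij _ lY eY m (lX x).-1 (lX x).+2.
    by move=> k /px/Yenum.
  have /sur[y ylt ys] : [set s | stack m (lX x).-1 <= s < stack m (lX x).+2] (s x).
    have := hA _ px; have := hB _ px; have := ltX _ px.
    by rewrite /= /s -/NY; lia.
  by exists (Some y) => _; exists y.
have [f fP] := choice ex; exists f; split.
  move=> x px; have [y fy [yl ys]] := fP x px.
  by exists y; split => //; apply: px.
move=> x x' px px' ff; have [y fy [_ ys]] := fP x px.
have [y' fy' [_ ys']] := fP x' px'; apply: sI => //.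
by move: fy'; rewrite -ys -ys' -ff fy => -[->].
Qed.

(** Each infinite level of [Y] absorbs countably many copies of itself without changing level; on
    finite levels the value of [E] is a dummy. *)
Lemma level_absorb : exists E : Y * nat -> Y,
  (forall y n, ~ fin (lY y) -> lY (E (y, n)) = lY y) /\
  (forall y n y' n', ~ fin (lY y) -> ~ fin (lY y') ->
     E (y, n) = E (y', n') -> y = y' /\ n = n').
Proof.
have c q : exists e : {y : Y | lY y = q} * nat -> {y : Y | lY y = q},
    ~ fin q -> injective e.
  have [|qinf] := pselect (fin q); first by exists fst.
  have [|e eI] := @infinite_card_prod_nat {y : Y | lY y = q}; last by exists e.
  apply: contra_not qinf; apply: card_le_finite; apply/card_leTP.
  exists (fun y => exist _ (val y) (set_mem (valP y))) => y y' /(congr1 sval) /=.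
  exact: val_inj.
pose e q := projT1 (cid (c q)).
have eI q : ~ fin q -> injective (e q) := projT2 (cid (c q)).
exists (fun yn => sval (e (lY yn.1) (exist _ yn.1 erefl, yn.2))).
split=> [y n _|y n y' n' yi y'i] /=; first exact: (svalP (e _ _)).
have cast q (Q : lY y' = q) :
  sval (e (lY y') (exist _ y' erefl, n')) = sval (e q (exist _ y' Q, n')).
  by case: _ / Q.
have yy' : sval (e (lY y) (exist _ y erefl, n)) =
    sval (e (lY y') (exist _ y' erefl, n')) -> lY y' = lY y.
  move=> ee; rewrite -(svalP (e (lY y) (exist _ y erefl, n))) ee.
  by rewrite (svalP (e _ _)).
move=> ee; have Q := yy' ee; move: ee; rewrite (cast _ Q) => ee.
have : e (lY y) (exist _ y erefl, n) = e (lY y) (exist _ y' Q, n').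
  by apply: eq_sig_hprop => // ? ? ?; exact: Prop_irrelevance.
by move=> /(eI _ yi)[].
Qed.

(** The rich levels need no coordination: Hall's condition for one level at a time embeds it into
    its window, and the overlaps of countably many such embeddings are resolved by absorption. *)
Lemma level_injection : exists2 f : X -> Y, injective f &
  forall x, (lX x).-1 <= lY (f x) < (lX x).+2.
Proof.
have [p [pP pI]] := poor_injection.
have [E [Elev EI]] := level_absorb.
have [eY [m Yenum]] := level_enum lY.
have rich x : exists y, ~ poor (lX x) ->
    (lX x).-1 <= lY y < (lX x).+2 /\ ~ fin (lY y).
  have [px|/existsNP[k /not_implyP[kl kinf]]] := pselect (poor (lX x)).
    by have [y _] := pP x px; exists y.
  have [y yk] := infinite_setN0 kinf.
  by exists y => _; rewrite yk.
have [r rP] := choice rich.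
have win l : exists g : X -> option Y,
    (forall x, lX x = l -> exists2 y, g x = Some y & l.-1 <= lY y < l.+2) /\
    (forall x x', lX x = l -> lX x' = l -> g x = g x' -> x = x').
  have /card_le_funP[g gI] := hall (leqnn l).
  exists (fun x => if pselect (x \in [set x | l <= lX x < l.+1]) is left H
                   then Some (val (g (exist _ x H))) else None).
  split=> [x xl|x x' xl x'l].
    case: pselect => [H|[]]; last by rewrite inE /= xl leqnn ltnSn.
    by eexists; [reflexivity|exact: set_mem (valP (g _))].
  case: pselect => [H|[]]; last by rewrite inE /= xl leqnn ltnSn.
  case: pselect => [H' [/val_inj/gI[]]//|[]].
  by rewrite inE /= x'l leqnn ltnSn.
have [g gP] := choice win.
(* A finite-level image [y] of a rich [x] is moved into the infinite level of
   [r x]; the code keeps the relocated elements apart. *)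
pose code x y := if `[< fin (lY y) >] then pickle (lX x, Some (lY y, eY y))
                 else pickle (lX x, @None (nat * nat)).
pose base x y := if `[< fin (lY y) >] then r x else y.
have ex x : exists y, (poor (lX x) -> p x = Some y) /\
    (~ poor (lX x) -> exists2 z, g (lX x) x = Some z & y = E (base x z, code x z)).
  have [px|npx] := pselect (poor (lX x)).
    by have [y [? _ _]] := pP x px; exists y.
  by have [z gz _] := (gP (lX x)).1 x erefl; exists (E (base x z, code x z)); split => // _; exists z.
have [f fP] := choice ex.
have base_inf x z : ~ poor (lX x) -> ~ fin (lY (base x z)).
  by move=> /rP[_ ri]; rewrite /base; case: asboolP.
have f_inf x : ~ poor (lX x) -> ~ fin (lY (f x)).
  move=> npx; have [z _ ->] := (fP x).2 npx.
  by rewrite Elev; apply: base_inf.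
have f_fin x : poor (lX x) -> fin (lY (f x)).
  by move=> px; have [y [py _ yfin]] := pP x px; move: ((fP x).1 px); rewrite py => -[<-].
exists f; last first.
  move=> x; have [px|npx] := pselect (poor (lX x)).
    have [y [py ? _]] := pP x px.
    by move: ((fP x).1 px); rewrite py => -[<-].
  have [z gz ->] := (fP x).2 npx; rewrite Elev; last exact: base_inf.
  rewrite /base; case: asboolP => _; first by have [] := rP x npx.
  by have [z' + ?] := (gP (lX x)).1 x erefl; rewrite gz => -[->].
move=> x x' ff.
have [px|npx] := pselect (poor (lX x)); have [px'|npx'] := pselect (poor (lX x')).
- by apply: pI => //; rewrite (fP x).1 // (fP x').1 // ff.
- by case: (f_inf x' npx'); rewrite -ff; exact: f_fin.
- by case: (f_inf x npx); rewrite ff; exact: f_fin.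
have [z gz fz] := (fP x).2 npx; have [z' gz' fz'] := (fP x').2 npx'.
move: ff; rewrite fz fz' => /EI[||bb cc]; try exact: base_inf.
have [ll zz] : lX x = lX x' /\ z = z'.
  move: cc bb; rewrite /code /base; case: asboolP => zf; case: asboolP => zf'.
  - move=> /(pcan_inj pickleK) E1 _; case: E1 => ll lz ez; split=> //.
    have [_ inj _] := Yenum _ zf'; apply: inj; rewrite ?inE //=.
  - by move=> /(pcan_inj pickleK).
  - by move=> /(pcan_inj pickleK).
  - by move=> /(pcan_inj pickleK)[->].
by apply: (gP (lX x)).2 => //; rewrite gz ll gz' zz.
Qed.

End injection.

(** * Cantor-Bernstein with control of the displacement *)

Section Cantor_Bernstein_tracking.
Variables (X Y : Type) (P : X -> Y -> Prop).

(** The classical bijection uses at each point either [f] or the inverse of [g], so a relation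
    satisfied along both graphs survives. [C] collects the orbits of [g \o f] that start outside the
    range of [g]. *)
Lemma Cantor_Bernstein_rel (f : X -> Y) (g : Y -> X) :
  injective f -> injective g -> (forall x, P x (f x)) -> (forall y, P (g y) y) ->
  exists2 h : X -> Y, bijective h & forall x, P x (h x).
Proof.
move=> fI gI Pf Pg.
pose C := [set x | exists n x0, ~ (exists y, g y = x0) /\ x = iter n (g \o f) x0].
have ex x : exists y, (C x /\ y = f x) \/ (~ C x /\ g y = x).
  have [Cx|nCx] := pselect (C x); first by exists (f x); left.
  have [y gy] : exists y, g y = x.
    by apply: contrapT => ng; apply: nCx; exists 0, x.
  by exists y; right.
have [h hP] := choice ex.
have Cstep x : C x -> C (g (f x)).
  by move=> [n [x0 [? ->]]]; exists n.+1, x0.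
have Cback x : C (g (f x)) -> C x.
  move=> [[|n] [x0 [nx0 e]]]; first by case: nx0; exists (f x).
  by exists n, x0; split => //; apply/fI/gI.
exists h; last by move=> x; have [[_ ->]|[_ {1}<-]] := hP x.
have hI : injective h.
  move=> x x' hh; have := hP x; have := hP x'; rewrite hh.
  move=> [[Cx' ->]|[Cx' e]] [[Cx e']|[Cx e']].
  - exact/esym/fI.
  - by case: Cx; rewrite -e'; exact: Cstep.
  - by case: Cx'; rewrite -e e'; exact: Cstep.
  - by rewrite -e -e'.
have hO y : exists x, h x = y.
  have [Cy|nCy] := pselect (C (g y)).
    move: Cy => [[|n] [x0 [nx0 e]]]; first by case: nx0; exists y.
    exists (iter n (g \o f) x0); have [[_ ->]|[]] := hP (iter n (g \o f) x0).
      by apply: gI.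
    by case; exists n, x0.
  exists (g y); have [[]//|[_]] := hP (g y); exact: gI.
have [k kP] := choice hO; exists k => // x; exact: hI.
Qed.

End Cantor_Bernstein_tracking.

Lemma level_bijection (X Y : Type) (lX : X -> nat) (lY : Y -> nat) :
  (forall i j, i <= j ->
     [set x | i <= lX x < j.+1] #<= [set y | i.-1 <= lY y < j.+2]) ->
  (forall i j, i <= j ->
     [set y | i <= lY y < j.+1] #<= [set x | i.-1 <= lX x < j.+2]) ->
  exists2 h : X -> Y, bijective h &
    forall x, lX x <= (lY (h x)).+1 /\ lY (h x) <= (lX x).+1.
Proof.
move=> /level_injection[f fI fl] /level_injection[g gI gl].
apply: (@Cantor_Bernstein_rel _ _ (fun x y => lX x <= (lY y).+1 /\ lY y <= (lX x).+1) f g) => //.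
- by move=> x; have := fl x; lia.
- by move=> y; have := gl y; lia.
Qed.

Local Open Scope ring_scope.

(** * Cardinal measures and shifts *)

Lemma same_cardinalP (k k' : Type) :
  same_cardinal k k' <-> exists f : k -> k', bijective f.
Proof.
split=> [/card_bijP[f fb]|[f [g fK gK]]].
  have [g fK gK] := fb.
  exists (fun x => val (f (exist _ x (in_setT x)))).
  exists (fun y => val (g (exist _ y (in_setT y)))) => x.
    rewrite [X in g X](_ : _ = f (exist _ x (in_setT x))) ?fK //.
    exact: val_inj.
  rewrite [X in f X](_ : _ = g (exist _ x (in_setT x))) ?gK //.
  exact: val_inj.
apply: Cantor_Bernstein; apply/card_leTTP.
  by exists f; exact: can_inj fK.
by exists g; exact: can_inj gK.
Qed.

Lemma same_cardinal_sym (k k' : Type) : same_cardinal k k' -> same_cardinal k' k.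
Proof. exact: card_esym. Qed.

Lemma same_cardinal_trans (k1 k2 k3 : Type) :
  same_cardinal k1 k2 -> same_cardinal k2 k3 -> same_cardinal k1 k3.
Proof. exact: card_eq_trans. Qed.

Lemma same_cardinal_false (k k' : Type) :
  same_cardinal k k' -> (k -> False) -> k' -> False.
Proof. by move=> /same_cardinal_sym/same_cardinalP[f _] nk /f. Qed.

Lemma existT_inj2 (I : Type) (P : I -> Type) i (x y : P i) :
  existT P i x = existT P i y -> x = y.
Proof.
move=> e; have := projT2_eq e.
by rewrite [projT1_eq e](Prop_irrelevance _ erefl).
Qed.

Lemma same_cardinal_sigT (I : Type) (P Q : I -> Type) :
  (forall i, same_cardinal (P i) (Q i)) -> same_cardinal {i & P i} {i & Q i}.
Proof.
move=> PQ; apply/same_cardinalP.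
pose f i := projT1 (cid ((same_cardinalP _ _).1 (PQ i))).
have fb i : bijective (f i) := projT2 (cid ((same_cardinalP _ _).1 (PQ i))).
have c i : exists g, cancel (f i) g /\ cancel g (f i).
  by have [g ? ?] := fb i; exists g.
pose g i := projT1 (cid (c i)).
have gP i : cancel (f i) (g i) /\ cancel (g i) (f i) := projT2 (cid (c i)).
exists (fun x => existT _ (projT1 x) (f _ (projT2 x))).
by exists (fun x => existT _ (projT1 x) (g _ (projT2 x))) => -[i x] /=;
  rewrite ?(gP i).1 ?(gP i).2.
Qed.

(** Sigma-additivity concerns full sequences, so a subfamily is expressed by putting [set0] in place
    of the discarded sets; these have no mass and their fibres are empty. *)
Lemma card_sigT_pred (I : Type) (T : Type) (F : I -> set T) (M : set T -> Type)
    (J : pred I) : (M set0 -> False) ->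
  [set: {i & M (if J i then F i else set0)}] #=
  [set x : {i & M (F i)} | J (projT1 x)].
Proof.
move=> M0.
(* [c] and [d] are casts obtained by matching on [J i]; the impossible branch is closed by emptiness
   of [M set0] in [c] and by [J i] being false in [d]. *)
pose c i : M (if J i then F i else set0) -> M (F i) :=
  if J i as b return M (if b then F i else set0) -> M (F i)
  then id else fun m => False_rect _ (M0 m).
pose d i : J i -> M (F i) -> M (if J i then F i else set0) :=
  if J i as b return b -> M (F i) -> M (if b then F i else set0)
  then fun _ => id else fun ne => False_rect _ (notF ne).
have cI i : injective (c i).
  by rewrite /c; case: (J i) => // x y; case: (M0 x).
have dI i (h h' : J i) x y : d i h x = d i h' y -> x = y.
  by rewrite /d; move: h h'; case: (J i).
have cJ i : M (if J i then F i else set0) -> J i.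
  by case: (J i) => // /M0.
apply: Cantor_Bernstein.
  apply: (@card_le_intro _ _ _ _ (fun x _ => existT (fun k => M (F k)) (projT1 x) (c _ (projT2 x)))).
    by move=> x _ /=; exact: cJ (projT2 x).
  move=> [i x] _ [j y] _ /= e; have ij := congr1 (@projT1 _ _) e; rewrite /= in ij.
  by case: _ / ij y e => y e; have -> // : x = y; apply: cI; exact: existT_inj2 e.
pose f (x : {i & M (F i)}) (h : J (projT1 x)) :=
  existT (fun k => M (if J k then F k else set0)) (projT1 x) (d _ h (projT2 x)).
apply: (@card_le_intro _ _ _ _ f) => // -[i x] h [j y] h' e.
have ij := congr1 (@projT1 _ _) e; rewrite /= in ij.
move: h h' e; rewrite /f /=; case: _ / ij y => y h h' e; have -> // : x = y.
by apply: (dI i h h'); exact: existT_inj2 e.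
Qed.

Section cardinal_measures.
Variables (d : measure_display) (X : measurableType d) (D : set X).
Variable M : set X -> Type.
Hypothesis cM : cardinal_measure D M.

Lemma card_bigcup_pred (J : pred nat) (F : nat -> set X) :
  (forall k, measurable (F k) /\ F k `<=` D) -> trivIset setT F ->
  [set: M (\bigcup_(k in [set k | J k]) F k)] #=
  [set x : {k & M (F k)} | J (projT1 x)].
Proof.
move=> FD Ft; pose F' k := if J k then F k else set0.
have -> : \bigcup_(k in [set k | J k]) F k = \bigcup_k F' k.
  apply/seteqP; split=> [x [k /= Jk Fx]|x [k _]]; first by exists k; rewrite // /F' Jk.
  by rewrite /F'; case: ifP => // Jk Fx; exists k.
apply: card_eq_trans (card_sigT_pred F J (cardinal_measure0 cM)).
apply: (cardinal_measure_sigma_additive cM) => [k|i j _ _].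
  by rewrite /F'; case: (J k) => //; split.
rewrite /F'; case: (J i) (J j) => -[] //; try by move=> [? []].
exact: Ft.
Qed.

Lemma card_subset (S S' : set X) : measurable S -> measurable S' ->
  S' `<=` D -> S `<=` S' -> [set: M S] #<= [set: M S'].
Proof.
move=> mS mS' S'D SS'.
pose F k := if k is 0%N then S else if k is 1%N then S' `\` S else set0.
have FD k : measurable (F k) /\ F k `<=` D.
  move: k => [|[|k]] /=; split => //; first by move=> x /SS'/S'D.
    exact: measurableD.
  by move=> x [/S'D].
have Ft : trivIset setT F.
  by move=> [|[|i]] [|[|j]] _ _ // [x [a b]] //; (case: a => // _ []) || case: b.
have -> : S' = \bigcup_k F k.
  apply/seteqP; split => [x S'x|x [[|[|k]] _]] //=; last 2 first.
  - exact: SS'.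
  - by case.
  by have [Sx|nSx] := pselect (S x); [exists 0%N|exists 1%N].
rewrite (card_le_eqr (cardinal_measure_sigma_additive cM FD Ft)).
apply/card_leTTP; exists (fun m : M (F 0%N) => existT (fun k => M (F k)) 0%N m).
by move=> x y; exact: existT_inj2.
Qed.

Lemma card_null_subset (Z S : set X) : measurable Z -> measurable S -> Z `<=` D ->
  S `<=` Z -> (M Z -> False) -> M S -> False.
Proof.
move=> mZ mS ZD SZ nZ.
by have /card_leTTP[f _] := card_subset mS mZ ZD SZ => /f.
Qed.

Lemma card_subset_null (Z S S' : set X) : measurable Z -> measurable S ->
  measurable S' -> Z `<=` D -> S `<=` D -> S' `<=` D ->
  (M Z -> False) -> S `<=` S' `|` Z -> [set: M S] #<= [set: M S'].
Proof.
move=> mZ mS mS' ZD SD S'D nZ SS'Z.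
pose F k := if k is 0%N then S `&` S' else if k is 1%N then S `\` S' else set0.
have FD k : measurable (F k) /\ F k `<=` D.
  move: k => [|[|k]] /=; split => //; try by move=> x [/SD].
    exact: measurableI.
  exact: measurableD.
have Ft : trivIset setT F.
  move=> [|[|i]] [|[|j]] _ _ // [x [a b]] //; try by case: a.
  all: try by case: b.
  - by case: a b => _ S'x [_ []].
  - by case: a b => _ nS'x [_ /nS'x].
have SE : S = \bigcup_k F k.
  apply/seteqP; split => [x Sx|x [[|[|k]] _]] //=; try by case.
  by have [Sx'|nSx] := pselect (S' x); [exists 0%N|exists 1%N].
apply: (@card_le_trans _ _ _ [set: M (S `&` S')]); last first.
  by apply: card_subset => //; exact: measurableI.
have := cardinal_measure_sigma_additive cM FD Ft; rewrite -SE => SF.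
rewrite (card_le_eql SF).
have F1 : M (F 1%N) -> False.
  apply: (card_null_subset mZ) => //; first exact: measurableD.
  by move=> x [/SS'Z[]].
have c k : exists f : M (F k) -> M (F 0%N), injective f /\ (M (F k) -> k = 0%N).
  move: k => [|[|k]].
  - by exists id; split.
  - by exists (fun m => False_rect _ (F1 m)); split => m; case: (F1 m).
  - have F2 : M (F k.+2) -> False by exact: cardinal_measure0 cM.
    by exists (fun m => False_rect _ (F2 m)); split => m; case: (F2 m).
pose f k := projT1 (cid (c k)).
have fP k : injective (f k) /\ (M (F k) -> k = 0%N) := projT2 (cid (c k)).
apply/card_leTTP; exists (fun x => f _ (projT2 x)) => -[i x] [j y] /=.
have i0 := (fP i).2 x; have j0 := (fP j).2 y; subst i j.
by move=> /(fP 0%N).1 ->.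
Qed.

Lemma card_eq_null (Z S S' : set X) : measurable Z -> measurable S ->
  measurable S' -> Z `<=` D -> S `<=` D -> S' `<=` D ->
  (M Z -> False) -> S `<=` S' `|` Z -> S' `<=` S -> same_cardinal (M S) (M S').
Proof.
move=> mZ mS mS' ZD SD S'D nZ SS'Z S'S; apply: Cantor_Bernstein.
  exact: (card_subset_null mZ).
exact: card_subset.
Qed.

End cardinal_measures.

(** * Masses of intervals under a shift *)

Section halfline_measures.
Variable R : realType.
Local Notation bR := (measurableTypeR R).
Local Notation halfline := (@halfline R).
Implicit Types mu : set bR -> Type.

Definition oc (a b : R) : set bR := [set t : R | a < t <= b].
Definition above (a : R) : set bR := [set t : R | a < t].
Definition origin : set bR := [set (0 : R)].

Lemma measurable_oc a b : measurable (oc a b).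
Proof. by rewrite /oc -set_itvE; exact: measurable_itv. Qed.

Lemma measurable_above a : measurable (above a).
Proof. by rewrite /above -set_itvE; exact: measurable_itv. Qed.

Lemma measurable_origin : measurable origin.
Proof. exact: measurable_set1. Qed.

Lemma measurable_halfline : measurable halfline.
Proof. by rewrite /Defs.halfline -set_itvE; exact: measurable_itv. Qed.

Lemma oc_halfline a b : 0 <= a -> oc a b `<=` halfline.
Proof. by move=> a0 t /andP[/(le_lt_trans a0)/ltW]. Qed.

Lemma above_halfline a : 0 <= a -> above a `<=` halfline.
Proof. by move=> a0 t /(le_lt_trans a0)/ltW. Qed.

Lemma origin_halfline : origin `<=` halfline.
Proof. by move=> t ->; rewrite /Defs.halfline /=. Qed.

(* Unlike log-bounded shifts, this relation visibly composes. For atomic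
   measures, having it in both directions is equivalent to being shifts of each
   other. *)
Definition dominated (K : R) mu mu' :=
  [set: mu origin] #<= [set: mu' origin] /\
  forall a b, 0 < a -> [set: mu (oc a b)] #<= [set: mu' (oc (a / K) (b * K))].

Lemma dominated_trans K K' mu1 mu2 mu3 : 0 < K ->
  dominated K mu1 mu2 -> dominated K' mu2 mu3 -> dominated (K * K') mu1 mu3.
Proof.
move=> K0 [z12 d12] [z23 d23]; split; first exact: card_le_trans z23.
move=> a b a0; apply: card_le_trans (d12 _ _ a0) _.
by rewrite invfM !mulrA; apply: d23; rewrite divr_gt0.
Qed.

Lemma measurable_ler_pair (f g : bR * bR -> R) :
  measurable_fun setT f -> measurable_fun setT g ->
  measurable [set p | f p <= g p].
Proof.
move=> mf mg; have := measurable_fun_ler mf mg.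
move=> /(_ measurableT [set true] I); rewrite setTI.
by congr measurable; apply/seteqP; split => p /=.
Qed.

Lemma measurable_log_bounded_region (K : R) : 0 < K ->
  measurable (log_bounded_region K).
Proof.
move=> K0.
(* Clearing denominators leaves two comparisons of measurable functions on the open quadrant. *)
have -> : log_bounded_region K =
   ([set 0] `*` [set 0]) `|` ((above 0 `*` above 0) `&`
   ([set p : bR * bR | (p.1 : R) <= K * p.2] `&`
    [set p : bR * bR | (p.2 : R) <= K * p.1])).
  apply/seteqP; split => [[x y] /= [[-> ->]|[x0 y0 /andP[h1 h2]]]|[x y] /= [[-> ->]|[[x0 y0] [h1 h2]]]].
  - by left.
  - right; do ! split => //.
      by rewrite -ler_pdivrMl // -ler_pdivlMr.
    by rewrite -ler_pdivrMr.
  - by left.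
  - right; split => //; rewrite ler_pdivrMr // h2 andbT.
    by rewrite ler_pdivlMr // ler_pdivrMl.
have m1 : measurable_fun [set: bR * bR] (fun p => p.1 : R) by exact: measurable_fst.
have m2 : measurable_fun [set: bR * bR] (fun p => p.2 : R) by exact: measurable_snd.
apply: measurableU; first by apply: measurableX; exact: measurable_set1.
apply: measurableI; first by apply: measurableX; exact: measurable_above.
by apply: measurableI; apply: measurable_ler_pair => //; apply: measurable_funM.
Qed.

Lemma borel_oc a b : 0 <= a -> borel_halfline (oc a b).
Proof. by move=> a0; split; [exact: measurable_oc|exact: oc_halfline]. Qed.

Lemma borel_above a : 0 <= a -> borel_halfline (above a).
Proof. by move=> a0; split; [exact: measurable_above|exact: above_halfline]. Qed.

Lemma borel_origin : borel_halfline origin.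
Proof. by split; [exact: measurable_origin|exact: origin_halfline]. Qed.

(** A marginal inherits sigma-additivity from [N]. This is how the dimension spectral measures
    obtain it, without adding up Hilbert dimensions. *)
Lemma log_bounded_shift_measure mu mu' :
  log_bounded_shift mu mu' -> cardinal_measure halfline mu.
Proof.
move=> [K [N [_ cN Nmu _ _]]]; split.
  have := Nmu set0; rewrite set0X => /(_ (conj measurable0 (@sub0set _ _))).
  by move=> /same_cardinal_false/(_ (cardinal_measure0 cN)).
move=> F FD Ft.
have FD' k : measurable (F k `*` halfline) /\ F k `*` halfline `<=` halfline `*` halfline.
  have [? ?] := FD k; split; first by apply: measurableX => //; exact: measurable_halfline.
  exact: setSX.
have Ft' : trivIset setT (fun k => F k `*` halfline).
  by move=> i j _ _ [[x y] [/= [Fx _] [Fy _]]]; apply: Ft => //; exists x.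
have mF : borel_halfline (\bigcup_k F k).
  split; first by apply: bigcupT_measurable => k; exact: (FD k).1.
  by move=> x [k _ /(FD k).2].
apply: same_cardinal_trans (same_cardinal_sym (Nmu _ mF)) _.
rewrite setX_bigcupl.
apply: same_cardinal_trans (cardinal_measure_sigma_additive cN FD' Ft') _.
by apply: same_cardinal_sigT => k; exact: Nmu (FD k).
Qed.

Lemma log_bounded_shift_dominated mu mu' : log_bounded_shift mu mu' ->
  exists2 K, 1 < K & dominated K mu mu' /\ dominated K mu' mu.
Proof.
move=> [K [N [K1 cN Nmu Nmu' Nout]]]; exists K => //.
have K0 : 0 < K := lt_trans ltr01 K1.
have mh := measurable_halfline.
have mZ : measurable ((halfline `*` halfline) `\` log_bounded_region K).
  by apply: measurableD; [exact: measurableX|exact: measurable_log_bounded_region].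
have ZD : (halfline `*` halfline) `\` log_bounded_region K `<=` halfline `*` halfline.
  by move=> p [].
(* If the region sends [S] into [S'], then up to the null complement of the region the mass of [N]
   over [S] lies in the strip over [S']. *)
have le S S' : borel_halfline S -> borel_halfline S' ->
    (forall x y, log_bounded_region K (x, y) -> S x -> S' y) ->
    [set: mu S] #<= [set: mu' S'].
  move=> bS bS' SS'; rewrite -(card_le_eql (Nmu _ bS)) -(card_le_eqr (Nmu' _ bS')).
  have [mS Sh] := bS; have [mS' Sh'] := bS'.
  apply: (card_subset_null cN mZ) => //; try exact: measurableX.
  - by move=> p [/Sh].
  - by move=> p [? /Sh'].
  - move=> [x y] [/= Sx hy]; have [G|nG] := pselect (log_bounded_region K (x, y)).
      by left; split; [exact: Sh|exact: SS' G Sx].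
    by right; split => //; split => //; exact: Sh.
have le' S S' : borel_halfline S -> borel_halfline S' ->
    (forall x y, log_bounded_region K (x, y) -> S y -> S' x) ->
    [set: mu' S] #<= [set: mu S'].
  move=> bS bS' SS'; rewrite -(card_le_eql (Nmu' _ bS)) -(card_le_eqr (Nmu _ bS')).
  have [mS Sh] := bS; have [mS' Sh'] := bS'.
  apply: (card_subset_null cN mZ) => //; try exact: measurableX.
  - by move=> p [? /Sh].
  - by move=> p [/Sh'].
  - move=> [x y] [/= hx Sy]; have [G|nG] := pselect (log_bounded_region K (x, y)).
      by left; split; [exact: SS' G Sy|exact: Sh].
    by right; split => //; split => //; exact: Sh.
have pos (a : R) : 0 < a -> 0 <= a / K by move=> a0; rewrite divr_ge0 ?ltW.
split; split.
- apply: le; try exact: borel_origin.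
  by move=> x y [[_ -> //]|/= [x0 _ _] xE]; move: x0; rewrite xE ltxx.
- move=> a b a0; apply: le; [exact/borel_oc/ltW|exact/borel_oc/pos|].
  move=> x y [[-> _]|/= [x0 y0 /andP[h1 h2]]] /andP[h3 h4].
    by have := lt_trans a0 h3; rewrite ltxx.
  move: h1 h2; rewrite ler_pdivlMr // ler_pdivrMr // => h1 h2; apply/andP; split.
    by rewrite (lt_le_trans _ h1) // mulrC ltr_pM2l // invr_gt0.
  by rewrite (le_trans h2) // mulrC ler_pM2r.
- apply: le'; try exact: borel_origin.
  by move=> x y [[-> //]|/= [_ y0 _] yE]; move: y0; rewrite yE ltxx.
- move=> a b a0; apply: le'; [exact/borel_oc/ltW|exact/borel_oc/pos|].
  move=> x y [[_ ->]|/= [x0 y0 /andP[h1 h2]]] /andP[h3 h4].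
    by have := lt_trans a0 h3; rewrite ltxx.
  move: h1 h2; rewrite ler_pdivlMr // ler_pdivrMr // => h1 h2; apply/andP; split.
    by rewrite ltr_pdivrMr // mulrC (lt_le_trans h3).
  by move: h1; rewrite ler_pdivrMl // mulrC => /le_trans; apply; rewrite ler_pM2r.
Qed.

End halfline_measures.

Arguments origin {R}.

(** * Geometric bands and their matching *)

Section levels.
Variable R : realType.
Local Notation bR := (measurableTypeR R).
Local Notation halfline := (@halfline R).
Implicit Types mu : set bR -> Type.
Variables (c rho : R).
Hypotheses (c_gt0 : 0 < c) (rho_gt1 : 1 < rho).

Definition band (n : nat) : set bR := oc (c / rho ^+ n.+1) (c / rho ^+ n).

Let rho_gt0 : 0 < rho := lt_trans ltr01 rho_gt1.

Let rX_gt0 n : 0 < rho ^+ n. Proof. exact: exprn_gt0. Qed.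

Let edge_gt0 n : 0 < c / rho ^+ n. Proof. exact: divr_gt0. Qed.

Lemma ltr_edge m n : (c / rho ^+ m < c / rho ^+ n) = (n < m)%N.
Proof. by rewrite ltr_pM2l // ltf_pV2 ?posrE // ltr_eXn2l. Qed.

Lemma ler_edge m n : (c / rho ^+ m <= c / rho ^+ n) = (n <= m)%N.
Proof. by rewrite leNgt ltr_edge -leqNgt. Qed.

Lemma borel_band n : borel_halfline (band n).
Proof. exact/borel_oc/ltW. Qed.

Lemma band_gt0 n t : band n t -> 0 < (t : R).
Proof. by move=> /andP[/(lt_trans (edge_gt0 _))]. Qed.

Lemma trivIset_band : trivIset setT band.
Proof.
move=> m n _ _ [t [/andP[m1 m2] /andP[n1 n2]]].
have := lt_le_trans m1 n2; have := lt_le_trans n1 m2.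
by rewrite !ltr_edge; lia.
Qed.

Lemma band_cover (t : R) : 0 < t -> t <= c -> exists n, band n t.
Proof.
move=> t0 tc.
have [n nt] : exists n, c / rho ^+ n.+1 < t.
  (* Bernoulli's inequality supplies a power of [rho] beyond [c / t]; the band of [t] is then found
     as the least index whose lower edge lies below [t]. *)
  have [N hN] : exists N : nat, c / t < rho ^+ N.
    have d0 : 0 < rho - 1 by rewrite subr_gt0.
    pose N := Num.truncn (c / t / (rho - 1)); exists N.+1.
    have : c / t / (rho - 1) < N.+1%:R.
      exact: truncnS_gt.
    rewrite ltr_pdivrMr // => /lt_le_trans; apply.
    have H n : n%:R * (rho - 1) + 1 <= rho ^+ n.
      elim: n => [|n IH]; first by rewrite mul0r add0r expr0.
      rewrite exprS; apply: (@le_trans _ _ (rho * (n%:R * (rho - 1) + 1))); last first.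
        by rewrite ler_pM2l.
      have : 0 <= n%:R * (rho - 1) ^+ 2 :> R by rewrite mulr_ge0 // sqr_ge0.
      by rewrite -natr1; nra.
    by apply: le_trans (H _); rewrite lerDl.
  exists N; rewrite ltr_pdivrMr // mulrC -ltr_pdivrMr //.
  by apply: (lt_le_trans hN); rewrite exprS ler_peMl // ltW.
have ex : exists n, c / rho ^+ n.+1 < t by exists n.
exists (ex_minn ex); case: ex_minnP => m mt min; rewrite /band /oc /= mt /=.
case: m mt min => [|m] mt min; first by rewrite expr0 divr1.
by rewrite leNgt; apply/negP => /min; rewrite ltnn.
Qed.

(** A common frame for two situations: the atoms of an eigenvalue sequence, several of which may
    share a band, and the bands themselves for a dimension spectral measure. The points to be
    matched are the elements of [{k & mu (F k)}]. *)
Record band_partition mu (F : nat -> set bR) (lev : nat -> nat) : Prop := {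
  bp_measure : cardinal_measure halfline mu;
  bp_borel : forall k, borel_halfline (F k);
  bp_band : forall k, F k `<=` band (lev k);
  bp_disjoint : trivIset setT F;
  bp_null : mu (halfline `\` (origin `|` \bigcup_k F k)) -> False }.

(** Since [K <= rho], stretching an interval between band edges by the factor [K] reaches at most
    one further band on either side. *)
Lemma band_hall K mu mu' F F' lev lev' : 0 < K -> K <= rho ->
  band_partition mu F lev -> band_partition mu' F' lev' -> dominated K mu mu' ->
  forall i j, (i <= j)%N ->
   [set x : {k & mu (F k)} | (i <= lev (projT1 x) < j.+1)%N] #<=
   [set y : {k & mu' (F' k)} | (i.-1 <= lev' (projT1 y) < j.+2)%N].
Proof.
move=> K0 Krho bp bp' [_ dom] i j ij.
have FP k := bp_borel bp k; have F'P k := bp_borel bp' k.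
have cm := bp_measure bp; have cm' := bp_measure bp'.
rewrite -(card_le_eql (card_bigcup_pred cm (fun k => i <= lev k < j.+1)%N FP (bp_disjoint bp))).
rewrite -(card_le_eqr (card_bigcup_pred cm' (fun k => i.-1 <= lev' k < j.+2)%N F'P (bp_disjoint bp'))).
have mU (P : set nat) : borel_halfline (\bigcup_(k in P) F k).
  split; first by apply: bigcup_measurable => k _; exact: (FP k).1.
  by move=> t [k _ /(FP k).2].
have mU' (P : set nat) : borel_halfline (\bigcup_(k in P) F' k).
  split; first by apply: bigcup_measurable => k _; exact: (F'P k).1.
  by move=> t [k _ /(F'P k).2].
apply: (@card_le_trans _ _ _ [set: mu (oc (c / rho ^+ j.+1) (c / rho ^+ i))]).
  apply: (card_subset cm); first exact: (mU _).1.
  - exact: measurable_oc.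
  - exact/oc_halfline/ltW.
  - move=> t [k /= /andP[ik kj] /(bp_band bp)/andP[h1 h2]]; apply/andP; split.
      by apply: le_lt_trans h1; rewrite ler_edge; lia.
    by apply: (le_trans h2); rewrite ler_edge; lia.
apply: card_le_trans (dom _ _ (edge_gt0 _)) _.
have aK : 0 <= c / rho ^+ j.+1 / K by rewrite divr_ge0 // ltW.
apply: (card_subset_null cm' _ _ _ _ _ _ (bp_null bp')).
- apply: measurableD; first exact: measurable_halfline.
  by apply: measurableU; [exact: measurable_origin|exact: (mU' _).1].
- exact: measurable_oc.
- exact: (mU' _).1.
- by move=> t [].
- exact: oc_halfline.
- exact: (mU' _).2.
move=> t /andP[h1 h2]; have t0 := le_lt_trans aK h1.
have [[k _ kt]|nt] := pselect ((\bigcup_k F' k) t); last first.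
  right; split; first exact: ltW.
  by move=> [t0'|//]; move: t0; rewrite t0' ltxx.
left; exists k => //=; have /andP[h3 h4] := bp_band bp' kt; apply/andP; split.
  (* For [i = 0] the stretched interval exceeds [c], but no piece lies there, and the truncated
     predecessor makes the bound trivial. *)
  case: i ij h2 => [//|i] _ h2 /=; rewrite -ltnS -ltr_edge.
  apply: (lt_le_trans h3); apply: (le_trans h2).
  rewrite exprSr invfM mulrA -mulrA ler_piMr ?(ltW (edge_gt0 _)) //.
  by rewrite mulrC ler_pdivrMr // mul1r.
rewrite -ltr_edge; apply: le_lt_trans (lt_le_trans h1 h4).
rewrite [rho ^+ j.+2]exprSr invfM mulrA ler_pM2l //.
by rewrite lef_pV2 ?posrE.
Qed.

Lemma band_matching K mu mu' F F' lev lev' : 0 < K -> K <= rho ->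
  band_partition mu F lev -> band_partition mu' F' lev' ->
  dominated K mu mu' -> dominated K mu' mu ->
  exists2 h : {k & mu (F k)} -> {k & mu' (F' k)}, bijective h &
    forall x, (lev (projT1 x) <= (lev' (projT1 (h x))).+1)%N /\
      (lev' (projT1 (h x)) <= (lev (projT1 x)).+1)%N.
Proof.
move=> K0 Kr bp bp' d d'.
apply: (level_bijection (lX := lev \o (@projT1 _ _)) (lY := lev' \o (@projT1 _ _))).
  exact: (band_hall K0 Kr bp bp' d).
exact: (band_hall K0 Kr bp' bp d').
Qed.

End levels.

Lemma same_cardinal_le (k k' : Type) : [set: k] #<= [set: k'] ->
  [set: k'] #<= [set: k] -> same_cardinal k k'.
Proof. exact: Cantor_Bernstein. Qed.

(** This is the image of the counting measure of [P] under [q]. With [q] the pair of positions of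
    two matched atoms, it becomes the joint measure of a shift. *)
Lemma cardinal_measure_pullback d (X : measurableType d) (D : set X) (P : Type)
    (q : P -> X) : cardinal_measure D (fun S => {x : P | S (q x)}).
Proof.
split=> [[]//|F _ Ft]; apply/same_cardinalP.
pose f (x : {x : P | (\bigcup_k F k) (q x)}) : {k & {x : P | F k (q x)}} :=
  let: exist2 k _ Fk := cid2 (svalP x) in existT _ k (exist _ (sval x) Fk).
have fv x : sval (projT2 (f x)) = sval x by rewrite /f; case: cid2.
have fI : injective f.
  move=> [x hx] [y hy] /(congr1 (fun z => sval (projT2 z))) xy.
  by apply: eq_sig_hprop => /= [*|]; [exact: Prop_irrelevance|rewrite !fv in xy].
have fO y : exists x, f x = y.
  case: y => k [x kx]; have hx : (\bigcup_k F k) (q x) by exists k.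
  exists (exist _ x hx); rewrite /f /=; case: cid2 => j /= _ jx.
  have kj : j = k by apply: Ft => //; exists (q x).
  by subst j; rewrite (Prop_irrelevance jx kx).
have [g gP] := choice fO; exists f; exists g => // x; exact: fI.
Qed.

Lemma same_cardinal_sig (P Q : Type) (f : P -> Q) (A : P -> Prop) (B : Q -> Prop) :
  bijective f -> (forall x, A x <-> B (f x)) ->
  same_cardinal {x | A x} {y | B y}.
Proof.
move=> [g fK gK] AB; have gP y : B y -> A (g y) by move=> By; apply/AB; rewrite gK.
apply/same_cardinalP.
exists (fun x => exist B (f (sval x)) ((AB _).1 (svalP x))).
exists (fun y => exist A (g (sval y)) (gP _ (svalP y))) => -[x hx];
  by apply: eq_sig_hprop => //= *; exact: Prop_irrelevance.
Qed.

(** * Atomic measures *)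

Section atomic.
Variable R : realType.
Local Notation bR := (measurableTypeR R).
Local Notation halfline := (@halfline R).
Variables (M : set bR -> Type) (lam : nat -> R).
Hypotheses (cM : cardinal_measure halfline M) (lam_gt0 : forall k, 0 < lam k).
Hypothesis lam_dec : forall k, lam k.+1 < lam k.
Hypothesis M_atomic : M (halfline `\` ([set (0 : R)] `|` range lam)) -> False.

Definition atom k : set bR := [set lam k].

Definition atoms : Type := (M origin + {k & M (atom k)})%type.

Definition atom_pos (x : atoms) : R :=
  match x with inl _ => 0 | inr y => lam (projT1 y) end.

Lemma lam_lt i j : (i < j)%N -> lam j < lam i.
Proof.
elim: j => // j IH; rewrite ltnS leq_eqVlt => /predU1P[->//|/IH].
exact: lt_trans.
Qed.

Lemma lam_inj : injective lam.
Proof.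
by move=> i j ij; case: (ltngtP i j) => // /lam_lt; rewrite ij ltxx.
Qed.

Lemma borel_atom k : borel_halfline (atom k).
Proof.
by split; [exact: measurable_set1|move=> t ->; exact: ltW].
Qed.

Lemma trivIset_atom : trivIset setT atom.
Proof. by move=> i j _ _ [t [-> /lam_inj]]. Qed.

Lemma bigcup_atom : \bigcup_k atom k = range lam.
Proof.
by apply/seteqP; split => [t [k _ ->]|t [k _ <-]]; exists k.
Qed.

(** An atomic measure is the image of the counting measure on its atoms, up to equipotence;
    marginals of a matching can thus be recognised. *)
Lemma atomsP S : borel_halfline S -> same_cardinal {x : atoms | S (atom_pos x)} (M S).
Proof.
move=> [mS Sh].
(* The origin is inserted as index 0, so that a single sequence carries all the mass. *)
pose A k := if k is k'.+1 then atom k' else origin.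
pose p k : R := if k is k'.+1 then lam k' else 0.
have AP k : measurable (A k) /\ A k `<=` halfline.
  by case: k => [|k]; [exact: borel_origin|exact: borel_atom].
have At : trivIset setT A.
  move=> [|i] [|j] _ _ // [t [/= a b]].
  - by have := lam_gt0 j; rewrite -b a ltxx.
  - by have := lam_gt0 i; rewrite -a b ltxx.
  - by congr _.+1; apply: trivIset_atom => //; exists t.
pose J k := `[< S (p k) >].
have ApE k t : A k t -> t = p k by case: k.
have Ap k : A k (p k) by case: k.
have UJ : measurable (\bigcup_(k in [set k | J k]) A k).
  by apply: bigcup_measurable => k _; exact: (AP k).1.
have UD : \bigcup_(k in [set k | J k]) A k `<=` halfline.
  by move=> t [k _ /(AP k).2].
have e1 : same_cardinal (M S) (M (\bigcup_(k in [set k | J k]) A k)).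
  apply: (card_eq_null cM _ _ _ _ _ _ M_atomic) => //.
  - apply: measurableD; first exact: measurable_halfline.
    apply: measurableU; first exact: measurable_set1.
    rewrite -bigcup_atom; apply: bigcupT_measurable => k; exact: (borel_atom k).1.
  - move=> t St; have [[t0|[k _ kt]]|nt] := pselect (([set (0 : R)] `|` range lam) t).
    + by left; exists 0%N => //=; apply/asboolP; rewrite /= -t0.
    + by left; exists k.+1 => //=; apply/asboolP; rewrite /= kt.
    + by right; split => //; exact: Sh.
  - by move=> t [k /= /asboolP + /ApE ->].
apply: same_cardinal_sym; apply: card_eq_trans e1 _.
apply: card_eq_trans (card_bigcup_pred cM J AP At) _.
pose u (x : atoms) : {k & M (A k)} :=
  match x with inl m => existT (fun k => M (A k)) 0%N m
  | inr y => existT (fun k => M (A k)) (projT1 y).+1 (projT2 y) end.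
pose v (x : {k & M (A k)}) : atoms :=
  (let: existT k m := x in match k return M (A k) -> atoms with
   | 0%N => fun m => inl m | k'.+1 => fun m => inr (existT _ k' m) end m).
have uK : cancel u v by move=> [//|[]].
have vK : cancel v u by move=> [[|k] m].
have pv x : atom_pos (v x) = p (projT1 x) by case: x => [[|k] m].
have pu x : p (projT1 (u x)) = atom_pos x by case: x => [//|[]].
apply: Cantor_Bernstein.
  apply: (@card_le_intro _ _ _ _ (fun x h => exist (fun x => S (atom_pos x)) (v x)
     (eq_ind_r S (asboolW h) (pv x)))) => // x h y h' /(congr1 sval) /=.
  exact: (can_inj vK).
apply: (@card_le_intro _ _ _ _ (fun x _ => u (sval x))).
  by move=> [x hx] _; apply/asboolP; rewrite /= pu.
move=> x _ y _ /(can_inj uK) xy; apply: eq_sig_hprop => // *.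
Qed.

Lemma atomic_above : M (above (lam 0%N)) -> False.
Proof.
apply: (card_null_subset cM _ _ _ _ M_atomic).
- apply: measurableD; first exact: measurable_halfline.
  apply: measurableU; first exact: measurable_set1.
  rewrite -bigcup_atom; apply: bigcupT_measurable => k; exact: (borel_atom k).1.
- exact: measurable_above.
- by move=> t [].
move=> t ht; split; first exact/ltW/(lt_trans _ ht).
move=> [t0|[k _ kt]].
  by have := lt_trans (lam_gt0 0%N) ht; rewrite t0 ltxx.
move: ht; rewrite /above /= -kt; case: k {kt} => [|k]; first by rewrite ltxx.
by rewrite ltNge ltW // lam_lt.
Qed.

Lemma atomic_band_partition c rho : 1 < rho -> lam 0%N <= c ->
  exists lev, band_partition c rho M atom lev.
Proof.
move=> rho1 lc; have c0 := lt_le_trans (lam_gt0 0%N) lc.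
have ex k : exists n, band c rho n (lam k).
  apply: band_cover => //; apply: le_trans lc.
  by case: k => // k; exact/ltW/lam_lt.
have [lev levP] := choice ex; exists lev; split => //.
- exact: borel_atom.
- by move=> k t ->.
- exact: trivIset_atom.
- by rewrite bigcup_atom.
Qed.

End atomic.

Section atomic_shift.
Variable R : realType.
Local Notation bR := (measurableTypeR R).
Local Notation halfline := (@halfline R).

Lemma atomic_log_bounded_shift (M M' : set bR -> Type) (lam lam' : nat -> R) K :
  cardinal_measure halfline M -> cardinal_measure halfline M' ->
  (forall k, 0 < lam k) -> (forall k, 0 < lam' k) ->
  (forall k, lam k.+1 < lam k) -> (forall k, lam' k.+1 < lam' k) ->
  (M (halfline `\` ([set (0 : R)] `|` range lam)) -> False) ->
  (M' (halfline `\` ([set (0 : R)] `|` range lam')) -> False) ->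
  1 < K -> dominated K M M' -> dominated K M' M -> log_bounded_shift M M'.
Proof.
move=> cM cM' lam0 lam0' lamd lamd' nM nM' K1 dom dom'.
have K0 := lt_trans ltr01 K1.
pose c := Num.max (lam 0%N) (lam' 0%N).
have [lev bp] : exists lev, band_partition c K M (atom lam) lev.
  by apply: atomic_band_partition => //; rewrite le_max lexx.
have [lev' bp'] : exists lev, band_partition c K M' (atom lam') lev.
  by apply: atomic_band_partition => //; rewrite le_max lexx orbT.
have c0 : 0 < c by rewrite lt_max lam0.
have [h hb hP] := band_matching c0 K1 K0 (lexx K) bp bp' dom dom'.
have /same_cardinalP[h0 h0b] : same_cardinal (M origin) (M' origin).
  exact: same_cardinal_le dom.1 dom'.1.
pose phi (x : atoms M lam) : atoms M' lam' :=
  match x with inl m => inl (h0 m) | inr y => inr (h y) end.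
have phib : bijective phi.
  have [g hK gK] := hb; have [g0 h0K g0K] := h0b.
  exists (fun x => match x with inl m => inl (g0 m) | inr y => inr (g y) end).
    by case=> ? /=; rewrite ?h0K ?hK.
  by case=> ? /=; rewrite ?g0K ?gK.
pose q (x : atoms M lam) : bR * bR := (atom_pos x, atom_pos (phi x)).
have pos0 x : @halfline (@atom_pos _ M lam x).
  by case: x => [m|x]; rewrite /Defs.halfline /=; [|exact/ltW].
have pos0' x : @halfline (@atom_pos _ M' lam' x).
  by case: x => [m|x]; rewrite /Defs.halfline /=; [|exact/ltW].
(* Matched atoms lie in the same band or in adjacent ones; two adjacent bands of ratio [K] span a
   factor [K ^+ 2]. *)
exists (K ^+ 2), (fun S => {x | S (q x)}); split.
- by rewrite exprn_egt1.
- exact: cardinal_measure_pullback.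
- move=> S bS; apply: same_cardinal_trans (atomsP cM lam0 lamd nM bS).
  by apply: (@same_cardinal_sig _ _ id); [exists id|move=> x; split => [[]|Sx]] => //; split => //; exact: pos0'.
- move=> S bS; apply: same_cardinal_trans (atomsP cM' lam0' lamd' nM' bS).
  by apply: same_cardinal_sig phib _ => x; split => [[]|Sx] //; split => //; exact: pos0.
suff reg x : log_bounded_region (K ^+ 2) (q x) by move=> [x [_]]; apply.
case: x => [m|y]; first by left.
right; rewrite /q /=; have [h1 h2] := hP y.
have /andP[a1 a2] := bp_band bp (erefl : atom lam (projT1 y) (lam (projT1 y))).
have /andP[b1 b2] := bp_band bp' (erefl : atom lam' (projT1 (h y)) (lam' (projT1 (h y)))).
split => //.
have e n : 0 < c / K ^+ n by rewrite divr_gt0 // exprn_gt0.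
have K2 : 0 < K ^+ 2 by rewrite exprn_gt0.
have shift2 n : c / K ^+ n = K ^+ 2 * (c / K ^+ n.+2).
  by rewrite -[n.+2]addn2 addnC exprD invfM mulrCA mulVKf // gt_eqF.
rewrite ler_pdivlMr // ler_pdivrMr // ler_pdivrMl //; apply/andP; split.
  apply: (le_trans a2); rewrite shift2 ler_pM2l //; apply/ltW/(le_lt_trans _ b1).
  by rewrite ler_edge //; lia.
apply: (le_trans b2); rewrite shift2 ler_pM2l //; apply/ltW/(le_lt_trans _ a1).
by rewrite ler_edge //; lia.
Qed.

End atomic_shift.

Local Open Scope complex_scope.

(** * Hilbert space preliminaries *)

Section real_norm.
Variable R : realType.

(** The norm takes values in [R[i]], whose order is partial; its real part gives access to the total
    order and to real arithmetic. *)
Definition rnorm (V : normedModType R[i]) (x : V) : R := complex.Re `|x|.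

Section norm.
Variable V : normedModType R[i].
Implicit Types x y : V.

Lemma rnormE x : `|x| = (rnorm x)%:C.
Proof. by rewrite /rnorm RRe_real // normr_real. Qed.

Lemma rnorm_ge0 x : 0 <= rnorm x.
Proof. by rewrite -lecR -rnormE normr_ge0. Qed.

Lemma rnorm0 : rnorm (0 : V) = 0.
Proof. by rewrite /rnorm normr0. Qed.

Lemma rnorm_eq0 x : rnorm x = 0 -> x = 0.
Proof. by move=> x0; apply/eqP; rewrite -normr_eq0 rnormE x0. Qed.

Lemma rnormN x : rnorm (- x) = rnorm x.
Proof. by rewrite /rnorm normrN. Qed.

Lemma rnorm_sub x y : rnorm (x - y) = rnorm (y - x).
Proof. by rewrite -rnormN opprB. Qed.

Lemma rnormD x y : rnorm (x + y) <= rnorm x + rnorm y.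
Proof. by rewrite -lecR rmorphD /= -!rnormE ler_normD. Qed.

Lemma rnormB x y : rnorm (x - y) <= rnorm x + rnorm y.
Proof. by rewrite -(rnormN y) rnormD. Qed.

Lemma rnorm_tri z x y : rnorm (x - y) <= rnorm (x - z) + rnorm (z - y).
Proof. by have := rnormD (x - z) (z - y); rewrite addrA subrK. Qed.

Lemma rnormZ (a : R[i]) x : rnorm (a *: x) = complex.Re `|a| * rnorm x.
Proof.
apply: (@complexI R); rewrite -rnormE normrZ rnormE.
by rewrite -[in LHS](RRe_real (normr_real a)) rmorphM.
Qed.

Lemma rnorm_cvgP (u : nat -> V) l :
  (u @ \oo --> l) <-> forall e : R, 0 < e ->
    exists N, forall n, (N <= n)%N -> rnorm (l - u n) < e.
Proof.
split=> [/cvgrPdist_lt ul e e0|ul].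
  have /ul[N _ NP] : 0 < e%:C by rewrite ltcR.
  by exists N => n /NP; rewrite rnormE ltcR.
apply/cvgrPdist_lt => e e0.
have eE : e = (complex.Re e)%:C by rewrite RRe_real // gtr0_real.
have /ul[N NP] : 0 < complex.Re e by rewrite -ltcR -eE.
by exists N => // n /NP; rewrite eE rnormE ltcR.
Qed.

Lemma closureP (A : set V) x :
  closure A x <-> forall e : R, 0 < e -> exists2 y, A y & rnorm (x - y) < e.
Proof.
split=> [Ax e e0|Ax U].
  have /Ax[y [Ay]] : nbhs x (ball x e%:C) by apply: nbhsx_ballx; rewrite ltcR.
  by rewrite -ball_normE /= rnormE ltcR => ?; exists y.
move=> /nbhs_normP[e /= e0 eU].
have eE : e = (complex.Re e)%:C by rewrite RRe_real // gtr0_real.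
have /Ax[y Ay xy] : 0 < complex.Re e by rewrite -ltcR -eE.
by exists y; split => //; apply: eU; rewrite /= eE rnormE ltcR.
Qed.

Lemma denseP (A : set V) :
  dense A <-> forall x (e : R), 0 < e -> exists2 y, A y & rnorm (x - y) < e.
Proof.
split=> [dA x e e0|dA U [x Ux] oU].
  have [|y [/= xy Ay]] := dA (ball x e%:C) _ (ball_open _ _).
    by exists x; apply: ballxx; rewrite ltcR.
  by exists y => //; move: xy; rewrite -ball_normE /= rnormE ltcR.
have : closure A x by apply/closureP; exact: dA.
by move=> /(_ U (open_nbhs_nbhs (conj oU Ux)))[y [Ay Uy]]; exists y.
Qed.

End norm.

Lemma rnorm_complete (V : completeNormedModType R[i]) (u : nat -> V) :
  (forall e : R, 0 < e -> exists N, forall m n, (N <= m)%N -> (N <= n)%N ->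
     rnorm (u m - u n) < e) ->
  exists l, forall e : R, 0 < e -> exists N, forall n, (N <= n)%N -> rnorm (l - u n) < e.
Proof.
move=> cu; have : cauchy (u @ \oo).
  apply: cauchy_exP => e e0.
  have eE : e = (complex.Re e)%:C by rewrite RRe_real // gtr0_real.
  have /cu[N NP] : 0 < complex.Re e by rewrite -ltcR -eE.
  exists (u N); exists N => // n /= Nn; rewrite -ball_normE /= rnormE eE ltcR.
  exact: NP.
move=> /cauchy_cvg/cvg_ex[l ul]; exists l; exact/rnorm_cvgP.
Qed.

Lemma bounded_operatorP (V W : normedModType R[i]) (T : {linear V -> W}) :
  bounded_operator T <->
  exists2 c : R, 0 < c & forall x, rnorm (T x) <= c * rnorm x.
Proof.
split=> [[c cT]|[c c0 cT]]; last first.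
  by exists c%:C => x; rewrite !rnormE -rmorphM /= lecR.
exists (`|complex.Re c| + 1) => [|x]; first by rewrite ltr_wpDl.
case: c cT => a b cT; have := cT x.
rewrite !rnormE lecE => /andP[_] /=; rewrite mulr0 subr0 => /le_trans; apply.
by apply: ler_wpM2r; [exact: rnorm_ge0|rewrite ler_wpDr // ler_norm].
Qed.

Section inner_product.
Variable H : hilbertType R.
Implicit Types x y z : H.

Lemma hdotDl x y z : hdot (x + y) z = hdot x z + hdot y z.
Proof. exact: linearDl. Qed.

Lemma hdotDr x y z : hdot z (x + y) = hdot z x + hdot z y.
Proof. exact: linearDr. Qed.

Lemma hdotZl a x y : hdot (a *: x) y = a * hdot x y.
Proof. exact: linearZl_LR. Qed.

Lemma hdotZr a x y : hdot x (a *: y) = a^* * hdot x y.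
Proof. exact: linearZr_LR. Qed.

Lemma hdot0l x : hdot 0 x = 0. Proof. exact: linear0l. Qed.
Lemma hdot0r x : hdot x 0 = 0. Proof. exact: linear0r. Qed.

Lemma hdotNl x y : hdot (- x) y = - hdot x y. Proof. exact: linearNl. Qed.
Lemma hdotNr x y : hdot x (- y) = - hdot x y. Proof. exact: linearNr. Qed.

Lemma hdotC x y : hdot x y = (hdot y x)^*.
Proof. by rewrite (hermC (hdot : {hermitian H for _ & _}) x y) expr0 mul1r. Qed.

Lemma hdot_sym0 x y : hdot x y = 0 -> hdot y x = 0.
Proof. by move=> xy; rewrite hdotC xy rmorph0. Qed.

Lemma hdotxx x : hdot x x = (rnorm x ^+ 2)%:C.
Proof. by rewrite -hdot_norm rnormE rmorphXn. Qed.

Definition rdot x y : R := complex.Re (hdot x y).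

Lemma rdotDl x y z : rdot (x + y) z = rdot x z + rdot y z.
Proof. by rewrite /rdot hdotDl raddfD. Qed.

Lemma rdotDr x y z : rdot z (x + y) = rdot z x + rdot z y.
Proof. by rewrite /rdot hdotDr raddfD. Qed.

Lemma rdotNl x y : rdot (- x) y = - rdot x y.
Proof. by rewrite /rdot hdotNl raddfN. Qed.

Lemma rdotNr x y : rdot x (- y) = - rdot x y.
Proof. by rewrite /rdot hdotNr raddfN. Qed.

Lemma rdotC x y : rdot x y = rdot y x.
Proof. by rewrite /rdot hdotC; case: (hdot y x). Qed.

Lemma rdotxx x : rdot x x = rnorm x ^+ 2.
Proof. by rewrite /rdot hdotxx. Qed.

Lemma rdotZl (t : R) x y : rdot (t%:C *: x) y = t * rdot x y.
Proof. by rewrite /rdot hdotZl; case: (hdot x y) => a b /=; rewrite mul0r subr0. Qed.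

Lemma rdotZr (t : R) x y : rdot x (t%:C *: y) = t * rdot x y.
Proof. by rewrite rdotC rdotZl rdotC. Qed.

Lemma rnormD_sqr x y : rnorm (x + y) ^+ 2 = rnorm x ^+ 2 + 2 * rdot x y + rnorm y ^+ 2.
Proof. by rewrite -!rdotxx rdotDl !rdotDr (rdotC y x); ring. Qed.

Lemma rnormB_sqr x y : rnorm (x - y) ^+ 2 = rnorm x ^+ 2 - 2 * rdot x y + rnorm y ^+ 2.
Proof. by rewrite rnormD_sqr rdotNr rnormN; ring. Qed.

(** For [a = hdot x y] the real part becomes the squared modulus of [hdot x y]. Real orthogonality,
    tested with all complex multiples, thus suffices. *)
Lemma hdot_rdot x y : (forall a : R[i], rdot x (a *: y) = 0) -> hdot x y = 0.
Proof.
move=> /(_ (hdot x y)); rewrite /rdot hdotZr.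
case: (hdot x y) => a b /= h.
have : a ^+ 2 + b ^+ 2 = 0 by rewrite -h; ring.
move/eqP; rewrite paddr_eq0 ?sqr_ge0 // !sqrf_eq0 => /andP[/eqP-> /eqP->].
by [].
Qed.

Lemma pythagoras x y : hdot x y = 0 ->
  rnorm (x + y) ^+ 2 = rnorm x ^+ 2 + rnorm y ^+ 2.
Proof. by move=> xy; rewrite rnormD_sqr /rdot xy /= mulr0 addr0. Qed.

End inner_product.

(** The common core of three Cauchy-Schwarz arguments: for the inner product, for almost minimising
    vectors, and for the semidefinite form of the modulus. *)
Lemma discriminant_le (a b c : R) : 0 <= a -> 0 <= c ->
  (forall t, 0 <= a + 2 * t * b + t ^+ 2 * c) -> b ^+ 2 <= a * c.
Proof.
move=> a0 c0 h; have [c_eq0|c_neq0] := eqVneq c 0.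
  suff -> : b = 0 by rewrite c_eq0; lra.
  apply/eqP; apply: contraT => b0; have := h (- (a + 1) / b).
  rewrite c_eq0 mulr0 addr0 -mulrA mulfVK //; lra.
have cp : 0 < c by rewrite lt_neqAle eq_sym c_neq0.
have := h (- b / c); rewrite (_ : _ + _ = (a * c - b ^+ 2) / c); last by field.
by rewrite pmulr_lge0 ?invr_gt0 // subr_ge0.
Qed.

Lemma rdot_le (H : hilbertType R) (x y : H) : `|rdot x y| <= rnorm x * rnorm y.
Proof.
rewrite -ler_sqr ?nnegrE ?mulr_ge0 ?rnorm_ge0 // real_normK ?num_real // exprMn.
apply: discriminant_le; rewrite ?sqr_ge0 // => t.
have := sqr_ge0 (rnorm (x + t%:C *: y)); rewrite rnormD_sqr rdotZr rnormZ.
by rewrite normc_def /= expr0n addr0 sqrtr_sqr exprMn real_normK ?num_real // mulrA.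
Qed.

Lemma orthogonal_closure (H : hilbertType R) (A : set H) x y :
  (forall z, A z -> hdot x z = 0) -> closure A y -> hdot x y = 0.
Proof.
move=> Ax /closureP yA; apply: hdot_rdot => a; apply/eqP; rewrite -normr_le0.
apply/ler_addgt0Pr => e e0; rewrite add0r.
have q0 : 0 < (complex.Re `|a| + 1) * (rnorm x + 1).
  by rewrite mulr_gt0 // ltr_wpDl // ?rnorm_ge0 // -lecR RRe_real ?normr_real ?normr_ge0.
have [z Az yz] := yA _ (divr_gt0 e0 q0).
have -> : rdot x (a *: y) = rdot x (a *: (y - z)).
  by rewrite scalerBr rdotDr rdotNr [X in _ - X](_ : _ = 0) ?subr0 // /rdot hdotZr Ax // mulr0.
apply: (le_trans (rdot_le _ _)); rewrite rnormZ.
have := rnorm_ge0 x; have := rnorm_ge0 (y - z).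
have : 0 <= complex.Re `|a| by rewrite -lecR RRe_real ?normr_real ?normr_ge0.
move: yz; rewrite ltr_pdivlMr //; set p := complex.Re _; set q := rnorm x; set s := rnorm (y - z).
by move=> *; nra.
Qed.

End real_norm.

(** * Isomorphisms from densely defined linear relations *)

Section extension.
Variable R : realType.

Lemma invS_lt (e : R) : 0 < e -> exists N, forall n, (N <= n)%N -> n.+1%:R^-1 < e.
Proof.
move=> e0; exists (Num.truncn e^-1) => n Nn.
rewrite invf_plt ?posrE //; apply: lt_le_trans (truncnS_gt _) _.
by rewrite ler_nat ltnS.
Qed.

Lemma ler_arch (x y k : R) : (forall e, 0 < e -> x <= y + k * e) -> x <= y.
Proof.
move=> h; apply/ler_addgt0Pr => e e0.
have k0 : 0 < `|k| + 1 by rewrite ltr_wpDl.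
apply: (le_trans (h _ (divr_gt0 e0 k0))); rewrite lerD2l mulrA ler_pdivrMr //.
by rewrite mulrC ler_pM2l // (le_trans (ler_norm _)) // lerDl.
Qed.

Section relation.
Variables (X Y : normedModType R[i]) (G : set (X * Y)) (C : R).
Hypothesis C0 : 0 <= C.
Hypothesis G_lin : forall (a : R[i]) p q, G p -> G q -> G (a *: p.1 + q.1, a *: p.2 + q.2).
Hypothesis G_le : forall p, G p -> rnorm p.2 <= C * rnorm p.1.

Definition rel_closure (x : X) (y : Y) := forall e : R, 0 < e ->
  exists p, [/\ G p, rnorm (x - p.1) < e & rnorm (y - p.2) < e].

Lemma rel_closure_lin (a : R[i]) x y x' y' : rel_closure x y -> rel_closure x' y' ->
  rel_closure (a *: x + x') (a *: y + y').
Proof.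
move=> cxy cxy' e e0; have a0 : 0 <= complex.Re `|a| := rnorm_ge0 (a : R[i]^o).
have k0 : 0 < complex.Re `|a| + 1 by rewrite ltr_wpDl.
have [p [Gp xp yp]] := cxy _ (divr_gt0 e0 (mulr_gt0 (@ltr0n R 2) k0)).
have [q [Gq xq yq]] := cxy' _ (divr_gt0 e0 (@ltr0n R 2)).
have bnd (V : normedModType R[i]) (v v' w w' : V) :
    rnorm (v - v') < e / (2 * (complex.Re `|a| + 1)) -> rnorm (w - w') < e / 2 ->
    rnorm (a *: v + w - (a *: v' + w')) < e.
  move=> vv' ww'; rewrite opprD addrACA -scalerBr; apply: (le_lt_trans (rnormD _ _)).
  rewrite rnormZ; move: vv'; rewrite invfM mulrA ltr_pdivlMr //.
  have := rnorm_ge0 (v - v'); nra.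
by exists (a *: p.1 + q.1, a *: p.2 + q.2); split; [exact: G_lin|exact: bnd|exact: bnd].
Qed.

Lemma rel_closure_le x y : rel_closure x y -> rnorm y <= C * rnorm x.
Proof.
move=> cxy; apply: (@ler_arch _ _ (1 + C)) => e /cxy[p [/G_le Gp xp yp]].
have := rnorm_tri p.2 y 0; rewrite !subr0 => h1.
have := rnorm_tri x p.1 0; rewrite !subr0 (rnorm_sub p.1) => h2.
have := ler_wpM2l C0 h2; have := ler_wpM2l C0 (ltW xp); lra.
Qed.

(** Two values at [x] differ by a value at 0, which the norm bound forces to vanish. *)
Lemma rel_closure_inj x y y' : rel_closure x y -> rel_closure x y' -> y = y'.
Proof.
move=> cxy cxy'; apply/eqP; rewrite -subr_eq0; apply/eqP/rnorm_eq0.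
have := rel_closure_lin (-1) cxy' cxy; rewrite !scaleN1r ![- _ + _]addrC subrr.
move=> /rel_closure_le; rewrite rnorm0 mulr0 => h.
by apply/eqP; rewrite eq_le h rnorm_ge0.
Qed.

Lemma sub_rel_closure p : G p -> rel_closure p.1 p.2.
Proof. by move=> Gp e e0; exists p; rewrite !subrr !rnorm0. Qed.

End relation.

Lemma rel_closure_ex (X : normedModType R[i]) (Y : completeNormedModType R[i])
    (G : set (X * Y)) (C : R) : 0 <= C ->
  (forall (a : R[i]) p q, G p -> G q -> G (a *: p.1 + q.1, a *: p.2 + q.2)) ->
  (forall p, G p -> rnorm p.2 <= C * rnorm p.1) ->
  dense (fst @` G) -> forall x, exists y, rel_closure G x y.
Proof.
move=> C0 G_lin G_le dG x.
have ex n : exists p, G p /\ rnorm (x - p.1) < n.+1%:R^-1.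
  have e0 : 0 < n.+1%:R^-1 :> R by rewrite invr_gt0.
  by have [_ [p Gp <-] xp] := (denseP _).1 dG x _ e0; exists p.
have [p pP] := choice ex.
have Gsub p1 p2 : G p1 -> G p2 -> rnorm (p1.2 - p2.2) <= C * rnorm (p1.1 - p2.1).
  move=> G1 G2; have := G_le _ (G_lin (-1) _ _ G2 G1).
  by rewrite /= !scaleN1r ![- _ + _]addrC.
have C1 : 0 < 2 * (C + 1) by rewrite mulr_gt0 // ltr_wpDl.
have [|y yP] := @rnorm_complete _ Y (fun n => (p n).2).
  move=> e e0; have [N NP] := invS_lt (divr_gt0 e0 C1).
  exists N => m n Nm Nn; apply: (le_lt_trans (Gsub _ _ (pP m).1 (pP n).1)).
  have := lt_trans (pP m).2 (NP _ Nm); have := lt_trans (pP n).2 (NP _ Nn).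
  rewrite !ltr_pdivlMr // => h1 h2.
  have h3 := rnorm_tri x (p m).1 (p n).1; rewrite (rnorm_sub _ x) in h3.
  have := ler_wpM2l C0 h3; have := rnorm_ge0 (x - (p m).1); have := rnorm_ge0 (x - (p n).1).
  nra.
exists y => e e0; have [N NP] := yP _ e0; have [N' NP'] := invS_lt e0.
exists (p (maxn N N')); have [Gp xp] := pP (maxn N N'); split => //.
  by apply: (lt_trans xp); apply: NP'; rewrite leq_maxr.
by apply: NP; rewrite leq_maxl.
Qed.

(** The closure of [G] is the graph of [U], and the closure of its transpose that of the inverse.
    Starting from a relation means that well-definedness, say of [T1 x |-> T2 (U x)], is a
    consequence of the norm bounds instead of a preliminary check. *)
Lemma isomorphism_of_relation (X Y : completeNormedModType R[i])
    (G : set (X * Y)) (C : R) : 0 <= C ->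
  (forall (a : R[i]) p q, G p -> G q -> G (a *: p.1 + q.1, a *: p.2 + q.2)) ->
  (forall p, G p -> rnorm p.2 <= C * rnorm p.1) ->
  (forall p, G p -> rnorm p.1 <= C * rnorm p.2) ->
  dense (fst @` G) -> dense (snd @` G) ->
  exists (U : {linear X -> Y}) (Uinv : {linear Y -> X}),
    isomorphism_onto U Uinv /\ forall p, G p -> U p.1 = p.2.
Proof.
move=> C0 G_lin le12 le21 d1 d2.
pose G' : set (Y * X) := [set p | G (p.2, p.1)].
have cl' x y : rel_closure G' y x <-> rel_closure G x y.
  split=> h e /h[[p1 p2] [Gp ? ?]]; exists (p2, p1); split => //.
have ex1 := rel_closure_ex C0 G_lin le12 d1.
have G'_lin (a : R[i]) p q : G' p -> G' q -> G' (a *: p.1 + q.1, a *: p.2 + q.2).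
  by case: p q => [p1 p2] [q1 q2] Gp Gq; exact: G_lin Gp Gq.
have le21' p : G' p -> rnorm p.2 <= C * rnorm p.1.
  by case: p => [p1 p2] Gp; exact: le21 Gp.
have ex2 : forall y, exists x, rel_closure G' y x.
  apply: (rel_closure_ex C0 G'_lin le21').
  by move: d2; congr dense; apply/seteqP; split => [_ [[p1 p2] Gp <-]|_ [[p1 p2] Gp <-]];
      exists (p2, p1).
have [f fP] := choice ex1; have [g gP] := choice ex2.
have inj1 := rel_closure_inj C0 G_lin le12.
have inj2 x y y' : rel_closure G x y' -> rel_closure G y y' -> x = y.
  by move=> /cl' h /cl' h'; exact: (rel_closure_inj C0 G'_lin le21' h h').
have flin : linear f.
  move=> a x y; apply: inj1 (fP _) _; exact: (rel_closure_lin G_lin a (fP x) (fP y)).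
have glin : linear g.
  move=> a x y; apply: inj2; first exact/cl'/gP.
  by apply: (rel_closure_lin G_lin a); apply/cl'; exact: gP.
pose U : {linear X -> Y} := HB.pack f (GRing.isLinear.Build R[i] X Y *:%R f flin).
pose Ui : {linear Y -> X} := HB.pack g (GRing.isLinear.Build R[i] Y X *:%R g glin).
have C1 : 0 < C + 1 by rewrite ltr_wpDl.
exists U, Ui; split; last first.
  by move=> p Gp; apply: inj1 (fP _) _; exact: sub_rel_closure.
split.
- apply/bounded_operatorP; exists (C + 1) => // x.
  have := rel_closure_le C0 le12 (fP x); have := rnorm_ge0 x; rewrite /U /=; nra.
- apply/bounded_operatorP; exists (C + 1) => // y.
  have : rnorm (g y) <= C * rnorm y.
    exact: (rel_closure_le C0 le21' (gP y)).
  by have := rnorm_ge0 y; rewrite /Ui /=; nra.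
- by move=> x; apply: (inj2 _ _ (f x)); [exact/cl'/gP|exact: fP].
- by move=> y; apply: (inj1 _ _ _ (fP _)); exact/cl'/gP.
Qed.

End extension.

(** * Projection along a closed subspace *)

Section projection.
Variables (R : realType) (H : hilbertType R) (S : set H).
Hypotheses (S0 : S 0) (S_lin : forall (a : R[i]) x y, S x -> S y -> S (a *: x + y)).
Hypothesis S_closed : closure S `<=` S.

Lemma projection_ex x : exists y, S y /\ forall z, S z -> hdot (x - y) z = 0.
Proof.
pose D : set R := [set rnorm (x - y) ^+ 2 | y in S].
have D0 : has_inf D.
  split; first by exists (rnorm (x - 0) ^+ 2), 0.
  by exists 0 => _ [y _ <-]; exact: sqr_ge0.
pose d := inf D.
have dle y : S y -> d <= rnorm (x - y) ^+ 2.
  by move=> Sy; apply: ge_inf; [exact: D0.2|exists y].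
have ex n : exists y, S y /\ rnorm (x - y) ^+ 2 < d + n.+1%:R^-1.
  have e0 : 0 < n.+1%:R^-1 :> R by rewrite invr_gt0.
  by have [_ [y Sy <-] yd] := inf_adherent e0 D0; exists y.
have [u uP] := choice ex.
(* Parallelogram identity: the midpoint of [u m] and [u n] lies in [S], so its squared distance to
   [x] is at least [d]. *)
have half m n : rnorm (u m - u n) ^+ 2 <= 2 * (m.+1%:R^-1 + n.+1%:R^-1).
  have Sh : S ((2^-1)%:C *: (u m + u n)).
    rewrite -[X in S X]addr0; apply: S_lin => //.
    by rewrite -[u m]scale1r; apply: S_lin; [exact: (uP m).1|exact: (uP n).1].
  have e1 : u m - u n = (x - u n) - (x - u m) by rewrite opprB addrCA (addrC x) addrK.
  have e2 : x - (2^-1)%:C *: (u m + u n) = (2^-1)%:C *: ((x - u m) + (x - u n)).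
    rewrite [in RHS]addrACA -opprD scalerBr; congr (_ - _).
    rewrite scalerDr -scalerDl -rmorphD /= -[LHS]scale1r; congr (_ *: _).
    by rewrite -[2^-1]mul1r -splitr.
  have := dle _ Sh; have := (uP m).2; have := (uP n).2; rewrite e2 e1.
  rewrite rnormZ normc_def /= expr0n addr0 sqrtr_sqr ger0_norm ?invr_ge0 // exprMn.
  move: (x - u m) (x - u n) => v w; rewrite rnormD_sqr rnormB_sqr (rdotC v w).
  move: (rnorm v ^+ 2) (rnorm w ^+ 2) (rdot w v) => a b r.
  move: (m.+1%:R^-1) (n.+1%:R^-1) => c c' *; lra.
have close e : 0 < e -> exists N, forall m n, (N <= m)%N -> (N <= n)%N ->
    rnorm (u m - u n) < e.
  move=> e0; have [N NP] := invS_lt (divr_gt0 (exprn_gt0 2 e0) (@ltr0n R 4)).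
  exists N => m n /NP Nm /NP Nn; rewrite -ltr_sqr ?nnegrE ?rnorm_ge0 ?(ltW e0) //.
  apply: (le_lt_trans (half m n)); move: Nm Nn.
  by move: (m.+1%:R^-1) (n.+1%:R^-1) (e ^+ 2) => a b c *; lra.
have [l lP] := @rnorm_complete _ H u close.
have Sl : S l.
  apply/S_closed/closureP => e /lP[N NP]; exists (u N); first exact: (uP N).1.
  exact: NP.
exists l; split => // z Sz; apply: hdot_rdot => a.
have Saz : S (a *: z) by rewrite -[_ *: _]addr0; apply: S_lin.
move: (a *: z) Saz => {Sz a z} z Sz.
(* Moving the almost minimal [u n] by [t *: z] lowers the squared distance by at most [n.+1%:R^-1];
   the discriminant of this quadratic in [t] gives the bound. *)
have small n : rdot (x - u n) z ^+ 2 <= n.+1%:R^-1 * rnorm z ^+ 2.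
  rewrite -sqrrN; apply: discriminant_le; rewrite ?sqr_ge0 ?invr_ge0 // => t.
  have Suz : S (u n + t%:C *: z) by rewrite addrC; apply: S_lin => //; exact: (uP n).1.
  have := dle _ Suz; have := (uP n).2.
  rewrite opprD addrA (rnormB_sqr (x - u n)) rnormZ rdotZr.
  rewrite normc_def /= expr0n addr0 sqrtr_sqr exprMn real_normK ?num_real //.
  move: (n.+1%:R^-1) (rnorm (x - u n) ^+ 2) (rnorm z ^+ 2) => a b c h1 h2.
  by rewrite mulrN; lra.
apply/eqP; rewrite -normr_le0; apply/ler_addgt0Pr => e e0; rewrite add0r.
have z1 : 0 < rnorm z + 1 by rewrite ltr_wpDl // rnorm_ge0.
have d0 : 0 < e / 2 / (rnorm z + 1) by rewrite !divr_gt0.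
have [N NP] := lP _ d0; have [N' NP'] := invS_lt (exprn_gt0 2 d0).
pose n := maxn N N'.
have h1 : rnorm (l - u n) < e / 2 / (rnorm z + 1) by apply: NP; rewrite leq_maxl.
have h2 : n.+1%:R^-1 < (e / 2 / (rnorm z + 1)) ^+ 2 by apply: NP'; rewrite leq_maxr.
have -> : x - l = (x - u n) - (l - u n) by rewrite opprB addrA subrK.
rewrite rdotDl rdotNl; apply: (le_trans (ler_normB _ _)).
have h3 : `|rdot (x - u n) z| <= e / 2.
  rewrite -ler_sqr ?nnegrE ?divr_ge0 ?(ltW e0) // real_normK ?num_real //.
  apply: (le_trans (small n)); apply: (@le_trans _ _ ((e / 2 / (rnorm z + 1)) ^+ 2 * rnorm z ^+ 2)).
    by rewrite ler_wpM2r ?sqr_ge0 // ltW.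
  rewrite -exprMn ler_sqr ?nnegrE ?mulr_ge0 ?rnorm_ge0 ?divr_ge0 ?invr_ge0 ?(ltW e0) ?(ltW z1) //.
  by rewrite mulrAC ler_pdivrMr // ler_wpM2l ?divr_ge0 ?(ltW e0) // lerDl.
have h4 : `|rdot (l - u n) z| <= e / 2.
  apply: (le_trans (rdot_le _ _)); move: h1; rewrite ltr_pdivlMr // => h1.
  have := rnorm_ge0 (l - u n); have := rnorm_ge0 z; nra.
by rewrite [leRHS]splitr; exact: lerD.
Qed.

(** [Q] realises the quotient by [S] inside the Hilbert space. Its linearity follows from uniqueness
    of the decomposition. *)
Lemma complement_projection : exists Q : {linear H -> H},
  [/\ forall x, rnorm (Q x) <= rnorm x, forall x z, S z -> hdot (Q x) z = 0 &
      forall x, S (x - Q x)].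
Proof.
have [p pP] := choice projection_ex.
pose q x := x - p x.
have S_sub x y : S x -> S y -> S (x - y).
  by move=> Sx Sy; rewrite addrC -scaleN1r; exact: S_lin.
have uniq x y : S (x - y) -> (forall z, S z -> hdot y z = 0) -> q x = y.
  move=> Sxy yS; apply/eqP; rewrite -subr_eq0; apply/eqP/rnorm_eq0.
  have : S (q x - y).
    rewrite (_ : _ - y = (x - y) - p x); first by apply: S_sub => //; exact: (pP x).1.
    by rewrite /q addrAC.
  move=> Sz; apply/eqP; rewrite -sqrf_eq0 -rdotxx /rdot hdotDl hdotNl (pP x).2 // yS //.
  by rewrite subr0.
have qlin : linear q.
  move=> a x y; apply: uniq.
    rewrite (_ : _ - _ = a *: p x + p y); first by apply: S_lin; [exact: (pP x).1|exact: (pP y).1].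
    by rewrite /q opprD addrACA -scalerBr !opprB ![_ + (_ - _)]addrC !subrK.
  by move=> z Sz; rewrite hdotDl hdotZl !(pP _).2 // mulr0 addr0.
pose Q : {linear H -> H} := HB.pack q (GRing.isLinear.Build R[i] H H *:%R q qlin).
exists Q; split => [x|x z Sz|x]; rewrite /Q /=.
- have orth : hdot (q x) (p x) = 0 by apply: (pP x).2; exact: (pP x).1.
  have e : rnorm x ^+ 2 = rnorm (q x) ^+ 2 + rnorm (p x) ^+ 2.
    by rewrite -(pythagoras orth) subrK.
  by rewrite -ler_sqr ?nnegrE ?rnorm_ge0 // e lerDl sqr_ge0.
- exact: (pP x).2.
- by rewrite /q opprB addrC subrK; exact: (pP x).1.
Qed.

End projection.

Section orthogonal_sums.
Variables (R : realType) (H : hilbertType R).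

Lemma hdot_suml (I : Type) (r : seq I) (P : pred I) (v : I -> H) y :
  hdot (\sum_(i <- r | P i) v i) y = \sum_(i <- r | P i) hdot (v i) y.
Proof. by apply: (big_morph (fun x => hdot x y)) => [x z|]; [exact: hdotDl|exact: hdot0l]. Qed.

Lemma hdot_sumr (I : Type) (r : seq I) (P : pred I) (v : I -> H) y :
  hdot y (\sum_(i <- r | P i) v i) = \sum_(i <- r | P i) hdot y (v i).
Proof. by apply: (big_morph (hdot y)) => [x z|]; [exact: hdotDr|exact: hdot0r]. Qed.

Lemma rnorm_sum_sqr (I : finType) (P : pred I) (v : I -> H) :
  (forall i j, i != j -> hdot (v i) (v j) = 0) ->
  rnorm (\sum_(i | P i) v i) ^+ 2 = \sum_(i | P i) rnorm (v i) ^+ 2.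
Proof.
move=> vO; rewrite -rdotxx /rdot hdot_suml raddf_sum; apply: eq_bigr => i Pi.
rewrite hdot_sumr (bigD1 i) //= big1 ?addr0 ?hdotxx // => j /andP[_ ji].
by rewrite vO // eq_sym.
Qed.

Variable B : set H.
Hypothesis B_on : orthonormal_set B.

Lemma orthonormal_rnorm b : B b -> rnorm b = 1.
Proof.
move=> Bb; have := B_on Bb Bb; rewrite eqxx hdotxx => /(congr1 (@complex.Re R)) /= /eqP.
by rewrite sqrf_eq1 => /orP[/eqP//|/eqP h]; have := rnorm_ge0 b; rewrite h; lra.
Qed.

Lemma orthonormal_coef (I : finType) (b : I -> H) (a : I -> R[i]) k :
  injective b -> (forall i, B (b i)) -> hdot (\sum_i a i *: b i) (b k) = a k.
Proof.
move=> bI bB; rewrite hdot_suml (bigD1 k) //= big1 ?addr0.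
  by rewrite hdotZl B_on // eqxx mulr1.
by move=> i ik; rewrite hdotZl B_on // (inj_eq bI) (negbTE ik) mulr0.
Qed.

Lemma orthonormal_rnorm_sum (I : finType) (P : pred I) (b : I -> H) (a : I -> R[i]) :
  injective b -> (forall i, B (b i)) ->
  rnorm (\sum_(i | P i) a i *: b i) ^+ 2 = \sum_(i | P i) complex.Re `|a i| ^+ 2.
Proof.
move=> bI bB; rewrite rnorm_sum_sqr.
  by apply: eq_bigr => i _; rewrite rnormZ orthonormal_rnorm // mulr1.
by move=> i j ij; rewrite hdotZl hdotZr B_on // (inj_eq bI) (negbTE ij) !mulr0.
Qed.

(** The sequences in [lin_span] may repeat vectors; repetitions are collected by multiplying
    coefficients by multiplicities. *)
Lemma lin_spanP x : lin_span B x <-> exists (n : nat) (b : 'I_n -> H) (a : 'I_n -> R[i]),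
  [/\ injective b, forall i, B (b i) & x = \sum_i a i *: b i].
Proof.
split=> [[s [c [sB ->]]]|[n [b [a [bI bB ->]]]]].
  pose u := undup s.
  have e : \sum_(b <- s) c b *: b = \sum_(b <- u) ((count_mem b s)%:R * c b) *: b.
    rewrite -big_undup_iterop_count /=; apply: eq_bigr => b _.
    by rewrite -scalerA scaler_nat.
  exists (size u), (fun i => nth 0 u i), (fun i => (count_mem (nth 0 u i) s)%:R * c (nth 0 u i)).
  split.
  - move=> i j /eqP; rewrite nth_uniq ?undup_uniq // => /eqP; exact: val_inj.
  - by move=> i; apply: sB; rewrite -mem_undup mem_nth.
  - by rewrite e (big_nth 0) big_mkord.
(* The coefficient, as a function of the vector, is recovered as an inner product with the whole
   sum. *)
exists [seq b i | i <- enum 'I_n], (fun x => hdot (\sum_i a i *: b i) x); split.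
  by move=> _ /mapP[i _ ->].
rewrite big_map big_enum /=.
by apply: eq_bigr => i _; rewrite orthonormal_coef.
Qed.

Lemma sub_lin_span b : B b -> lin_span B b.
Proof.
move=> Bb; exists [:: b], (fun=> 1); split; first by move=> c; rewrite inE => /eqP->.
by rewrite big_seq1 scale1r.
Qed.

End orthogonal_sums.

(** * Comparison of Hilbert dimensions *)

Section dimension.
Variables (R : realType) (H H' : hilbertType R) (B : set H) (C : set H').
Variables (Phi : {linear H -> H'}) (K : R).
Hypotheses (B_on : orthonormal_set B) (C_on : orthonormal_set C).
Hypothesis Phi_le : forall x, rnorm (Phi x) <= K * rnorm x.
Hypothesis Phi_inj : forall x, lin_span B x ->
  (forall c, C c -> hdot (Phi x) c = 0) -> x = 0.

Lemma orthonormal_neq0 b : B b -> b <> 0.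
Proof. by move=> /(orthonormal_rnorm B_on) + b0; rewrite b0 rnorm0; lra. Qed.

(** Linear algebra: [n.+1] vectors of [B] tested against the [n] vectors of [C] give a matrix with a
    nontrivial left kernel, hence a nonzero combination killed by all the tests. *)
Lemma finite_dim_le : finite_set C -> B #<= C.
Proof.
move=> [n Cn]; apply: contrapT => /negP nBC.
have [f fB fI] : exists2 f : 'I_n.+1 -> H, (forall i, B (f i)) & injective f.
  have : `I_n.+1 #<= B.
    have [[m Bm]|/infiniteP Binf] := pselect (finite_set B); last first.
      apply: card_le_trans Binf; exact: subset_card_le.
    rewrite (card_le_eqr Bm) card_le_II ltnNge; apply: contra nBC => mn.
    by rewrite (card_le_eql Bm) (card_le_eqr Cn) card_le_II.
  move=> /card_le_funP[g gI].
  have iP (i : 'I_n.+1) : val i \in `I_n.+1 by rewrite inE /=.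
  exists (fun i => val (g (SigSub (iP i)))) => [i|i j /val_inj/gI/(congr1 val) /=].
    exact: set_mem (valP (g _)).
  exact: val_inj.
have /card_set_bijP[c [cC cI cO]] : `I_n #= C by apply: card_esym.
pose A : 'M[R[i]]_(n.+1, n) := \matrix_(i, j) hdot (Phi (f i)) (c j).
have : kermx A != 0.
  by rewrite -mxrank_eq0 mxrank_ker subn_eq0 -ltnNge ltnS rank_leq_col.
move=> /rowV0Pn[v /sub_kermxP vA v0]; pose x := \sum_i v 0 i *: f i.
have x0 : x = 0.
  apply: Phi_inj; first by apply/(lin_spanP B_on); exists n.+1, f, (fun i => v 0 i).
  move=> _ /cO[j jn <-]; rewrite /x linear_sum hdot_suml.
  have := congr1 (fun N : 'M[R[i]]_(1, n) => N 0 (Ordinal jn)) vA; rewrite !mxE => E0; rewrite -[RHS]E0.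
  by apply: eq_bigr => i _; rewrite linearZ hdotZl mxE.
move/negP: v0; apply; apply/eqP/rowP => k.
by rewrite mxE -(orthonormal_coef B_on (fun i => v 0 i) k fI fB) -/x x0 hdot0l.
Qed.

(* Bessel's inequality for the functional [x |-> <Phi x, c>], without Riesz. *)
Lemma countable_coefs c : C c -> countable [set b | B b /\ hdot (Phi b) c <> 0].
Proof.
move=> Cc; pose a b : R := complex.Re `|hdot (Phi b) c|.
pose D k := [set b | B b /\ k.+1%:R^-1 < a b].
have aE b : `|hdot (Phi b) c| = (a b)%:C by rewrite RRe_real // normr_real.
have -> : [set b | B b /\ hdot (Phi b) c <> 0] = \bigcup_k D k.
  apply/seteqP; split=> [b [Bb b0]|b [k _ [Bb h]]]; last first.
    by split => // b0; move: h; rewrite /a b0 normr0 /= ltNge invr_ge0 ler0n.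
  have : 0 < a b by rewrite -ltcR -aE normr_gt0; apply/eqP.
  move=> ab; exists (Num.truncn (a b)^-1) => //; split => //.
  by rewrite invf_plt ?posrE // truncnS_gt.
apply: bigcup_countable => // k _; apply: finite_set_countable.
apply: contrapT => /infiniteP/card_le_funP[g gI].
(* More than [K ^+ 2 * k.+1%:R ^+ 2] coefficients above [k.+1%:R^-1] are contradictory: with the
   conjugate coefficients, [rnorm x ^+ 2] equals the pairing of [Phi x] with [c], so [rnorm x <= K],
   although [rnorm x ^+ 2] exceeds [K ^+ 2]. *)
pose N := (Num.truncn (K ^+ 2 * k.+1%:R ^+ 2)).+1.
pose f (i : 'I_N) := val (g (SigSub (in_setT (val i)))).
have fD i : D k (f i) := set_mem (valP (g _)).
have fI : injective f.
  by move=> i j; rewrite /f => /val_inj/gI/(congr1 val) /=; exact: val_inj.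
pose x := \sum_i (hdot (Phi (f i)) c)^* *: f i.
have xc : hdot (Phi x) c = (\sum_i a (f i) ^+ 2)%:C.
  rewrite /x linear_sum hdot_suml rmorph_sum; apply: eq_bigr => i _.
  by rewrite linearZ hdotZl mulrC -normCK aE rmorphXn.
have xn : rnorm x ^+ 2 = \sum_i a (f i) ^+ 2.
  rewrite (orthonormal_rnorm_sum B_on) //; last by move=> i; exact: (fD i).1.
  by apply: eq_bigr => i _; rewrite norm_conjC.
have := rdot_le (Phi x) c; rewrite /rdot xc -xn (orthonormal_rnorm C_on Cc) mulr1 /=.
rewrite ger0_norm ?sqr_ge0 // => /le_trans/(_ (Phi_le x)) h1.
have h2 : N%:R * k.+1%:R^-1 ^+ 2 <= rnorm x ^+ 2.
  rewrite xn -[N in N%:R]card_ord -sum1_card natr_sum mulr_suml.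
  apply: ler_sum => i _; rewrite mul1r ler_sqr ?nnegrE ?invr_ge0 // ?(ltW (fD i).2) //.
  by apply: le_trans (ltW (fD i).2); rewrite invr_ge0.
have h3 : K ^+ 2 < N%:R * k.+1%:R^-1 ^+ 2.
  rewrite exprVn ltr_pdivlMr ?exprn_gt0 //; exact: truncnS_gt.
have x0 : 0 < rnorm x.
  rewrite lt_neqAle rnorm_ge0 andbT eq_sym; apply/eqP => x0.
  by move: h2; rewrite x0 expr0n /= leNgt mulr_gt0 // exprn_gt0 // invr_gt0.
have h4 : rnorm x <= K by rewrite -(ler_pM2r x0) -expr2.
have := lt_le_trans h3 h2; rewrite ltNge; apply/negP; rewrite negbK.
by rewrite ler_sqr ?nnegrE ?rnorm_ge0 // (le_trans (rnorm_ge0 _) h4).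
Qed.

(** For infinite [C], send [b] to some [c] on which [Phi b] has a nonzero coefficient. The fibres
    are countable, so [B] embeds into [C * nat] and then into [C]. *)
Lemma dim_le : B #<= C.
Proof.
have [/finite_dim_le//|Cinf] := pselect (finite_set C).
have [|e eI] := @infinite_card_prod_nat C.
  by apply: contra_not Cinf; rewrite (eq_finite_set (card_setT C)).
have ex (b : B) : exists c : C, hdot (Phi (val b)) (val c) <> 0.
  have Bb := set_mem (valP b).
  apply: contrapT => nc; apply: (orthonormal_neq0 Bb).
  apply: Phi_inj; first exact: sub_lin_span.
  move=> c Cc; apply: contrapT => bc; apply: nc.
  by exists (SigSub (mem_set Cc)).
have [f fP] := choice ex.
have exr (c : C) : exists r : H -> nat, forall b b',
    B b -> B b' -> hdot (Phi b) (val c) <> 0 -> hdot (Phi b') (val c) <> 0 ->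
    r b = r b' -> b = b'.
  have /countable_injP[r rI] := countable_coefs (set_mem (valP c)).
  by exists r => b b' Bb Bb' h h'; apply: rI; rewrite inE.
have [r rP] := choice exr.
apply/card_le_funP; exists (fun b : B => e (f b, r (f b) (val b))) => b b' /eI[fb].
rewrite fb => rb; apply: val_inj; apply: (rP (f b')) rb; try exact: set_mem (valP _).
  by rewrite -fb; exact: fP.
exact: fP.
Qed.

End dimension.

(** * Spectral measures *)

Section spectral.
Variable R : realType.
Local Notation bR := (measurableTypeR R).
Local Notation halfline := (@halfline R).

Lemma borel_halflineT : borel_halfline halfline.
Proof. by split => //; exact: measurable_halfline. Qed.

Lemma borel_halfline0 : @borel_halfline R set0.
Proof. by split. Qed.

Lemma borel_halflineD (S S' : set bR) :
  borel_halfline S -> borel_halfline S' -> borel_halfline (S `\` S').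
Proof. by move=> [mS Sh] [mS' _]; split; [exact: measurableD|move=> t [/Sh]]. Qed.

Lemma borel_halflineI (S S' : set bR) :
  borel_halfline S -> borel_halfline S' -> borel_halfline (S `&` S').
Proof. by move=> [mS Sh] [mS' _]; split; [exact: measurableI|move=> t [/Sh]]. Qed.

Section pvm.
Variables (H : hilbertType R) (E : set bR -> {linear H -> H}).
Hypothesis pE : projection_valued_measure E.

Lemma pvm_adj S x y : borel_halfline S -> hdot (E S x) y = hdot x (E S y).
Proof. by move=> /(pvm_proj pE)[_ + _]; apply. Qed.

Lemma pvm_idem S x : borel_halfline S -> E S (E S x) = E S x.
Proof. by move=> /(pvm_proj pE)[_ _]; apply. Qed.

Lemma pvm_sub S S' x : borel_halfline S -> borel_halfline S' -> S `<=` S' ->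
  E S x = x -> E S' x = x.
Proof.
by move=> bS bS' /setIidr SS' Sx; rewrite -{1}Sx -(pvm_setI pE) // SS'.
Qed.

Lemma pvm_disj S S' x y : borel_halfline S -> borel_halfline S' ->
  S `&` S' = set0 -> E S x = x -> E S' y = y -> hdot x y = 0.
Proof.
move=> bS bS' SS' <- <-; rewrite pvm_adj // -(pvm_setI pE) // SS'.
by rewrite (pvm_set0 pE) hdot0r.
Qed.

Lemma pvm_comm S S' x : borel_halfline S -> borel_halfline S' ->
  E S (E S' x) = E S' (E S x).
Proof. by move=> bS bS'; rewrite -!(pvm_setI pE) // setIC. Qed.

Lemma pvm_add S S' x : borel_halfline S -> borel_halfline S' ->
  S `&` S' = set0 -> E (S `|` S') x = E S x + E S' x.
Proof.
move=> bS bS' SS'.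
pose F k := if k is 0%N then S else if k is 1%N then S' else set0.
have bF k : borel_halfline (F k) by case: k => [|[|k]] //; exact: borel_halfline0.
have tF : trivIset setT F.
  move=> [|[|i]] [|[|j]] _ _ // [t [a b]] //; try by case: a.
  all: try by case: b.
  - by have : set0 t by rewrite -SS'.
  - by have : set0 t by rewrite -SS'.
have -> : S `|` S' = \bigcup_k F k.
  apply/seteqP; split => [t [St|S't]|t [[|[|k]] _]] //=; last 2 first.
  - by left.
  - by right.
  - by exists 0%N.
  - by exists 1%N.
have /rnorm_cvgP lim := @pvm_sigma_additive _ _ _ pE F bF tF x.
apply/eqP; rewrite -subr_eq0; apply/eqP/rnorm_eq0/eqP.
rewrite eq_le rnorm_ge0 andbT; apply/ler_addgt0Pr => e /lim[N NP]; rewrite add0r.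
have := NP N.+2 (leq_trans (leqnSn _) (leqnSn _)).
rewrite 2!big_ord_recl big1 ?addr0 => [/ltW//|i _].
by rewrite /= (pvm_set0 pE).
Qed.

Lemma pvm_split S x : borel_halfline S -> x = E S x + E (halfline `\` S) x.
Proof.
move=> bS; have bS' := borel_halflineD borel_halflineT bS.
rewrite -pvm_add //; last by apply/seteqP; split => // t [? []].
by rewrite setDUK ?(pvm_setT pE) //; exact: bS.2.
Qed.

Lemma pvm_le S x : borel_halfline S -> rnorm (E S x) <= rnorm x.
Proof.
move=> bS; have [->|] := eqVneq (rnorm (E S x)) 0; first exact: rnorm_ge0.
move=> n0; have p0 : 0 < rnorm (E S x) by rewrite lt_neqAle eq_sym n0 rnorm_ge0.
rewrite -(ler_pM2r p0) -expr2 -rdotxx /rdot pvm_adj // pvm_idem // -/(rdot _ _).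
exact: (le_trans (ler_norm _) (rdot_le _ _)).
Qed.

Lemma pvm_range S x : borel_halfline S -> range (E S) x <-> E S x = x.
Proof. by move=> bS; split => [[y _ <-]|<-]; [exact: pvm_idem|exists x]. Qed.

Lemma pvm_closed S x : borel_halfline S -> closure [set y | E S y = y] x -> E S x = x.
Proof.
move=> bS /closureP cl; apply/eqP; rewrite -subr_eq0; apply/eqP/rnorm_eq0/eqP.
rewrite eq_le rnorm_ge0 andbT; apply: (@ler_arch _ _ _ 2) => e /cl[y /= Sy xy].
have -> : E S x - x = E S (x - y) + (y - x) by rewrite linearB /= Sy addrA subrK.
apply: (le_trans (rnormD _ _)); rewrite (rnorm_sub y).
by have := pvm_le (x - y) bS; lra.
Qed.

End pvm.

Section modulus.
Variables (H H' : hilbertType R) (T : {linear H -> H'}) (A : {linear H -> H}).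
Variable E : set bR -> {linear H -> H}.
Hypotheses (TA : is_modulus T A) (sE : is_spectral_measure A E).

Let pE : projection_valued_measure E := sE.1.

Lemma modulus_adj x y : hdot (A x) y = hdot x (A y).
Proof. by have [[_ adj _] _] := TA; exact: adj. Qed.

Lemma modulus_hdot x y : hdot (T x) (T y) = hdot (A x) (A y).
Proof.
by have [_ [Ts [_ adj AA]]] := TA; rewrite adj -AA modulus_adj.
Qed.

Lemma modulus_rnorm x : rnorm (T x) = rnorm (A x).
Proof.
apply/eqP; rewrite -(eqrXn2 (n:=2)) ?rnorm_ge0 //.
by rewrite -!rdotxx /rdot modulus_hdot.
Qed.

Lemma modulus_rdot_sym x y : rdot (A x) y = rdot (A y) x.
Proof. by rewrite /rdot modulus_adj -/(rdot _ _) rdotC. Qed.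

Lemma modulus_ge0 x : 0 <= rdot (A x) x.
Proof.
have [[_ _ pos] _] := TA; have := pos x.
by rewrite lecE => /andP[_].
Qed.

Let mid : measurable_fun halfline (fun t : bR => (t : R)%:E).
Proof. by apply/measurable_EFinP; exact: measurable_id. Qed.

Let nonneg (t : bR) : halfline t -> (0 <= (t : R)%:E)%E.
Proof. by move=> t0; rewrite lee_fin. Qed.

Lemma spectral_integral S x : borel_halfline S -> E S x = x ->
  exists2 mu : {measure set bR -> \bar R}, mu S = (rnorm x ^+ 2)%:E &
    ((rdot (A x) x)%:E = \int[mu]_(t in S) (t : R)%:E)%E.
Proof.
move=> bS Sx; have [mu muE Ax] := sE.2 x; exists mu.
  by rewrite muE ?setIidl; [|exact: bS.2|exact: bS.1]; rewrite Sx -/(rdot x x) rdotxx.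
rewrite Ax (@ge0_negligible_integral _ _ _ _ _ (halfline `\` S)) //.
- by rewrite setDD setIidr //; exact: bS.2.
- by apply: measurableD; [exact: measurable_halfline|exact: bS.1].
- exact: measurable_halfline.
- rewrite muE; last by apply: measurableD; [exact: measurable_halfline|exact: bS.1].
  rewrite setIidl; last by move=> t [].
  have : E (halfline `\` S) x = 0.
    by have := pvm_split pE x bS; rewrite Sx => /eqP; rewrite -subr_eq0 opprD addrA subrr sub0r oppr_eq0 => /eqP.
  by move=> ->; rewrite hdot0l.
Qed.

Lemma rdot_upper S (b : R) x : borel_halfline S -> (forall t, S t -> (t : R) <= b) ->
  E S x = x -> rdot (A x) x <= b * rnorm x ^+ 2.
Proof.
move=> bS Sb Sx; have [mu muS Ax] := spectral_integral bS Sx.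
have [mS Sh] := bS.
rewrite -lee_fin Ax EFinM -muS -integral_cst //; apply: ge0_le_integral => //.
Qed.

Lemma rdot_lower S (a : R) x : 0 <= a -> borel_halfline S -> (forall t, S t -> a <= (t : R)) ->
  E S x = x -> a * rnorm x ^+ 2 <= rdot (A x) x.
Proof.
move=> a0 bS Sa Sx; have [mu muS Ax] := spectral_integral bS Sx.
have [mS Sh] := bS.
rewrite -lee_fin Ax EFinM -muS -integral_cst //; apply: ge0_le_integral => //.
Qed.

(** [E] is tied to [A] only through the quadratic form, so this needs polarisation: the scalar
    measure of [x + y] is the sum of those of [x] and [y], hence the cross term of the form
    vanishes. *)
Lemma modulus_orth S S' x y : borel_halfline S -> borel_halfline S' ->
  S `&` S' = set0 -> E S x = x -> E S' y = y -> hdot (A x) y = 0.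
Proof.
move=> bS bS' SS' Sx S'y; apply: hdot_rdot => c.
have {S'y} : E S' (c *: y) = c *: y by rewrite linearZ /= S'y.
move: (c *: y) => {c}y S'y.
have cross U : borel_halfline U -> hdot (E U x) y = 0 /\ hdot (E U y) x = 0.
  move=> bU; split.
    by apply: (pvm_disj pE bS bS' SS') => //; rewrite (pvm_comm pE) // Sx.
  apply: hdot_sym0; apply: (pvm_disj pE bS bS' SS') => //.
  by rewrite (pvm_comm pE) // S'y.
have [mu muE Ax] := sE.2 x; have [nu nuE Ay] := sE.2 y.
have [ka kaE Axy] := sE.2 (x + y).
have : (rdot (A (x + y)) (x + y))%:E = ((rdot (A x) x)%:E + (rdot (A y) y)%:E)%E.
  rewrite Ax Ay Axy -ge0_integral_measure_add //; last exact: measurable_halfline.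
  apply: eq_measure_integral => U mU Uh; rewrite kaE //.
  transitivity (mu U + nu U)%E; last exact: esym (measure_addE mu nu U).
  rewrite muE // nuE //.
  rewrite -EFinD -raddfD /= linearD hdotDl !hdotDr.
  have [-> ->] : hdot (E (U `&` halfline) x) y = 0 /\ hdot (E (U `&` halfline) y) x = 0.
    by apply: cross; apply: borel_halflineI => //; exact: borel_halflineT.
  by rewrite addr0 add0r.
rewrite -EFinD => -[]; rewrite linearD rdotDl !rdotDr (modulus_rdot_sym y x).
lra.
Qed.

(** The component of [A x] outside the subspace has squared norm equal to its pairing with [A x],
    which vanishes by [modulus_orth]. *)
Lemma modulus_commute S x : borel_halfline S -> E S x = x -> E S (A x) = A x.
Proof.
move=> bS Sx; have bS' := borel_halflineD borel_halflineT bS.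
have S0 : S `&` (halfline `\` S) = set0 by apply/seteqP; split => // t [? []].
have z0 : E (halfline `\` S) (A x) = 0.
  apply/rnorm_eq0/eqP; rewrite -sqrf_eq0 -rdotxx /rdot (pvm_adj pE) // (pvm_idem pE) //.
  by rewrite (modulus_orth bS bS' S0 Sx) // (pvm_idem pE).
by rewrite [RHS](pvm_split pE _ bS) z0 addr0.
Qed.

Lemma modulus_orth2 S S' x y : borel_halfline S -> borel_halfline S' ->
  S `&` S' = set0 -> E S x = x -> E S' y = y -> hdot (T x) (T y) = 0.
Proof.
move=> bS bS' SS' Sx S'y; rewrite modulus_hdot.
by apply: (modulus_orth bS bS') => //; exact: modulus_commute.
Qed.

Lemma modulus_CS x y : rdot (A x) y ^+ 2 <= rdot (A x) x * rdot (A y) y.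
Proof.
apply: discriminant_le; rewrite ?modulus_ge0 // => t.
have := modulus_ge0 (x + t%:C *: y); rewrite linearD linearZ /=.
rewrite rdotDl !rdotDr !rdotZl !rdotZr (modulus_rdot_sym y x).
by move/le_trans; apply; rewrite le_eqVlt; apply/orP; left; apply/eqP; ring.
Qed.

(** [modulus_CS] for [x] and [A x] bounds the fourth power of [rnorm (A x)] by the product of the
    forms at [x] and at [A x]. Both are controlled by [b] because [A] preserves the spectral
    subspace. *)
Lemma modulus_upper S (b : R) x : borel_halfline S -> (forall t, S t -> (t : R) <= b) ->
  0 <= b -> E S x = x -> rnorm (T x) <= b * rnorm x.
Proof.
move=> bS Sb b0 Sx; rewrite modulus_rnorm.
have := modulus_CS x (A x); rewrite rdotxx => h.
have h1 := rdot_upper bS Sb Sx; have h2 := rdot_upper bS Sb (modulus_commute bS Sx).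
have [z|z] := eqVneq (rnorm (A x)) 0; first by rewrite z mulr_ge0 ?rnorm_ge0.
have z0 : 0 < rnorm (A x) by rewrite lt_neqAle eq_sym z rnorm_ge0.
rewrite -ler_sqr ?nnegrE ?mulr_ge0 ?rnorm_ge0 // -(ler_pM2r (exprn_gt0 2 z0)) -expr2.
apply: (le_trans h); apply: (le_trans (ler_pM (modulus_ge0 _) (modulus_ge0 _) h1 h2)).
by rewrite le_eqVlt; apply/orP; left; apply/eqP; ring.
Qed.

Lemma modulus_lower S (a : R) x : 0 <= a -> borel_halfline S -> (forall t, S t -> a <= (t : R)) ->
  E S x = x -> a * rnorm x <= rnorm (T x).
Proof.
move=> a0 bS Sa Sx; rewrite modulus_rnorm.
have [->|z] := eqVneq (rnorm x) 0; first by rewrite mulr0 rnorm_ge0.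
have z0 : 0 < rnorm x by rewrite lt_neqAle eq_sym z rnorm_ge0.
rewrite -(ler_pM2r z0) -mulrA -expr2; apply: (le_trans (rdot_lower a0 bS Sa Sx)).
exact: (le_trans (ler_norm _) (rdot_le _ _)).
Qed.

Lemma rnorm_sqr_split S x : borel_halfline S ->
  rnorm (T x) ^+ 2 = rnorm (T (E S x)) ^+ 2 + rnorm (T (E (halfline `\` S) x)) ^+ 2.
Proof.
move=> bS; have bS' := borel_halflineD borel_halflineT bS.
rewrite {1}(pvm_split pE x bS) linearD pythagoras //.
apply: (modulus_orth2 bS bS'); rewrite ?(pvm_idem pE) //.
by apply/seteqP; split => // t [? []].
Qed.

Lemma rnorm_part_le S x : borel_halfline S -> rnorm (T (E S x)) <= rnorm (T x).
Proof.
move=> bS; rewrite -ler_sqr ?nnegrE ?rnorm_ge0 // (rnorm_sqr_split x bS).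
by rewrite lerDl sqr_ge0.
Qed.

(** Away from 0 the half-line is a countable union of sets bounded below by positive numbers, here
    []1, oo[] and dyadic bands. On each of them [T] is bounded below, so a vector of the kernel has
    no component there. *)
Lemma kernelE x : T x = 0 <-> E origin x = x.
Proof.
split=> [Tx|Ox]; last first.
  apply/rnorm_eq0/eqP; rewrite eq_le rnorm_ge0 andbT.
  have := @modulus_upper origin 0 x (@borel_origin R); rewrite mul0r; apply => //.
  by move=> t ->.
pose F k := if k is k'.+1 then band 1 2 k' else @above R 1.
have above0 S (a : R) : 0 < a -> borel_halfline S -> (forall t, S t -> a <= (t : R)) -> E S x = 0.
  move=> a0 bS Sa; apply/rnorm_eq0/eqP; rewrite eq_le rnorm_ge0 andbT -(ler_pM2l a0) mulr0.
  have := modulus_lower (ltW a0) bS Sa (pvm_idem pE x bS) => /le_trans; apply.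
  by apply: (le_trans (rnorm_part_le x bS)); rewrite Tx rnorm0.
have bF k : borel_halfline (F k).
  by case: k => [|k]; [exact: borel_above|apply: borel_band; rewrite ?ltr01 ?ltr1n].
have F0 k : E (F k) x = 0.
  case: k (bF k) => [|k] bk; first by apply: (above0 _ 1) => // t; exact: ltW.
  apply: (above0 _ (1 / 2 ^+ k.+1) _ bk) => [|t /andP[h _]]; last exact: ltW.
  by rewrite divr_gt0 // exprn_gt0.
have b1 j (t : bR) : band 1 2 j t -> (t : R) <= 1.
  move=> /andP[_ /le_trans]; apply.
  by rewrite ler_pdivrMr ?exprn_gt0 // mul1r exprn_ege1 // ler1n.
have tF : trivIset setT F.
  move=> [|i] [|j] _ _ // [t [a b]].
  - by have := lt_le_trans a (b1 _ _ b); rewrite ltxx.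
  - by have := lt_le_trans b (b1 _ _ a); rewrite ltxx.
  - by congr _.+1; apply: (@trivIset_band R 1 2) => //; rewrite ?ltr01 ?ltr1n //; exists t.
have UF : halfline `\` origin = \bigcup_k F k.
  apply/seteqP; split => [t [th t0]|t [k _ kt]].
    have tp : 0 < (t : R) by rewrite lt_neqAle th andbT eq_sym; apply/eqP.
    have [t1|t1] := leP (t : R) 1; last by exists 0%N.
    have g2 : 1 < 2 :> R by rewrite ltr1n.
    by have [n nt] := band_cover g2 tp t1; exists n.+1.
  split; first exact: (bF k).2.
  have t0 : 0 < (t : R).
    case: k kt => [|k] kt; first exact: lt_trans kt.
    by apply: (band_gt0 _ _ kt); rewrite ?ltr01 ?ltr1n.
  by move=> t0'; move: t0; rewrite t0' ltxx.
have /rnorm_cvgP lim := @pvm_sigma_additive _ _ _ pE F bF tF x.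
rewrite [RHS](pvm_split pE x (@borel_origin R)) UF.
suff -> : E (\bigcup_k F k) x = 0 by rewrite addr0.
apply/rnorm_eq0/eqP; rewrite eq_le rnorm_ge0 andbT; apply/ler_addgt0Pr => e /lim[N /(_ N (leqnn N))].
by rewrite big1 ?subr0 ?add0r => [/ltW|i _].
Qed.

End modulus.

End spectral.

(** * Equivalent operators have comparable spectral dimensions *)

Section comparison.
Variable R : realType.
Local Notation bR := (measurableTypeR R).
Local Notation halfline := (@halfline R).

Lemma sub_closure (H : hilbertType R) (B : set H) : B `<=` closure B.
Proof. by move=> x Bx; apply/closureP => e e0; exists x => //; rewrite subrr rnorm0. Qed.

(** A vector of [F'] orthogonal to [C] vanishes, as the span of [C] is dense in [F']; injectivity on
    [F] is thus what [dim_le] asks for. *)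
Lemma hilbert_dim_le (H H' : hilbertType R) (F : set H) (F' : set H') (k k' : Type)
    (Phi : {linear H -> H'}) (K : R) :
  hilbert_dim F k -> hilbert_dim F' k' ->
  (forall x, rnorm (Phi x) <= K * rnorm x) ->
  (forall x, F x -> F' (Phi x)) -> (forall x, F x -> Phi x = 0 -> x = 0) ->
  [set: k] #<= [set: k'].
Proof.
move=> [B [Bo Bc] kB] [C [Co Cc] kC] Phi_le PhiF PhiI.
rewrite (card_le_eql kB) (card_le_eqr kC).
apply: (dim_le Bo Co Phi_le) => x Bx Phix.
have Fx : F x by rewrite -Bc; exact: sub_closure.
apply: PhiI => //; apply/rnorm_eq0/eqP; rewrite -sqrf_eq0 -rdotxx /rdot.
rewrite (@orthogonal_closure _ _ (lin_span C)) //; last by rewrite Cc; exact: PhiF.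
move=> z [s [c [sC ->]]]; rewrite hdot_sumr big_seq big1 // => b /sC Cb.
by rewrite hdotZr Phix // mulr0.
Qed.

Lemma closed_image (H H' : hilbertType R) (F : set H) (L : {linear H -> H'}) (c k : R) :
  0 < c -> 0 < k -> closure F `<=` F -> (forall x y, F x -> F y -> F (x - y)) ->
  (forall x, rnorm (L x) <= c * rnorm x) -> (forall x, F x -> rnorm x <= k * rnorm (L x)) ->
  closure (L @` F) `<=` L @` F.
Proof.
move=> c0 k0 Fc FB Lc Lk w /closureP wcl.
have ex n : exists f, F f /\ rnorm (w - L f) < n.+1%:R^-1.
  have e0 : 0 < n.+1%:R^-1 :> R by rewrite invr_gt0.
  by have [_ [f Ff <-] wf] := wcl _ e0; exists f.
have [f fP] := choice ex.
have [|l lP] := @rnorm_complete _ H f.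
  move=> e e0; have k2 : 0 < 2 * k by rewrite mulr_gt0.
  have [N NP] := invS_lt (divr_gt0 e0 k2).
  exists N => m n Nm Nn; apply: (le_lt_trans (Lk _ (FB _ _ (fP m).1 (fP n).1))).
  have := lt_trans (fP m).2 (NP _ Nm); have := lt_trans (fP n).2 (NP _ Nn).
  rewrite !ltr_pdivlMr // linearB /=; have := rnorm_tri w (L (f m)) (L (f n)).
  rewrite (rnorm_sub _ w) => h h1 h2; have h3 := ler_wpM2l (ltW k0) h.
  apply: (le_lt_trans h3); rewrite mulrDr [ltRHS]splitr.
  by apply: ltrD; rewrite ltr_pdivlMr // -mulrA (mulrC k) -mulrA.
exists l.
  by apply/Fc/closureP => e /lP[N NP]; exists (f N); [exact: (fP N).1|exact: NP].
apply/esym/eqP; rewrite -subr_eq0; apply/eqP/rnorm_eq0/eqP.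
rewrite eq_le rnorm_ge0 andbT; apply: (@ler_arch _ _ _ (1 + c)) => e e0.
have [N NP] := lP _ e0; have [N' NP'] := invS_lt e0.
have h1 := lt_trans (fP (maxn N N')).2 (NP' _ (leq_maxr _ _)).
have h2 := NP _ (leq_maxl N N'); move: h1 h2; set g := f _ => h1 h2.
rewrite add0r mulrDl mul1r; apply: (le_trans (rnorm_tri (L g) _ _)).
apply: lerD; first exact: ltW.
rewrite rnorm_sub -linearB; apply: (le_trans (Lc _)).
by rewrite ler_pM2l // ltW.
Qed.

Section operators.
Variables (H1 H1' H2 H2' : hilbertType R).
Variables (T1 : {linear H1 -> H1'}) (T2 : {linear H2 -> H2'}).
Variables (A1 : {linear H1 -> H1}) (A2 : {linear H2 -> H2}).
Variables (E1 : set bR -> {linear H1 -> H1}) (E2 : set bR -> {linear H2 -> H2}).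
Hypotheses (TA1 : is_modulus T1 A1) (sE1 : is_spectral_measure A1 E1).
Hypotheses (TA2 : is_modulus T2 A2) (sE2 : is_spectral_measure A2 E2).
Variables (U : {linear H1 -> H2}) (Ui : {linear H2 -> H1}) (C0 : R).
Hypotheses (C0_ge1 : 1 <= C0) (UK : cancel U Ui) (UiK : cancel Ui U).
Hypotheses (U_le : forall x, rnorm (U x) <= C0 * rnorm x).
Hypotheses (Ui_le : forall y, rnorm (Ui y) <= C0 * rnorm y).
Hypothesis T21 : forall x, rnorm (T2 (U x)) <= C0 * rnorm (T1 x).
Hypothesis T12 : forall x, rnorm (T1 x) <= C0 * rnorm (T2 (U x)).

Let p1 : projection_valued_measure E1 := sE1.1.
Let p2 : projection_valued_measure E2 := sE2.1.

Let C0_gt0 : 0 < C0 := lt_le_trans ltr01 C0_ge1.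

Let U_ge x : rnorm x <= C0 * rnorm (U x).
Proof. by rewrite -{1}(UK x). Qed.

Lemma kernel_dim_le k k' : hilbert_dim (range (E1 origin)) k ->
  hilbert_dim (range (E2 origin)) k' -> [set: k] #<= [set: k'].
Proof.
move=> d1 d2; have bo := @borel_origin R.
pose Phi : {linear H1 -> H2} := E2 origin \o U.
apply: (@hilbert_dim_le _ _ _ _ _ _ Phi C0 d1 d2).
- by move=> x; apply: (le_trans (pvm_le p2 _ bo)).
- by move=> x _; exists (U x).
move=> x /(pvm_range p1 x bo)/(kernelE TA1 sE1) T1x.
have : T2 (U x) = 0.
  apply/rnorm_eq0/eqP; rewrite eq_le rnorm_ge0 andbT.
  by have := T21 x; rewrite T1x rnorm0 mulr0.
move=> /(kernelE TA2 sE2); rewrite /Phi /= => -> Ux0.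
by rewrite -(UK x) Ux0 linear0.
Qed.

Section band.
Variables (a b : R).
Hypotheses (a_gt0 : 0 < a) (ab : a < b).

(** One factor [C0] pays for the comparison of [T2 \o U] with [T1], the other for the change of norm
    under [U] or its inverse. The 4 makes the unwanted component at most a quarter of the vector, so
    that it can be absorbed. *)
Let C : R := 4 * C0 ^+ 2.
Let C_gt0 : 0 < C. Proof. by rewrite mulr_gt0 // exprn_gt0. Qed.
Let C_ge1 : 1 <= C.
Proof. by have : 1 <= C0 ^+ 2 := exprn_ege1 2 C0_ge1; rewrite /C; lra. Qed.
Let b_gt0 : 0 < b := lt_trans a_gt0 ab.
Let bC_gt0 : 0 < b * C. Proof. exact: mulr_gt0. Qed.
Let aC_gt0 : 0 < a / C. Proof. exact: divr_gt0. Qed.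

(** The form of a complement is the one in which [pvm_split] for [above c] produces it. *)
Definition below (c : R) : set bR := halfline `\` above c.

Lemma borel_below c : 0 <= c -> borel_halfline (below c).
Proof. by move=> c0; apply: borel_halflineD; [exact: borel_halflineT|exact: borel_above]. Qed.

Lemma below_le c t : below c t -> (t : R) <= c.
Proof. by move=> [_ /negP]; rewrite -leNgt. Qed.

Let bb1 := borel_below (ltW a_gt0).
Let bb2 := borel_below (ltW b_gt0).
Let bblm := borel_below (ltW bC_gt0).
Let bblow := borel_below (ltW aC_gt0).
Let bmid := borel_oc (b * C) (ltW aC_gt0).
Let bF := borel_oc b (ltW a_gt0).

(** On its part above [b * C] the operator [T2] expands by at least [b * C], while [T2 (U x)] has
    norm at most [C0 * b * rnorm x]. Hence that part of [U x] is small and the rest retains most of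
    the norm. *)
Lemma below_embedding x : E1 (below b) x = x ->
  rnorm x <= 2 * C0 * rnorm (E2 (below (b * C)) (U x)).
Proof.
move=> xb; have ba := borel_above (ltW bC_gt0).
pose yh := E2 (above (b * C)) (U x); pose yl := E2 (below (b * C)) (U x).
have yE : U x = yh + yl := pvm_split p2 (U x) ba.
have h1 : b * C * rnorm yh <= rnorm (T2 yh).
  apply: (modulus_lower TA2 sE2 (ltW bC_gt0) ba) => [t|]; first exact: ltW.
  exact: (pvm_idem p2).
have h2 : rnorm (T2 yh) <= rnorm (T2 (U x)) := rnorm_part_le TA2 sE2 (U x) ba.
have h3 : rnorm (T1 x) <= b * rnorm x.
  by apply: (modulus_upper TA1 sE1 bb2) => // [t|]; [exact: below_le|exact: ltW].
have h4 : C * rnorm yh <= C0 * rnorm x.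
  rewrite -(ler_pM2l b_gt0) mulrA; apply: (le_trans h1); apply: (le_trans h2).
  by apply: (le_trans (T21 x)); rewrite mulrCA ler_pM2l.
have h5 : 4 * C0 * rnorm yh <= rnorm x.
  rewrite -(ler_pM2l C0_gt0) (_ : C0 * (4 * C0 * rnorm yh) = C * rnorm yh) //.
  by rewrite /C; ring.
have h6 : rnorm (U x) <= rnorm yh + rnorm yl by rewrite yE rnormD.
have h7 : 0 <= C0 * rnorm yl by rewrite mulr_ge0 ?rnorm_ge0 ?ltW.
have := le_trans (U_ge x) (ler_wpM2l (ltW C0_gt0) h6); rewrite -/yl.
move: h5 h7; rewrite mulrDr -!mulrA.
by move: (C0 * rnorm yl) (C0 * rnorm yh) (rnorm x) => *; lra.
Qed.

(* The compression of [U] maps the spectral subspace of [T1] below [a] onto a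
   dense subspace of the one of [T2] below [a / C]. *)
Lemma low_orthogonal z : E2 (below (a / C)) z = z ->
  (forall f, E1 (below a) f = f -> hdot z (U f) = 0) -> z = 0.
Proof.
move=> zlow zF; have ba := borel_above (ltW a_gt0).
pose x1 := E1 (below a) (Ui z); pose x2 := E1 (above a) (Ui z).
have xE : Ui z = x2 + x1 := pvm_split p1 (Ui z) ba.
have h1 : a * rnorm x2 <= rnorm (T1 x2).
  apply: (modulus_lower TA1 sE1 (ltW a_gt0) ba) => [t|]; first exact: ltW.
  exact: (pvm_idem p1).
have h2 : rnorm (T1 x2) <= rnorm (T1 (Ui z)) := rnorm_part_le TA1 sE1 (Ui z) ba.
have h3 : rnorm (T2 z) <= a / C * rnorm z.
  by apply: (modulus_upper TA2 sE2 bblow) => // [t|]; [exact: below_le|exact: ltW].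
have h4 : C * rnorm x2 <= C0 * rnorm z.
  rewrite -(ler_pM2l a_gt0) mulrCA; apply: (le_trans (ler_wpM2l (ltW C_gt0) (le_trans h1 h2))).
  have := T12 (Ui z); rewrite UiK => h5.
  apply: (le_trans (ler_wpM2l (ltW C_gt0) h5)).
  apply: (le_trans (ler_wpM2l (ltW C_gt0) (ler_wpM2l (ltW C0_gt0) h3))).
  by rewrite le_eqVlt; apply/orP; left; apply/eqP; field; rewrite gt_eqF.
have h5 : 4 * C0 * rnorm x2 <= rnorm z.
  rewrite -(ler_pM2l C0_gt0) (_ : C0 * (4 * C0 * rnorm x2) = C * rnorm x2) //.
  by rewrite /C; ring.
have zE : z = U x2 + U x1 by rewrite -linearD -xE UiK.
have h6 : rnorm z ^+ 2 <= rnorm z * rnorm (U x2).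
  rewrite -rdotxx {2}zE rdotDr [X in _ + X](_ : _ = 0) ?addr0.
    exact: (le_trans (ler_norm _) (rdot_le _ _)).
  by rewrite /rdot zF // (pvm_idem p1).
have h7 := U_le x2.
have := rnorm_ge0 z; rewrite le_eqVlt => /predU1P[/esym/rnorm_eq0//|zp].
move: h6; rewrite expr2 ler_pM2l // => h6; apply: rnorm_eq0.
move: h5 zp (le_trans h6 h7); rewrite -mulrA.
by move: (C0 * rnorm x2) (rnorm z) => *; lra.
Qed.

(* [U] need not map a spectral subspace into a neighbouring one, so the
   dimensions are compared modulo [S], the image of what lies below [a]: the
   part of [T1] in []a, b]] embeds into the complement of [S] below [b * C],
   and there only the component above [a / C] can be nonzero. *)
Lemma band_dim_le k k' : hilbert_dim (range (E1 (oc a b))) k ->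
  hilbert_dim (range (E2 (oc (a / C) (b * C)))) k' -> [set: k] #<= [set: k'].
Proof.
move=> d1 d2.
pose P := E2 (below (b * C)); pose F1 := [set f | E1 (below a) f = f].
pose L : {linear H1 -> H2} := P \o U.
have LE x : L x = P (U x) by [].
have L_le x : rnorm (L x) <= C0 * rnorm x by apply: (le_trans (pvm_le p2 _ bblm)).
have sub12 f : F1 f -> E1 (below b) f = f.
  apply: (pvm_sub p1) => //; move=> t [th nt]; split => // bt; apply: nt.
  exact: lt_trans bt.
pose S := L @` F1.
have F1_lin (c : R[i]) f g : F1 f -> F1 g -> F1 (c *: f + g).
  by rewrite /F1 /= linearP => -> ->.
have S_lin (c : R[i]) f g : S f -> S g -> S (c *: f + g).
  by move=> [x Fx <-] [y Fy <-]; exists (c *: x + y); [exact: F1_lin|rewrite linearP].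
have S0 : S 0 by exists 0; rewrite /F1 /= ?linear0.
have S_closed : closure S `<=` S.
  apply: (@closed_image _ _ _ _ C0 (2 * C0)) => //.
  - by rewrite mulr_gt0.
  - by move=> x; exact: (pvm_closed p1).
  - by move=> x y Fx Fy; rewrite addrC -scaleN1r; exact: F1_lin.
  - by move=> x /sub12; exact: below_embedding.
have [Q [Q_le Q_orth Q_sub]] := complement_projection S0 S_lin S_closed.
pose Phi : {linear H1 -> H2} := E2 (oc (a / C) (b * C)) \o (Q \o L).
apply: (@hilbert_dim_le _ _ _ _ _ _ Phi C0 d1 d2).
- move=> x; apply: (le_trans (pvm_le p2 _ bmid)).
  exact: (le_trans (Q_le _) (L_le x)).
- by move=> x _; eexists.
move=> x /(pvm_range p1 x bF) xF; rewrite /Phi [in X in X -> _]/=; set z := Q _ => Pz0.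
have Lz : P z = z.
  have [f Ff fE] := Q_sub (L x).
  have -> : z = L x - L f by rewrite fE opprB addrC subrK.
  by rewrite linearB /= !(pvm_idem p2).
(* [z] lies below [b * C] and has no component in []a / C, b * C]], so it lies below [a / C]. *)
have zlow : E2 (below (a / C)) z = z.
  have zE : z = E2 (halfline `\` oc (a / C) (b * C)) z.
    by rewrite {1}(pvm_split p2 z bmid) Pz0 add0r.
  rewrite (_ : below (a / C) = below (b * C) `&` (halfline `\` oc (a / C) (b * C))).
    rewrite (pvm_setI p2) //; first by rewrite -zE.
    by apply: borel_halflineD => //; exact: borel_halflineT.
  apply/seteqP; split => t.
    move=> [th nt]; split; split => //.
      apply: contra_not nt => /= /(le_lt_trans _); apply.
      apply: (@le_trans _ _ a); first by rewrite ler_pdivrMr // ler_peMr // ltW.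
      by apply: (le_trans (ltW ab)); rewrite ler_peMr // ltW.
    by move=> /andP[/nt].
  move=> [[th nt] [_ nm]]; split => // ta; apply: nm; apply/andP; split => //.
  by rewrite leNgt; apply/negP.
(* Orthogonality to [S] is orthogonality to [P (U f)]; since [P z = z], the projection moves to [z]
   and disappears. *)
have z0 : z = 0.
  apply: low_orthogonal zlow _ => f Ff.
  have : hdot z (L f) = 0 by apply: Q_orth; exists f.
  by rewrite LE -(pvm_adj p2) // Lz.
(* Now [L x = L f] with [f] below [a]. As [L] is injective below [b], [x = f]; but a vector of []a,
   b]] is orthogonal to those below [a]. *)
have [f Ff fE] : S (L x) by have := Q_sub (L x); rewrite -/z z0 subr0.
have xb : E1 (below b) x = x.
  apply: (pvm_sub p1 bF) => // t /andP[ta tb]; split; first exact: ltW (lt_trans a_gt0 ta).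
  by apply/negP; rewrite -leNgt.
have xf : x = f.
  apply/eqP; rewrite -subr_eq0; apply/eqP/rnorm_eq0/eqP; rewrite eq_le rnorm_ge0 andbT.
  have e : L (x - f) = 0 by rewrite linearB fE subrr.
  have := @below_embedding (x - f); rewrite -/P -LE e rnorm0 mulr0; apply.
  by rewrite linearB xb (sub12 _ Ff).
apply/rnorm_eq0/eqP; rewrite -sqrf_eq0 -rdotxx /rdot {2}xf.
rewrite (pvm_disj p1 bF bb1 _ xF Ff) //.
by apply/seteqP; split => // t [/andP[ta _] [_ nt]].
Qed.

End band.

End operators.

End comparison.

(** * Operators with comparable spectral dimensions are equivalent *)

Section combinations.
Variables (K : pzRingType) (P : Type).

(** The indices are kept formal so that one list can be evaluated both on [e1] and on
    [e2 \o phi]. *)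
Definition combination (V : lmodType K) (g : P -> V) (s : seq (P * K)) :=
  \sum_(q <- s) q.2 *: g q.1.

Lemma combination_cat (V : lmodType K) (g : P -> V) s s' :
  combination g (s ++ s') = combination g s + combination g s'.
Proof. exact: big_cat. Qed.

Lemma combination_scale (V : lmodType K) (g : P -> V) a s :
  combination g [seq (q.1, a * q.2) | q <- s] = a *: combination g s.
Proof.
by rewrite /combination big_map scaler_sumr; apply: eq_bigr => q _; rewrite scalerA.
Qed.

End combinations.

(** The regrouping is chosen before [V] and [g]: the same distinct indices and coefficients must
    serve on both sides of the isomorphism. *)
Lemma combination_regroup_eq (K : pzRingType) (P : eqType) (s : seq (P * K)) :
  exists (n : nat) (b : 'I_n -> P) (a : 'I_n -> K), injective b /\
  forall (V : lmodType K) (g : P -> V), combination g s = \sum_i a i *: g (b i).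
Proof.
pose t := undup [seq q.1 | q <- s].
pose a (p : P) := \sum_(q <- s | q.1 == p) q.2.
exists (size t), (tnth (in_tuple t)), (fun i => a (tnth (in_tuple t) i)).
split=> [|V g]; first by apply/tuple_uniqP; exact: undup_uniq.
rewrite -(big_tnth _ _ t xpredT (fun p => a p *: g p)) /combination.
under [RHS]eq_bigr do rewrite scaler_suml.
rewrite (exchange_big_dep xpredT) //= [LHS]big_seq [RHS]big_seq; apply: eq_bigr => q qs.
have qt : q.1 \in t by rewrite mem_undup; apply/mapP; exists q.
under [RHS]eq_bigl do rewrite eq_sym.
by rewrite -big_filter (filter_pred1_uniq _ qt) ?undup_uniq // big_seq1.
Qed.

Lemma combination_regroup (K : pzRingType) (P : Type) (s : seq (P * K)) :
  exists (n : nat) (b : 'I_n -> P) (a : 'I_n -> K), injective b /\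
  forall (V : lmodType K) (g : P -> V), combination g s = \sum_i a i *: g (b i).
Proof. exact: (@combination_regroup_eq K {classic P}). Qed.

Section adapted.
Variable R : realType.
Local Notation bR := (measurableTypeR R).
Local Notation halfline := (@halfline R).

Lemma closure_add (H : hilbertType R) (A : set H) :
  (forall x y, A x -> A y -> A (x + y)) ->
  forall x y, closure A x -> closure A y -> closure A (x + y).
Proof.
move=> AD x y /closureP cx /closureP cy; apply/closureP => e e0.
have e2 : 0 < e / 2 by rewrite divr_gt0.
have [x' Ax' xx'] := cx _ e2; have [y' Ay' yy'] := cy _ e2.
exists (x' + y'); first exact: AD.
rewrite opprD addrACA; apply: (le_lt_trans (rnormD _ _)).
by rewrite [ltRHS]splitr; exact: ltrD.
Qed.

Lemma hilbert_dim_fun (H : hilbertType R) (F : set H) k : hilbert_dim F k ->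
  exists beta : k -> H, [/\ injective beta, orthonormal_set (range beta) &
    closure (lin_span (range beta)) = F].
Proof.
move=> [B [Bo Bc] /card_set_bijP[f [fS fI fO]]].
have fB : range f = B.
  by apply/seteqP; split => [_ [x _ <-]|b /fO[x _ <-]]; [exact: fS|exists x].
by exists f; rewrite fB; split => // x y; apply: fI; rewrite inE.
Qed.

Definition piece (c rho : R) n : set bR := if n is k.+1 then band c rho k else origin.

Definition piece_lo (c rho : R) n : R := if n is k.+1 then c / rho ^+ k.+1 else 0.

Definition piece_hi (c rho : R) n : R := if n is k.+1 then c / rho ^+ k else 0.

(* Level [0] stands for the kernel and [k.+1] for the band [k]. Only finite
   combinations are considered, which suffices by density and avoids unordered
   infinite sums. *)
Record adapted_basis (H H' : hilbertType R) (T : {linear H -> H'}) (c rho : R)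
    (P : Type) (lev : P -> nat) (e : P -> H) : Prop := {
  ab_inj : injective e;
  ab_orth : orthonormal_set (range e);
  ab_dense : dense [set combination e s | s in [set: seq (P * R[i])]];
  ab_lower : forall n (b : 'I_n -> P) (a : 'I_n -> R[i]), injective b ->
    \sum_i (piece_lo c rho (lev (b i)) * complex.Re `|a i|) ^+ 2 <=
    rnorm (T (\sum_i a i *: e (b i))) ^+ 2;
  ab_upper : forall n (b : 'I_n -> P) (a : 'I_n -> R[i]), injective b ->
    rnorm (T (\sum_i a i *: e (b i))) ^+ 2 <=
    \sum_i (piece_hi c rho (lev (b i)) * complex.Re `|a i|) ^+ 2 }.

Section construction.
Variables (H H' : hilbertType R) (T : {linear H -> H'}) (A : {linear H -> H}).
Variables (E : set bR -> {linear H -> H}) (D : set bR -> Type) (c rho : R).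
Hypotheses (TA : is_modulus T A) (sE : is_spectral_measure A E).
Hypothesis DE : forall S, borel_halfline S -> hilbert_dim (range (E S)) (D S).
Hypotheses (c_gt0 : 0 < c) (rho_gt1 : 1 < rho) (D_above : D (above c) -> False).

Let pE : projection_valued_measure E := sE.1.

(** The cardinals themselves index the basis vectors, so a matching of cardinals is directly a
    matching of bases. *)
Definition dim_points : Type := (D origin + {k & D (band c rho k)})%type.

Definition dim_level (p : dim_points) : nat :=
  match p with inl _ => 0 | inr q => (projT1 q).+1 end.

Let P := dim_points.
Let lev := dim_level.
Let pc := piece c rho.

Lemma borel_piece n : borel_halfline (pc n).
Proof. by case: n => [|n]; [exact: borel_origin|exact: borel_band]. Qed.

Lemma trivIset_piece : trivIset setT pc.
Proof.
move=> [|i] [|j] _ _ // [t [a b]].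
- by have := band_gt0 c_gt0 rho_gt1 b; rewrite a ltxx.
- by have := band_gt0 c_gt0 rho_gt1 a; rewrite b ltxx.
- by congr _.+1; apply: (trivIset_band c_gt0 rho_gt1) => //; exists t.
Qed.

Lemma piece_disj i j : i != j -> pc i `&` pc j = set0.
Proof.
move=> /eqP ij; apply/seteqP; split => // t [a b]; apply: ij.
by apply: trivIset_piece => //; exists t.
Qed.

Lemma bigcup_piece : halfline `\` above c = \bigcup_n pc n.
Proof.
apply/seteqP; split => [t [th /negP]|t [[|n] _]].
- rewrite -leNgt => tc; move: th; rewrite /Defs.halfline /= le_eqVlt => /predU1P[t0|t0].
    by exists 0%N => //; rewrite -t0.
  by have [n nt] := band_cover rho_gt1 t0 tc; exists n.+1.
- by move=> ->; split; [exact: origin_halfline|apply/negP; rewrite -leNgt ltW].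
- move=> nt; split; first exact: (borel_band c_gt0 rho_gt1 n).2 nt.
  apply/negP; rewrite -leNgt; have /andP[_ /le_trans] := nt; apply.
  have := ler_edge c_gt0 rho_gt1 n 0%N; rewrite expr0 divr1 => ->.
  exact: leq0n.
Qed.

Lemma modulus_piece n x : E (pc n) x = x ->
  piece_lo c rho n * rnorm x <= rnorm (T x) <= piece_hi c rho n * rnorm x.
Proof.
have rho0 := lt_trans ltr01 rho_gt1.
case: n => [|n] nx /=.
  have -> : T x = 0 by apply/(kernelE TA sE).
  by rewrite !mul0r rnorm0 lexx.
have e0 m : 0 <= c / rho ^+ m by rewrite divr_ge0 ?exprn_ge0 ?ltW.
have bb := borel_band c_gt0 rho_gt1 n.
apply/andP; split.
  by apply: (modulus_lower TA sE (e0 _) bb) nx => t /andP[h _]; exact: ltW.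
by apply: (modulus_upper TA sE bb) nx => // t /andP[].
Qed.

Lemma above_part x : E (above c) x = 0.
Proof.
have ba := borel_above (ltW c_gt0).
have [beta [_ _ Fb]] := hilbert_dim_fun (DE ba).
have : closure (lin_span (range beta)) (E (above c) x) by rewrite Fb; exists x.
move=> /closureP cl; apply/rnorm_eq0/eqP; rewrite eq_le rnorm_ge0 andbT.
apply/ler_addgt0Pr => e /cl[_ [s [a [sB ->]]]]; rewrite add0r => /ltW.
rewrite big_seq big1 ?subr0 // => b /sB[d _ _]; by case: (D_above d).
Qed.

(** The bases of the spectral subspaces of the pieces are put together. [T] sends different pieces
    to orthogonal vectors, so the bounds on the single pieces add up in square. *)
Lemma adapted_basis_ex : exists e : P -> H, adapted_basis T c rho lev e.
Proof.
have [b0 [b0I b0O b0c]] := hilbert_dim_fun (DE (@borel_origin R)).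
have ex k := hilbert_dim_fun (DE (borel_band c_gt0 rho_gt1 k)).
pose bb k := projT1 (cid (ex k)).
have bbP k : [/\ injective (bb k), orthonormal_set (range (bb k)) &
    closure (lin_span (range (bb k))) = range (E (band c rho k))] := projT2 (cid (ex k)).
pose e (p : P) : H := match p with inl m => b0 m | inr q => bb (projT1 q) (projT2 q) end.
have eE p : E (pc (lev p)) (e p) = e p.
  apply/(pvm_range pE); first exact: borel_piece.
  case: p => [m|[k m]] /=.
    have : range (E origin) (b0 m) by rewrite -b0c; apply/sub_closure/sub_lin_span; exists m.
    by [].
  have [_ _ bbc] := bbP k.
  have : range (E (band c rho k)) (bb k m) by rewrite -bbc; apply/sub_closure/sub_lin_span; exists m.
  by [].
have e1 p : hdot (e p) (e p) = 1.
  case: p => [m|[k m]] /=; first by rewrite b0O ?eqxx //; exists m.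
  by have [_ kO _] := bbP k; rewrite kO ?eqxx //; exists m.
have eO p q : e p <> e q -> hdot (e p) (e q) = 0.
  move=> pq; have [lpq|lpq] := eqVneq (lev p) (lev q); last first.
    by apply: (pvm_disj pE (borel_piece _) (borel_piece _) (piece_disj lpq)); exact: eE.
  move: pq lpq; case: p q => [m|[k m]] [m'|[k' m']] //= pq.
    by move=> _; rewrite b0O ?(negbTE (introN eqP pq)).
  move=> [kk']; subst k'; have [_ kO _] := bbP k.
  by rewrite kO ?(negbTE (introN eqP pq)).
have eI : injective e.
  move=> p q pq; have lpq : lev p = lev q.
    apply/eqP; apply: contraT => lpq.
    have := pvm_disj pE (borel_piece _) (borel_piece _) (piece_disj lpq) (eE p) (eE q).
    by rewrite pq e1 => /eqP; rewrite oner_eq0.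
  move: pq lpq; case: p q => [m|[k m]] [m'|[k' m']] //=.
    by move=> /b0I ->.
  by move=> + [kk']; subst k'; have [kI _ _] := bbP k => /kI ->.
have e_on : orthonormal_set (range e).
  move=> _ _ [p _ <-] [q _ <-]; have [->|/eqP pq] := eqVneq (e p) (e q).
    by rewrite e1.
  by rewrite eO.
(* A combination is regrouped by level; [v j] is its component in piece [j], and the maximal level
   bounds the number of groups. *)
have decomp n (b : 'I_n -> P) (a : 'I_n -> R[i]) : injective b ->
    exists (N : nat) (v : 'I_N -> H) (key : 'I_n -> 'I_N),
    [/\ forall i, val (key i) = lev (b i),
        forall j : 'I_N, rnorm (v j) ^+ 2 = \sum_(i | key i == j) complex.Re `|a i| ^+ 2,
        forall j : 'I_N, E (pc j) (v j) = v j &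
        rnorm (T (\sum_i a i *: e (b i))) ^+ 2 = \sum_j rnorm (T (v j)) ^+ 2].
  move=> bI; pose N := \max_i lev (b i).
  pose key i : 'I_N.+1 := inord (lev (b i)).
  have keyE i : val (key i) = lev (b i) by rewrite /key /= inordK // ltnS; exact: leq_bigmax.
  pose v (j : 'I_N.+1) : H := \sum_(i | key i == j) a i *: e (b i).
  have vE (j : 'I_N.+1) : E (pc j) (v j) = v j.
    by rewrite linear_sum; apply: eq_bigr => i /eqP <-; rewrite linearZ keyE eE.
  exists N.+1, v, key; split => //.
    move=> j; apply: (orthonormal_rnorm_sum e_on) => [i i' /eI/bI//|i].
    by exists (b i).
  rewrite (partition_big key xpredT) //= linear_sum; apply: rnorm_sum_sqr => i j ij.
  by apply: (modulus_orth2 TA sE (borel_piece _) (borel_piece _) (piece_disj ij)); exact: vE.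
exists e; split => //.
- pose W := [set combination e s | s in [set: seq (P * R[i])]].
  have WD x y : W x -> W y -> W (x + y).
    by move=> [s _ <-] [s' _ <-]; exists (s ++ s') => //; rewrite combination_cat.
  have W0 : W 0 by exists [::] => //; rewrite /combination big_nil.
  have spanW k : lin_span (range (bb k)) `<=` W.
    move=> _ [s [a [sB ->]]]; elim: s sB => [|b s IH] sB; first by rewrite big_nil.
    rewrite big_cons; apply: WD; last by apply: IH => d ds; apply: sB; rewrite inE ds orbT.
    have [m _ mb] : range (bb k) b by apply: sB; rewrite inE eqxx.
    exists [:: (inr (existT _ k m) : P, a b)] => //.
    by rewrite /combination big_seq1 /= mb.
  have spanW0 : lin_span (range b0) `<=` W.
    move=> _ [s [a [sB ->]]]; elim: s sB => [|b s IH] sB; first by rewrite big_nil.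
    rewrite big_cons; apply: WD; last by apply: IH => d ds; apply: sB; rewrite inE ds orbT.
    have [m _ mb] : range b0 b by apply: sB; rewrite inE eqxx.
    exists [:: (inl m : P, a b)] => //.
    by rewrite /combination big_seq1 /= mb.
  have pieceW n x : closure W (E (pc n) x).
    case: n => [|n].
      by apply: (closure_subset spanW0); rewrite b0c; exists x.
    by apply: (closure_subset (@spanW n)); have [_ _ ->] := bbP n; exists x.
  apply/denseP => x eps eps0.
  (* With no mass above [c], [x] is the limit of the partial sums of its pieces, each in the closure
     of [W]. *)
  have xE : x = E (\bigcup_n pc n) x.
    rewrite {1}(pvm_split pE x (borel_above (ltW c_gt0))) above_part add0r.
    by rewrite bigcup_piece.
  have /rnorm_cvgP lim := @pvm_sigma_additive _ _ _ pE pc borel_piece trivIset_piece x.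
  have e2 : 0 < eps / 2 by rewrite divr_gt0.
  have [N /(_ N (leqnn N))] := lim _ e2; rewrite -xE => xN.
  have : closure W (\sum_(k < N) E (pc k) x).
    apply: (big_ind (closure W)) => // [|y z]; first exact: sub_closure.
    exact: closure_add.
  move=> /closureP/(_ _ e2)[y Wy yN]; exists y => //.
  by apply: (le_lt_trans (rnorm_tri _ x y)); rewrite [ltRHS]splitr; exact: ltrD xN yN.
- move=> n b a bI; have [N [v [key [keyE vn vE ->]]]] := decomp n b a bI.
  rewrite (partition_big key xpredT) //=; apply: ler_sum => j _.
  have /andP[h _] := modulus_piece (vE j).
  have lo0 : 0 <= piece_lo c rho j.
    by case: (nat_of_ord j) => //= k; rewrite divr_ge0 ?exprn_ge0 ?ltW // (lt_trans ltr01).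
  rewrite (eq_bigr (fun i => piece_lo c rho j ^+ 2 * complex.Re `|a i| ^+ 2)).
    rewrite -mulr_sumr -vn -exprMn ler_sqr ?nnegrE ?mulr_ge0 ?rnorm_ge0 //.
  by move=> i /eqP <-; rewrite -keyE exprMn.
- move=> n b a bI; have [N [v [key [keyE vn vE ->]]]] := decomp n b a bI.
  rewrite [leRHS](partition_big key xpredT) //=; apply: ler_sum => j _.
  have /andP[_ h] := modulus_piece (vE j).
  have hi0 : 0 <= piece_hi c rho j.
    by case: (nat_of_ord j) => //= k; rewrite divr_ge0 ?exprn_ge0 ?ltW // (lt_trans ltr01).
  rewrite [leRHS](eq_bigr (fun i => piece_hi c rho j ^+ 2 * complex.Re `|a i| ^+ 2)).
    rewrite -mulr_sumr -vn -exprMn ler_sqr ?nnegrE ?mulr_ge0 ?rnorm_ge0 //.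
  by move=> i /eqP <-; rewrite -keyE exprMn.
Qed.

End construction.

(** * From a matching of bases to an equivalence *)

Section equivalence.
Variables (H1 H1' H2 H2' : hilbertType R).
Variables (T1 : {linear H1 -> H1'}) (T2 : {linear H2 -> H2'}).
Hypotheses (bT1 : bounded_operator T1) (bT2 : bounded_operator T2).
Hypotheses (dT1 : dense (range T1)) (dT2 : dense (range T2)).
Variables (c rho : R) (P1 P2 : Type) (lev1 : P1 -> nat) (lev2 : P2 -> nat).
Variables (e1 : P1 -> H1) (e2 : P2 -> H2) (phi : P1 -> P2).
Hypotheses (c_gt0 : 0 < c) (rho_gt1 : 1 < rho).
Hypotheses (ab1 : adapted_basis T1 c rho lev1 e1) (ab2 : adapted_basis T2 c rho lev2 e2).
Hypothesis phi_bij : bijective phi.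
Hypothesis phi_zero : forall p, lev1 p = 0%N <-> lev2 (phi p) = 0%N.
Hypothesis phi_lev : forall p,
  (lev1 p <= (lev2 (phi p)).+1)%N /\ (lev2 (phi p) <= (lev1 p).+1)%N.

Let rho_gt0 : 0 < rho := lt_trans ltr01 rho_gt1.

(** One factor [rho] is the width of a band, the other the displacement by one level. The kernel has
    level 0 but is not close to the band of level 1, whence the separate condition on zero
    levels. *)
Lemma piece_hi_lo m n : (n = 0%N <-> m = 0%N) -> (m <= n.+1)%N ->
  piece_hi c rho n <= rho ^+ 2 * piece_lo c rho m.
Proof.
move=> mn0 mn; case: n mn0 mn => [|n] mn0 mn /=; case: m mn0 mn => [|m] mn0 mn /=.
- by rewrite mulr0.
- by have := mn0.1 erefl.
- by have := mn0.2 erefl.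
rewrite -[rho ^+ m.+1]expr1 -exprM muln1 -[leRHS]mulrC -mulrA.
rewrite ler_pM2l // ler_pdivlMl ?exprn_gt0 // ler_pdivrMr ?exprn_gt0 //.
by rewrite -exprD ler_weXn2l ?ltW //; lia.
Qed.

Let G : set (H1 * H2) :=
  [set q | exists s, q = (combination e1 s, combination (e2 \o phi) s)].

Let G_lin (a : R[i]) p q : G p -> G q -> G (a *: p.1 + q.1, a *: p.2 + q.2).
Proof.
move=> [s ->] [s' ->]; exists ([seq (q.1, a * q.2) | q <- s] ++ s').
by rewrite !combination_cat !combination_scale.
Qed.

(** Matched bases are orthonormal, so [U] will even be isometric; the distortion [rho ^+ 2] appears
    only on the target side. *)
Let G_norm p : G p -> rnorm p.1 = rnorm p.2.
Proof.
move=> [s ->] /=; have [n [b [a [bI sE]]]] := combination_regroup s.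
rewrite !sE; apply/eqP; rewrite -(eqrXn2 (n := 2)) ?rnorm_ge0 //; apply/eqP.
have [phi' phiK _] := phi_bij.
rewrite (orthonormal_rnorm_sum (ab_orth ab1)); last 2 first.
- by move=> i j /(ab_inj ab1)/bI.
- by move=> i; exists (b i).
rewrite (orthonormal_rnorm_sum (ab_orth ab2)) //.
by move=> i j /= /(ab_inj ab2)/(can_inj phiK)/bI.
Qed.

Let sqr_le (x y : R) : 0 <= y -> x ^+ 2 <= (rho ^+ 2 * y) ^+ 2 -> x <= rho ^+ 2 * y.
Proof.
move=> y0 h; have [x0|/ltW x0] := leP 0 x; last first.
  by apply: (le_trans x0); rewrite mulr_ge0 // exprn_ge0 // ltW.
by move: h; rewrite ler_sqr ?nnegrE // mulr_ge0 // exprn_ge0 // ltW.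
Qed.

Let term_le m n (r : R) : 0 <= r -> (n = 0%N <-> m = 0%N) -> (m <= n.+1)%N ->
  (piece_hi c rho n * r) ^+ 2 <= (rho ^+ 2) ^+ 2 * (piece_lo c rho m * r) ^+ 2.
Proof.
move=> r0 mn0 mn; rewrite -exprMn mulrA ler_sqr ?nnegrE.
- by rewrite ler_wpM2r // piece_hi_lo.
- rewrite mulr_ge0 //; case: (n) => //= k.
  by rewrite divr_ge0 ?exprn_ge0 ?ltW.
- rewrite !mulr_ge0 ?exprn_ge0 ?(ltW rho_gt0) //; case: (m) => //= k.
  by rewrite divr_ge0 ?exprn_ge0 ?ltW.
Qed.

Let T_le p : G p -> rnorm (T2 p.2) <= rho ^+ 2 * rnorm (T1 p.1) /\
  rnorm (T1 p.1) <= rho ^+ 2 * rnorm (T2 p.2).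
Proof.
move=> [s ->] /=; have [n [b [a [bI sE]]]] := combination_regroup s.
have [phi' phiK _] := phi_bij.
have bI2 : injective (phi \o b) by move=> i j /(can_inj phiK)/bI.
have a0 i : 0 <= complex.Re `|a i| := rnorm_ge0 (a i : R[i]^o).
rewrite !sE; split; apply: sqr_le; rewrite ?rnorm_ge0 //.
  apply: (le_trans (ab_upper ab2 a bI2)); rewrite exprMn.
  apply: le_trans (ler_wpM2l (sqr_ge0 _) (ab_lower ab1 a bI)).
  rewrite mulr_sumr; apply: ler_sum => i _; apply: term_le => //.
    by split=> /phi_zero.
  exact: (phi_lev _).1.
apply: (le_trans (ab_upper ab1 a bI)); rewrite exprMn.
apply: le_trans (ler_wpM2l (sqr_ge0 _) (ab_lower ab2 a bI2)).
rewrite mulr_sumr; apply: ler_sum => i _; apply: term_le => //.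
exact: (phi_lev _).2.
Qed.

Lemma bounded_eq_dense (X Y : normedModType R[i]) (f g : {linear X -> Y}) (W : set X) :
  bounded_operator f -> bounded_operator g -> dense W ->
  (forall x, W x -> f x = g x) -> forall x, f x = g x.
Proof.
move=> /bounded_operatorP[k k0 fk] /bounded_operatorP[l l0 gl] /denseP dW fg x.
apply/eqP; rewrite -subr_eq0; apply/eqP/rnorm_eq0/eqP; rewrite eq_le rnorm_ge0 andbT.
apply: (@ler_arch _ _ _ (k + l)) => e e0; have [y Wy xy] := dW x e e0.
have -> : f x - g x = f (x - y) - g (x - y).
  by rewrite (linearB f) (linearB g) (fg _ Wy) opprB addrA subrK.
rewrite add0r mulrDl; apply: (le_trans (rnormB _ _)).
by apply: lerD; [apply: (le_trans (fk _))|apply: (le_trans (gl _))]; rewrite ler_pM2l // ltW.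
Qed.

Lemma dense_image (X Y : normedModType R[i]) (f : {linear X -> Y}) (W : set X) :
  bounded_operator f -> dense (range f) -> dense W -> dense (f @` W).
Proof.
move=> /bounded_operatorP[k k0 fk] /denseP df /denseP dW; apply/denseP => y e e0.
have ee : 0 < e / 2 by rewrite divr_gt0.
have [_ [x _ <-] yx] := df y _ ee; have [z Wz xz] := dW x _ (divr_gt0 ee k0).
exists (f z); first by exists z.
apply: (le_lt_trans (rnorm_tri (f x) _ _)); rewrite [ltRHS]splitr; apply: ltrD => //.
by rewrite -linearB; apply: (le_lt_trans (fk _)); rewrite mulrC -ltr_pdivlMr.
Qed.

Lemma adapted_equivalent : topologically_equivalent T1 T2.
Proof.
have [phi' phiK phi'K] := phi_bij.
have d1 : dense (fst @` G).
  move: (ab_dense ab1); congr dense; apply/seteqP; split.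
    by move=> _ [s _ <-]; exists (combination e1 s, combination (e2 \o phi) s) => //; exists s.
  by move=> _ [_ [s ->] <-]; exists s.
have d2 : dense (snd @` G).
  move: (ab_dense ab2); congr dense; apply/seteqP; split.
    move=> _ [s _ <-]; pose s' := [seq (phi' q.1, q.2) | q <- s].
    exists (combination e1 s', combination (e2 \o phi) s'); first by exists s'.
    rewrite /= /combination big_map; apply: eq_bigr => q _ /=.
    by rewrite phi'K.
  move=> _ [_ [s ->] <-]; exists [seq (phi q.1, q.2) | q <- s] => //=.
  by rewrite /combination big_map.
have [U [Ui [UP UE]]] : exists (U : {linear H1 -> H2}) (Uinv : {linear H2 -> H1}),
    isomorphism_onto U Uinv /\ forall p, G p -> U p.1 = p.2.
  apply: (@isomorphism_of_relation _ H1 H2 G 1) => //; move=> p /G_norm ->;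
    by rewrite mul1r.
(* [T_le] gives the two-sided bound for [G'], and density of the images of [T1] and [T2] makes both
   its projections dense. *)
pose G' : set (H1' * H2') := [set q | exists2 p, G p & q = (T1 p.1, T2 p.2)].
have [V [Vi [VP VE]]] : exists (V : {linear H1' -> H2'}) (Vinv : {linear H2' -> H1'}),
    isomorphism_onto V Vinv /\ forall p, G' p -> V p.1 = p.2.
  apply: (@isomorphism_of_relation _ H1' H2' G' (rho ^+ 2)).
  - exact: sqr_ge0.
  - move=> a _ _ [p Gp ->] [q Gq ->]; exists (a *: p.1 + q.1, a *: p.2 + q.2).
      exact: G_lin.
    by rewrite /= !linearP.
  - by move=> _ [p /T_le[? _] ->].
  - by move=> _ [p /T_le[_ ?] ->].
  - move: (dense_image bT1 dT1 d1); congr dense; apply/seteqP; split.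
      by move=> _ [_ [p Gp <-] <-]; exists (T1 p.1, T2 p.2) => //; exists p.
    by move=> _ [_ [p Gp ->] <-]; exists p.1 => //; exists p.
  - move: (dense_image bT2 dT2 d2); congr dense; apply/seteqP; split.
      by move=> _ [_ [p Gp <-] <-]; exists (T1 p.1, T2 p.2) => //; exists p.
    by move=> _ [_ [p Gp ->] <-]; exists p.2 => //; exists p.
have [bU bUi UK UiK] := UP; have [bV _ _ _] := VP.
exists U, Ui, V, Vi; split => // x; rewrite -{1}(UiK x) /=.
move: (Ui x) => {}x.
pose f : {linear H1 -> H2'} := T2 \o U; pose g : {linear H1 -> H2'} := V \o T1.
have comp_bounded (X Y Z : normedModType R[i]) (h : {linear Y -> Z}) (k : {linear X -> Y}) :
    bounded_operator h -> bounded_operator k -> bounded_operator (h \o k : {linear X -> Z}).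
  move=> /bounded_operatorP[a a0 ha] /bounded_operatorP[b b0 kb].
  apply/bounded_operatorP; exists (a * b) => [|y]; first exact: mulr_gt0.
  by apply: (le_trans (ha _)); rewrite -mulrA ler_pM2l.
apply: (@bounded_eq_dense _ _ f g _ _ _ d1); try exact: comp_bounded.
move=> _ [p Gp <-]; rewrite /f /g /= UE //.
by have /= -> // := VE (T1 p.1, T2 p.2); exists p.
Qed.

End equivalence.

End adapted.

(** * The two implications *)

Section final.
Variable R : realType.
Local Notation bR := (measurableTypeR R).
Local Notation halfline := (@halfline R).

Lemma topologically_equivalent_sym (X1 Y1 X2 Y2 : completeNormedModType R[i])
    (T1 : {linear X1 -> Y1}) (T2 : {linear X2 -> Y2}) :
  topologically_equivalent T1 T2 -> topologically_equivalent T2 T1.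
Proof.
move=> [U [Ui [V [Vi [[bU bUi UK UiK] [bV bVi VK ViK] TE]]]]].
by exists Ui, U, Vi, V; split => // x; rewrite TE UK VK.
Qed.

(** Allowing every larger constant lets both directions of the comparison use the same factor. *)
Lemma equivalent_dominated (H1 H1' H2 H2' : hilbertType R)
    (T1 : {linear H1 -> H1'}) (T2 : {linear H2 -> H2'}) (D1 D2 : set bR -> Type) :
  is_dim_spectral_measure T1 D1 -> is_dim_spectral_measure T2 D2 ->
  (D1 set0 -> False) -> topologically_equivalent T1 T2 ->
  exists2 C0, 1 <= C0 & forall C, C0 <= C -> dominated (4 * C ^+ 2) D1 D2.
Proof.
move=> [A1 [E1 [TA1 sE1 d1]]] [A2 [E2 [TA2 sE2 d2]]] D10.
move=> [U [Ui [V [Vi [[bU bUi UK UiK] [bV bVi VK ViK] TE]]]]].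
move: bU bUi bV bVi => /bounded_operatorP[u u0 uP] /bounded_operatorP[u' u0' uP'].
move=> /bounded_operatorP[v v0 vP] /bounded_operatorP[v' v0' vP'].
exists (1 + u + u' + v + v'); first by rewrite -!addrA lerDl !addr_ge0 ?ltW.
move=> C CC.
have [C1 Cu Cu' Cv Cv'] : [/\ 1 <= C, u <= C, u' <= C, v <= C & v' <= C].
  by clear - CC u0 u0' v0 v0'; split; lra.
have le (X Y : normedModType R[i]) (f : X -> Y) k : k <= C ->
    (forall x, rnorm (f x) <= k * rnorm x) -> forall x, rnorm (f x) <= C * rnorm x.
  by move=> kC fk x; apply: (le_trans (fk x)); rewrite ler_wpM2r // rnorm_ge0.
have TU x : T2 (U x) = V (T1 x) by rewrite TE UK.
have U_le := le _ _ _ u Cu uP; have Ui_le := le _ _ _ u' Cu' uP'.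
have T21 x : rnorm (T2 (U x)) <= C * rnorm (T1 x).
  by rewrite TU; exact: (le _ _ _ v).
have T12 x : rnorm (T1 x) <= C * rnorm (T2 (U x)).
  by rewrite TU -{1}(VK (T1 x)); exact: (le _ _ _ v').
split.
  have bo := @borel_origin R.
  exact: (kernel_dim_le TA1 sE1 TA2 sE2 UK U_le T21 (d1 _ bo) (d2 _ bo)).
(* For [b <= a] the interval is empty; this is where [D1 set0] has to be empty. *)
move=> a b a0; have [ab|ba] := ltP a b; last first.
  apply/card_leTTP; have -> : oc a b = set0.
    apply/seteqP; split => // t /andP[at_ tb].
    by have := lt_le_trans at_ (le_trans tb ba); rewrite ltxx.
  by exists (fun m => False_rect _ (D10 m)) => m; case: (D10 m).
have C4 : 0 < 4 * C ^+ 2 by rewrite mulr_gt0 // exprn_gt0 // (lt_le_trans ltr01).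
apply: (band_dim_le TA1 sE1 TA2 sE2 C1 UK UiK U_le Ui_le T21 T12 a0 ab).
  exact/d1/borel_oc/ltW.
by apply/d2/borel_oc; rewrite divr_ge0 ?ltW.
Qed.

(** Domination speaks of bounded intervals only, so the unbounded part is cut into intervals of
    length 1; dividing their left ends by [K] keeps them above [c]. *)
Lemma dominated_above mu mu' K c : 0 < K -> 0 < c ->
  cardinal_measure halfline mu -> cardinal_measure halfline mu' ->
  dominated K mu mu' -> (mu' (above c) -> False) -> mu (above (K * c)) -> False.
Proof.
move=> K0 c0 cm cm' [_ dom] nc.
have Kc0 : 0 < K * c by rewrite mulr_gt0.
pose F k := oc (K * c + k%:R) (K * c + k.+1%:R).
have lo0 k : 0 < K * c + k%:R by rewrite ltr_pwDl.
have bF k : borel_halfline (F k) by apply: borel_oc; exact: ltW.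
have tF : trivIset setT F.
  have lt i j (t : bR) : F i t -> F j t -> (i <= j)%N.
    move=> /andP[it _] /andP[_ tj]; have := lt_le_trans it tj.
    by rewrite ltrD2l ltr_nat ltnS.
  by move=> i j _ _ [t [it jt]]; apply/eqP; rewrite eqn_leq (lt _ _ _ it jt) (lt _ _ _ jt it).
have F0 k : mu (F k) -> False.
  have /card_leTTP[f _] := dom _ (K * c + k.+1%:R) (lo0 k) => /f.
  apply: (card_null_subset cm' (measurable_above c)) => //.
  - exact: measurable_oc.
  - by apply: above_halfline; exact: ltW.
  move=> t /andP[h _]; apply: le_lt_trans h; rewrite ler_pdivlMr //.
  by rewrite mulrC lerDl.
have -> : above (K * c) = \bigcup_k F k.
  apply/seteqP; split => [t ht|t [k _ /andP[h _]]]; last first.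
    by apply: le_lt_trans h; rewrite lerDl.
  have d0 : 0 < (t : R) - K * c by rewrite subr_gt0.
  have ex : exists n, (t : R) <= K * c + n.+1%:R.
    exists (Num.truncn ((t : R) - K * c)); rewrite -lerBlDl; exact/ltW/truncnS_gt.
  exists (ex_minn ex) => //; case: ex_minnP => m mt mn; rewrite /F /oc /= mt andbT.
  case: m mt mn => [|m] mt mn; first by rewrite addr0.
  by rewrite ltNge; apply/negP => /mn; rewrite ltnn.
by have /same_cardinalP[f _] := cardinal_measure_sigma_additive cm bF tF => /f[k /F0].
Qed.

Lemma dominated_equivalent (H1 H1' H2 H2' : hilbertType R)
    (T1 : {linear H1 -> H1'}) (T2 : {linear H2 -> H2'}) (D1 D2 : set bR -> Type) K c :
  bounded_operator T1 -> bounded_operator T2 -> dense (range T1) -> dense (range T2) ->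
  is_dim_spectral_measure T1 D1 -> is_dim_spectral_measure T2 D2 ->
  cardinal_measure halfline D1 -> cardinal_measure halfline D2 ->
  0 < c -> (D1 (above c) -> False) -> (D2 (above c) -> False) ->
  1 < K -> dominated K D1 D2 -> dominated K D2 D1 -> topologically_equivalent T1 T2.
Proof.
move=> bT1 bT2 dT1 dT2 [A1 [E1 [TA1 sE1 d1]]] [A2 [E2 [TA2 sE2 d2]]] c1 c2 c0 n1 n2 K1 d12 d21.
have K0 := lt_trans ltr01 K1.
have bp (D : set bR -> Type) : cardinal_measure halfline D -> (D (above c) -> False) ->
    band_partition c K D (band c K) id.
  move=> cD nD; split => //.
  - exact: borel_band.
  - by move=> k t.
  - exact: trivIset_band.
  - rewrite [X in _ `\` X](_ : _ = halfline `\` above c) ?setDD ?setIidr //.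
      by apply: above_halfline; exact: ltW.
    rewrite (@bigcup_piece _ c K) //; apply/seteqP; split=> [t [t0|[k _ kt]]|t [[|k] _ kt]].
    + by exists 0%N.
    + by exists k.+1.
    + by left.
    + by right; exists k.
have [h hb hP] := band_matching c0 K1 K0 (lexx K) (bp _ c1 n1) (bp _ c2 n2) d12 d21.
have /same_cardinalP[h0 h0b] : same_cardinal (D1 origin) (D2 origin).
  exact: same_cardinal_le d12.1 d21.1.
pose phi (x : dim_points D1 c K) : dim_points D2 c K :=
  match x with inl m => inl (h0 m) | inr y => inr (h y) end.
have phib : bijective phi.
  have [g hK gK] := hb; have [g0 h0K g0K] := h0b.
  exists (fun x => match x with inl m => inl (g0 m) | inr y => inr (g y) end).
    by case=> ? /=; rewrite ?h0K ?hK.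
  by case=> ? /=; rewrite ?g0K ?gK.
have [e1 ab1] := adapted_basis_ex TA1 sE1 d1 c0 K1 n1.
have [e2 ab2] := adapted_basis_ex TA2 sE2 d2 c0 K1 n2.
apply: (adapted_equivalent bT1 bT2 dT1 dT2 c0 K1 ab1 ab2 phib); case=> [m|y] //=.
by have [? ?] := hP y.
Qed.

End final.

Theorem theorem12 (R : realType) (H1 H1' H2 H2' : hilbertType R)
    (T : {linear H1 -> H1'}) (T' : {linear H2 -> H2'})
    (M M' : set (measurableTypeR R) -> Type)
    (hT : bounded_operator T) (hT' : bounded_operator T')
    (dT : dense (range T)) (dT' : dense (range T'))
    (hM : eigenvalue_sequence T M) (hM' : eigenvalue_sequence T' M') :
  topologically_equivalent T T' <-> log_bounded_shift M M'.
Proof.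
have [cM [[D dD sD] [lam [_ [lam0 lamd _ _ nM]]]]] := hM.
have [cM' [[D' dD' sD'] [lam' [_ [lam0' lamd' _ _ nM']]]]] := hM'.
have cD := log_bounded_shift_measure sD; have cD' := log_bounded_shift_measure sD'.
have [K1 K11 [DM MD]] := log_bounded_shift_dominated sD.
have [K2 K21 [DM' MD']] := log_bounded_shift_dominated sD'.
have K10 := lt_trans ltr01 K11; have K20 := lt_trans ltr01 K21.
have mul_gt1 (x y : R) : 1 < x -> 1 < y -> 1 < x * y.
  by move=> x1 y1; rewrite -[ltLHS]mul1r ltr_pM // ltW.
split=> [TT'|/log_bounded_shift_dominated[K K_gt1 [MM' M'M]]].
  have [C C1 CP] := equivalent_dominated dD dD' (cardinal_measure0 cD) TT'.
  have [C' C1' CP'] := equivalent_dominated dD' dD (cardinal_measure0 cD')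
    (topologically_equivalent_sym TT').
  pose K := 4 * (Num.max C C') ^+ 2.
  have DD' : dominated K D D' by apply: CP; rewrite le_max lexx.
  have D'D : dominated K D' D by apply: CP'; rewrite le_max lexx orbT.
  have K_gt1 : 1 < K.
    have m1 : 1 <= Num.max C C' by rewrite le_max C1.
    by apply: (@lt_le_trans _ _ 4); [rewrite ltr1n|rewrite ler_peMr // exprn_ege1].
  have K0 := lt_trans ltr01 K_gt1.
  (* The factors come from the chain [M], [D], [D'], [M']: [K1] and [K2] from the definition of the
     eigenvalue sequences, [K] from the equivalence. *)
  apply: (@atomic_log_bounded_shift _ _ _ lam lam' (K1 * K * K2)) => //.
  - by apply: (mul_gt1 _ _ (mul_gt1 _ _ K11 K_gt1) K21).
  - apply: dominated_trans DM'; first exact: mulr_gt0.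
    exact: dominated_trans MD DD'.
  - rewrite -mulrA mulrC; apply: dominated_trans DM; first exact: mulr_gt0.
    by rewrite mulrC; exact: dominated_trans MD' D'D.
have K0 := lt_trans ltr01 K_gt1.
have nD := dominated_above K10 (lam0 0%N) cD cM DM (atomic_above cM lam0 lamd nM).
have nD' := dominated_above K20 (lam0' 0%N) cD' cM' DM' (atomic_above cM' lam0' lamd' nM').
(* [M] and [M'] vanish above their first atoms, so [D] and [D'] vanish above these atoms multiplied
   by the factors of their shifts. *)
pose c := Num.max (K1 * lam 0%N) (K2 * lam' 0%N).
have c0 : 0 < c by rewrite lt_max mulr_gt0.
have above_null (mu : set (measurableTypeR R) -> Type) x : 0 < x -> x <= c ->
    cardinal_measure (@halfline R) mu -> (mu (above x) -> False) -> mu (above c) -> False.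
  move=> x0 xc cmu; apply: (card_null_subset cmu).
  - exact: measurable_above.
  - exact: measurable_above.
  - exact/above_halfline/ltW.
  - by move=> t; exact: le_lt_trans.
apply: (@dominated_equivalent _ _ _ _ _ _ _ D D' (K1 * K * K2) c) => //.
- by apply: above_null cD nD; rewrite ?mulr_gt0 // le_max lexx.
- by apply: above_null cD' nD'; rewrite ?mulr_gt0 // le_max lexx orbT.
- exact: (mul_gt1 _ _ (mul_gt1 _ _ K11 K_gt1) K21).
- apply: dominated_trans MD'; first exact: mulr_gt0.
  exact: dominated_trans DM MM'.
- rewrite -mulrA mulrC; apply: dominated_trans MD; first exact: mulr_gt0.
  by rewrite mulrC; exact: dominated_trans DM' M'M.
Qed.
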